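(* Let $n\ge1$ and let $f\colon\mathbb{R}\to\mathbb{R}$ be locally Lipschitz continuous and non-decreasing with $f(0)=0$. Put $\ell(s)=\sup_{0<|t|\le s}\frac{f(t)}{t}$ for $s>0$, $\ell(0)=0$. For $\phi\in L^1(\mathbb{R}^n)\cap L^\infty(\mathbb{R}^n)$ let $u_c(t;\phi)$ denote the unique classical $L^\infty$-solution of $$u_t=\Delta u+f(u),\qquad u(0)=\phi,$$ with maximal (in $L^\infty$) interval of existence $[0,T_{\rm max}(\phi))$. If $$\int_0^1s^{-(1+2/n)}\ell(s)\,ds<\infty,$$ then for any $A>1$ there exists $\delta=\delta(A)>0$ such that for all $\phi\in L^1(\mathbb{R}^n)\cap L^\infty(\mathbb{R}^n)$ satisfying $\|\phi\|_1+\|\phi\|_\infty\le\delta$ we have $T_{\rm max}(\phi)=\infty$ and $$AS(t)\phi^-\le u_c(t;\phi)\le AS(t)\phi^+\qquad\text{for all }t\ge0 .$$ Consequently $\|u_c(t;\phi)\|_\infty\le At^{-n/2}\|\phi\|_1$ for all $t>0$.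
   Context: $\|\cdot\|_q$ denotes the norm of $L^q(\mathbb{R}^n)$. $S(t)$ is the heat semigroup: $[S(t)\phi](x)=\int_{\mathbb{R}^n}(4\pi t)^{-n/2}e^{-|x-y|^2/4t}\phi(y)\,dy$ for $t>0$, $S(0)=\mathrm{Id}$. $\phi^+=\max\{\phi,0\}$ and $\phi^-=\min\{\phi,0\}\le0$. A classical $L^\infty$-solution on $[0,T)$ is meant in the standard sense: $u\in C^{2,1}(\mathbb{R}^n\times(0,T))$ satisfies the equation pointwise in $\mathbb{R}^n\times(0,T)$, $u\in L^\infty_{\rm loc}([0,T),L^\infty(\mathbb{R}^n))$, and $\|u(t)-S(t)\phi\|_\infty\to0$ as $t\to0$. Since $f$ is locally Lipschitz, for every $\phi\in L^\infty(\mathbb{R}^n)$ there is a unique such solution on a maximal interval $[0,T_{\rm max}(\phi))$, $T_{\rm max}(\phi)\in(0,\infty]$ (standard fact). *)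

(* Defs.v *)
From HB Require Import structures.
From mathcomp Require Import all_boot all_order all_algebra.
From mathcomp Require Import all_classical all_reals all_analysis.

Set Implicit Arguments.
Unset Strict Implicit.
Unset Printing Implicit Defensive.
Import Order.TTheory GRing.Theory Num.Theory.
Import numFieldNormedType.Exports.

Local Open Scope classical_set_scope.
Local Open Scope ring_scope.

Definition coor (R : realType) (n : nat) (i : 'I_n) (v : 'rV[R]_n) :
  measurableTypeR R := v ord0 i.

(* Row vectors carry the sigma-algebra generated by the coordinates, which is
   the Borel one. *)
Section measurable_row.
Context {R : realType} (n : nat).

Let row_set0 : g_sigma_preimage (@coor R n) set0.
Proof. exact: sigma_algebra0. Qed.

Let row_setC A :
  g_sigma_preimage (@coor R n) A -> g_sigma_preimage (@coor R n) (~` A).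
Proof. exact: sigma_algebraC. Qed.

Let row_bigcup (F : (set 'rV[R]_n)^nat) :
  (forall i, g_sigma_preimage (@coor R n) (F i)) ->
  g_sigma_preimage (@coor R n) (\bigcup_i (F i)).
Proof. exact: sigma_algebra_bigcup. Qed.

HB.instance Definition _ := @isMeasurable.Build default_measure_display
  'rV[R]_n (g_sigma_preimage (@coor R n)) row_set0 row_setC row_bigcup.

End measurable_row.

Lemma measurable_coor (R : realType) n (i : 'I_n) :
  measurable_fun [set: 'rV[R]_n] (coor i).
Proof.
move=> _ Y mY; rewrite setTI; apply: sub_sigma_algebra => /=.
rewrite -bigcup_seq/=; exists i => /=; first by rewrite mem_index_enum.
by exists Y => //; rewrite setTI.
Qed.

Lemma measurable_fun_rowP (R : realType) n d (T : measurableType d)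
    (f : T -> 'rV[R]_n) :
  (forall i, measurable_fun [set: T] (coor i \o f)) ->
  measurable_fun [set: T] f.
Proof.
move=> mf _ Y mY; rewrite setTI.
suff : g_sigma_preimage (@coor R n) `<=` [set A | measurable (f @^-1` A)].
  exact.
apply: smallest_sub => /=.
  split => /= [|A mA|F mF]; first by rewrite preimage_set0.
    by rewrite setTD preimage_setC; exact: measurableC.
  by rewrite preimage_bigcup; exact: bigcupT_measurable.
move=> A; rewrite -bigcup_seq/= => -[i _ [B mB <-]].
by rewrite setTI -comp_preimage -[X in measurable X]setTI; exact: mf.
Qed.

Definition row_cons (R : realType) n (p : measurableTypeR R * 'rV[R]_n) :
  'rV[R]_n.+1 := row_mx (const_mx p.1 : 'rV[R]_1) p.2.

Definition row_uncons (R : realType) n (v : 'rV[R]_n.+1) :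
  measurableTypeR R * 'rV[R]_n := (coor ord0 v, rsubmx (v : 'rV[R]_(1 + n))).

Lemma row_cons0 (R : realType) n (p : measurableTypeR R * 'rV[R]_n) :
  coor ord0 (row_cons p) = p.1.
Proof.
rewrite /coor /row_cons (_ : ord0 = lshift n (ord0 : 'I_1)); last exact/val_inj.
by apply: (etrans (row_mxEl _ _ _ _)); rewrite mxE.
Qed.

Lemma row_consS (R : realType) n (p : measurableTypeR R * 'rV[R]_n) (i : 'I_n) :
  coor (lift ord0 i) (row_cons p) = coor i p.2.
Proof.
rewrite /coor /row_cons (_ : lift ord0 i = rshift 1 i); last exact/val_inj.
exact: row_mxEr.
Qed.

Lemma row_unconsS (R : realType) n (v : 'rV[R]_n.+1) (i : 'I_n) :
  coor i (row_uncons v).2 = coor (lift ord0 i) v.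
Proof.
rewrite /coor /row_uncons /= mxE; congr (v _ _); exact/val_inj.
Qed.

Lemma row_unconsK (R : realType) n : cancel (@row_uncons R n) (@row_cons R n).
Proof.
move=> v; apply/rowP => i; rewrite -!/(coor i _).
case: (unliftP ord0 i) => [j|] ->; last exact: row_cons0.
by rewrite -!/(coor _ _) row_consS row_unconsS.
Qed.

Lemma row_consK (R : realType) n : cancel (@row_cons R n) (@row_uncons R n).
Proof.
move=> p; rewrite [RHS]surjective_pairing; congr (_, _); first exact: row_cons0.
by apply/rowP => i; have := row_unconsS (row_cons p) i; rewrite row_consS.
Qed.

Lemma measurable_row_cons (R : realType) n :
  measurable_fun [set: measurableTypeR R * 'rV[R]_n] (@row_cons R n).
Proof.
apply: measurable_fun_rowP => i.
case: (unliftP ord0 i) => [j|] ->.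
  rewrite (_ : _ \o _ = coor j \o snd); last by apply/funext => p; exact: row_consS.
  exact: (measurableT_comp (measurable_coor j) measurable_snd).
rewrite (_ : _ \o _ = fst); last by apply/funext => p; exact: row_cons0.
exact: measurable_fst.
Qed.

Lemma measurable_row_uncons (R : realType) n :
  measurable_fun [set: 'rV[R]_n.+1] (@row_uncons R n).
Proof.
apply: measurable_fun_pair; first exact: measurable_coor.
apply: measurable_fun_rowP => i.
rewrite (_ : _ \o _ = coor (lift ord0 i)); first exact: measurable_coor.
by apply/funext => v; exact: row_unconsS.
Qed.

Section lebesgue_rowS.
Context {R : realType} (n : nat).
Variable mu : {sigma_finite_measure set 'rV[R]_n -> \bar R}.

Definition lebesgue_rowS : set 'rV[R]_n.+1 -> \bar R :=
  pushforward (@lebesgue_measure R \x mu)%E (@row_cons R n).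

Let rowS0 : lebesgue_rowS set0 = 0%E.
Proof. by rewrite /lebesgue_rowS /pushforward preimage_set0 measure0. Qed.

Let rowS_ge0 A : (0 <= lebesgue_rowS A)%E.
Proof. by rewrite /lebesgue_rowS /pushforward; exact: measure_ge0. Qed.

Let rowS_sigma_additive : semi_sigma_additive lebesgue_rowS.
Proof.
have mcons B : measurable B -> measurable (@row_cons R n @^-1` B).
  by move=> mB; rewrite -[X in measurable X]setTI; exact: measurable_row_cons.
move=> F mF tF mUF; rewrite /lebesgue_rowS /pushforward preimage_bigcup.
apply: measure_semi_sigma_additive.
- by move=> k; exact: mcons.
- apply/trivIsetP => /= i j _ _ ij; rewrite -preimage_setI.
  by move/trivIsetP : tF => /(_ _ _ _ _ ij) ->//; rewrite preimage_set0.
- by rewrite -preimage_bigcup; exact: mcons.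
Qed.

HB.instance Definition _ := isMeasure.Build _ _ _ lebesgue_rowS
  rowS0 rowS_ge0 rowS_sigma_additive.

Let lebesgue_rowS_sigma_finite : sigma_finite setT lebesgue_rowS.
Proof.
have /sigma_finiteP[F [TF ndF Foo]] := sigma_finiteT (@lebesgue_measure R).
have /sigma_finiteP[G [TG ndG Goo]] := sigma_finiteT mu.
exists (fun k => @row_uncons R n @^-1` (F k `*` G k)).
  rewrite -preimage_bigcup; apply/seteqP; split => // v _.
  have [k _ Fk] : (\bigcup_k F k) (row_uncons v).1 by rewrite -TF.
  have [l _ Gl] : (\bigcup_k G k) (row_uncons v).2 by rewrite -TG.
  exists (maxn k l) => //; split.
  - by have /subsetPset := ndF _ _ (leq_maxl k l); exact.
  - by have /subsetPset := ndG _ _ (leq_maxr k l); exact.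
move=> k; have [mF Fkoo] := Foo k; have [mG Gkoo] := Goo k; split.
  rewrite -[X in measurable X]setTI; apply: measurable_row_uncons => //.
  exact: measurableX.
rewrite /lebesgue_rowS /pushforward -comp_preimage.
rewrite (_ : _ \o _ = id); last by apply/funext; exact: row_consK.
by rewrite preimage_id product_measure1E// lte_mul_pinfty// ge0_fin_numE.
Qed.

HB.instance Definition _ := @Measure_isSigmaFinite.Build _ _ _
  lebesgue_rowS lebesgue_rowS_sigma_finite.

End lebesgue_rowS.

(* Lebesgue measure on R^n, as an iterated product; see lebesgue_row_box. *)
Fixpoint lebesgue_row (R : realType) (n : nat) :
    {sigma_finite_measure set 'rV[R]_n -> \bar R} :=
  match n with
  | 0 => [the {sigma_finite_measure set 'rV[R]_0 -> \bar R} of dirac (0 : 'rV[R]_0)]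
  | m.+1 => [the {sigma_finite_measure set 'rV[R]_m.+1 -> \bar R} of
      lebesgue_rowS (lebesgue_row R m)]
  end.

Lemma lebesgue_row_box (R : realType) n (A : 'I_n -> set (measurableTypeR R)) :
  (forall i, measurable (A i)) ->
  lebesgue_row R n [set v | forall i, A i (coor i v)] =
  (\prod_(i < n) lebesgue_measure (A i))%E.
Proof.
elim: n A => [|n IHn] A mA.
  rewrite big_ord0 /= diracE mem_set//.
  by case.
rewrite big_ord_recl /= -IHn// -product_measure1E//; last first.
  rewrite (_ : mkset _ = \bigcap_(i in [set: 'I_n])
    (coor i @^-1` A (lift ord0 i))); last first.
    by apply/seteqP; split => v /= h i; [move=> _|]; exact: h.
  apply: fin_bigcap_measurable => // i _.
  by rewrite -[X in measurable X]setTI; exact: measurable_coor.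
rewrite /lebesgue_rowS /pushforward; congr (_ _).
apply/seteqP; split => [p h|p [h0 hS] i] /=.
  split; first by have := h ord0; rewrite row_cons0.
  by move=> i; have := h (lift ord0 i); rewrite row_consS.
case: (unliftP ord0 i) => [j|] ->; last by rewrite row_cons0.
by rewrite row_consS; exact: hS.
Qed.

Section heat_equation.
Context {R : realType} {n : nat}.
Implicit Types (f : R -> R) (phi : 'rV[R]_n -> R) (u : R -> 'rV[R]_n -> R).

(* The library norm on row vectors is the sup norm; this is the square of the
   Euclidean norm. *)
Definition sqr_euclidean (x : 'rV[R]_n) : R := \sum_(i < n) x ord0 i ^+ 2.

Definition heat_kernel (t : R) (x : 'rV[R]_n) : R :=
  (4 * pi * t) `^ (- (n%:R / 2)) * expR (- (sqr_euclidean x / (4 * t))).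

Definition heat_semigroup (t : R) phi (x : 'rV[R]_n) : R :=
  if 0 < t then \int[lebesgue_row R n]_y (heat_kernel t (x - y) * phi y)
  else phi x.

Definition partial (i : 'I_n) (g : 'rV[R]_n -> R) : 'rV[R]_n -> R :=
  'D_(delta_mx ord0 i) g.

Definition partial_t u (t : R) (x : 'rV[R]_n) : R := 'D_1 (u ^~ x) t.

Definition laplacian (g : 'rV[R]_n -> R) (x : 'rV[R]_n) : R :=
  \sum_(i < n) partial i (partial i g) x.

Definition jointly_continuous_at u (t : R) (x : 'rV[R]_n) : Prop :=
  {for (t, x), continuous (fun p : R * 'rV[R]_n => u p.1 p.2)}.

Definition C21 (T : \bar R) u : Prop :=
  forall t x, 0 < t -> (t%:E < T)%E ->
  [/\ jointly_continuous_at u t x,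
      derivable (u ^~ x) t 1 /\ jointly_continuous_at (partial_t u) t x,
      forall i, derivable (u t) x (delta_mx ord0 i) /\
        jointly_continuous_at (fun s => partial i (u s)) t x
    & forall i j, derivable (partial i (u t)) x (delta_mx ord0 j) /\
        jointly_continuous_at (fun s => partial j (partial i (u s))) t x].

Definition Lq_norm (q : \bar R) (g : 'rV[R]_n -> R) : \bar R :=
  Lnorm (lebesgue_row R n) q (EFin \o g).

(* Classical L^oo-solutions on [0, T) of u_t = Laplacian u + f(u), u(0) = phi.
   The values of u at times outside [0, T) are irrelevant; u 0 is the given
   representative phi of the initial datum. *)
Definition classical_solution f phi (T : \bar R) u : Prop :=
  [/\ (0 < T)%E /\ u 0 = phi,
      C21 T u,
      forall t x, 0 < t -> (t%:E < T)%E ->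
        partial_t u t x = laplacian (u t) x + f (u t x),
      forall T' : R, (T'%:E < T)%E ->
        exists M : R, forall t, 0 <= t <= T' -> (Lq_norm +oo (u t) <= M%:E)%E
    & (fun t => Lq_norm +oo (fun x => u t x - heat_semigroup t phi x)) @ 0^'+
        --> 0%E].

(* u is the unique classical L^oo-solution on its maximal interval of existence
   [0, T), i.e. u = u_c( . ; phi) and T = T_max(phi). *)
Definition maximal_solution f phi (T : \bar R) u : Prop :=
  classical_solution f phi T u /\
  forall T' v, classical_solution f phi T' v ->
    (T' <= T)%E /\ forall t, 0 <= t -> (t%:E < T')%E -> v t = u t.

End heat_equation.

Definition locally_lipschitz (R : realType) (f : R -> R) : Prop :=
  forall x : R, exists2 r : R, 0 < r & [lipschitz f y | y in ball x r].

(* The supremum is that of a nonempty bounded set when f is locally Lipschitz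
   and f 0 = 0. *)
Definition ell (R : realType) (f : R -> R) (s : R) : R :=
  if 0 < s then sup [set f t / t | t in [set t : R | 0 < `|t| <= s]] else 0.

(* Main.v *)
Require Import Defs.
From HB Require Import structures.
From mathcomp Require Import all_boot all_order all_algebra.
From mathcomp Require Import all_classical all_reals all_analysis.
From mathcomp Require Import measurable_realfun ess_sup_inf ring lra.

Set Implicit Arguments.
Unset Strict Implicit.
Unset Printing Implicit Defensive.
Import Order.TTheory GRing.Theory Num.Theory.
Import numFieldNormedType.Exports.

Local Open Scope classical_set_scope.
Local Open Scope ring_scope.

(** The solution is the fixed point of the Duhamel map
<<
    u(t)  |->  S(t) phi + int_0^t S(t - s) f(u(s)) ds
>>
between the barriers [A S(t) phi^-] and [A S(t) phi^+].

Why the map preserves this order interval: as [f] is nondecreasing and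
[f z <= ell s * z] for [0 <= z <= s], every [u] below the upper barrier
satisfies [f(u(s)) <= Lambda(s) A S(s) phi^+], where [Lambda(s)] is [ell] at a
bound of the sup norm of [A S(s) phi^+]. By the semigroup law
[S(t - s) S(s) = S(t)] the function [S(t) phi^+] leaves the time integral, so
that the image is at most
[(1 + A int_0^t Lambda) S(t) phi^+], hence at most [A S(t) phi^+] once
[int_0^oo Lambda <= 1 - 1/A]; the lower barrier is symmetric. If the [L^1] and
[L^oo] norms of [phi] are at most [b/A], then [A S(s) phi^+] is at most
[b min(1, s^(-n/2))]. Cutting time into the intervals where [s^(-n/2)] lies
between consecutive powers of 2 turns the integral of
[ell(b min(1, s^(-n/2)))] into a tail of the integral of
[s^(-1-2/n) ell(s)], which the hypothesis makes small with [b]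
([stretched_integral_small]). The map is also monotone: iterated from the upper
barrier it decreases to a fixed point ([exists_mild_solution]).

Two parts of the classical theory link this fixed point to the statement.

Regularity ([mild_C21], [mild_heat_equation]): a space derivative of order [m]
of the heat kernel is at most [C t^(-m/2)] times a Gaussian. For [m = 1] this is
integrable in time, so a bounded mild solution is Lipschitz in space with
constant [L / sqrt s] at time [s]. Since the second derivatives of the kernel
have mean zero, the Lipschitz bound gains half a power in them:
[|D^2 S(t - s) f(u(s))| <= C s^(-1/2) (t - s)^(-1/2)], again integrable. The
time derivative of the Duhamel term is not taken under the singular integral:
Fubini and the fundamental theorem of calculus exhibit the term as the
primitive of its would-be derivative ([is_derive_duhamel_time]).

Uniqueness ([heat_comparison], [classical_solution_unique]): for two classical
solutions [u] and [v], a positive maximum of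
[exp(- (L + 1) t) (u - v) - eta (|x|^2 + 2 n t)] is impossible, and the term
[eta |x|^2] confines the maximum to a compact set. Maximality of the existence
interval then holds because the solution is global. *)

(** * Mass and semigroup law of the heat kernel *)

Section row_integral.
Context {R : realType}.
Local Notation leb := (@lebesgue_measure R).

(** The measure in dimension [n + 1] is an image of a product measure, so this is
Tonelli's theorem after a change of variables. *)
Lemma lebesgue_row_tonelli n (h : 'rV[R]_n.+1 -> \bar R) :
  measurable_fun [set: 'rV[R]_n.+1] h -> (forall x, 0 <= h x)%E ->
  (\int[lebesgue_row R n.+1]_x h x =
   \int[leb]_a \int[lebesgue_row R n]_y h (row_cons (a, y)))%E.
Proof.
move=> mh h0.
have mr := @measurable_row_cons R n.
rewrite -(fubini_tonelli1 (fun p => h (row_cons p)))//; last first.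
  exact: measurableT_comp.
rewrite [LHS](ge0_integral_pushforward mr)//.
Qed.

Lemma integral_row_prod n (h : 'I_n -> R -> R) :
  (forall i, measurable_fun setT (h i)) -> (forall i a, 0 <= h i a) ->
  (\int[lebesgue_row R n]_x (\prod_(i < n) h i (coor i x))%:E =
   \prod_(i < n) \int[leb]_a (h i a)%:E)%E.
Proof.
elim: n h => [|n IHn] h mh h0.
  rewrite big_ord0; under eq_integral do rewrite big_ord0.
  by rewrite integral_cst// mul1e; exact: diracT.
rewrite lebesgue_row_tonelli; first last.
- by move=> x; rewrite lee_fin prodr_ge0.
- apply/measurable_EFinP; apply: measurable_prod => i _.
  exact: (measurableT_comp (mh i) (measurable_coor i)).
have IH := IHn (fun i => h (lift ord0 i)) (fun i => mh _) (fun i a => h0 _ a).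
rewrite big_ord_recl /= -IH.
transitivity (\int[leb]_a ((h ord0 a)%:E *
    \int[lebesgue_row R n]_y (\prod_(i < n) h (lift ord0 i) (coor i y))%:E))%E.
  apply: eq_integral => a _.
  rewrite -ge0_integralZl//; first last.
  - by rewrite lee_fin.
  - by move=> y _; rewrite lee_fin prodr_ge0.
  - apply/measurable_EFinP; apply: measurable_prod => i _.
    exact: (measurableT_comp (mh _) (measurable_coor i)).
  apply: eq_integral => y _; rewrite big_ord_recl row_cons0 -EFinM.
  by congr (_ * _)%:E; apply: eq_bigr => i _; rewrite row_consS.
rewrite ge0_integralZr//.
- by apply/measurable_EFinP; exact: mh.
- by move=> a _; rewrite lee_fin.
- by apply: integral_ge0 => y _; rewrite lee_fin prodr_ge0.
Qed.

End row_integral.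

Section heat_kernel_mass.
Context {R : realType} {n : nat}.
Implicit Types (x y z : 'rV[R]_n) (s t : R).
Local Notation leb := (@lebesgue_measure R).
Local Notation nu := (lebesgue_row R n).

Lemma coorB i x y : coor i (x - y) = coor i x - coor i y.
Proof. by rewrite /coor !mxE. Qed.

(** The one-dimensional heat kernel at time [t] is the normal density of variance
[2 t]; this gives access to the integral of the Gaussian. *)
Lemma normal_pdf_heat t (a b : R) : 0 < t ->
  normal_pdf a (Num.sqrt (2 * t)) b =
  (Num.sqrt (4 * pi * t))^-1 * expR (- ((a - b) ^+ 2 / (4 * t))).
Proof.
move=> t0; rewrite normal_pdfE ?gt_eqF ?sqrtr_gt0 ?mulr_gt0//.
rewrite /normal_peak /normal_fun sqr_sqrtr ?mulr_ge0 ?ltW//.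
congr ((Num.sqrt _)^-1 * expR _); first by ring.
by field; rewrite gt_eqF.
Qed.

Lemma heat_kernel_prod t x y : 0 < t ->
  heat_kernel t (x - y) =
  \prod_(i < n) normal_pdf (coor i x) (Num.sqrt (2 * t)) (coor i y).
Proof.
move=> t0.
have p0 : 0 <= 4 * pi * t by rewrite !mulr_ge0 ?pi_ge0 ?ltW.
under eq_bigr do rewrite normal_pdf_heat//.
rewrite big_split/= prodr_const card_ord /heat_kernel; congr (_ * _).
  rewrite [n%:R / 2]mulrC powRN powRrM powR12_sqrt// powR_mulrn ?sqrtr_ge0//. by rewrite exprVn.
rewrite -expR_sum; congr expR; rewrite sumrN; congr (- _).
rewrite /sqr_euclidean mulr_suml; apply: eq_bigr => i _.
by rewrite -[(x - y) _ _]/(coor i (x - y)) coorB.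
Qed.

Lemma sqr_euclideanC x y : sqr_euclidean (x - y) = sqr_euclidean (y - x).
Proof.
by apply: eq_bigr => i _; rewrite -!/(coor i _) !coorB -sqrrN opprB.
Qed.

Lemma heat_kernel_sym t x y : heat_kernel t (x - y) = heat_kernel t (y - x).
Proof.
by rewrite /heat_kernel sqr_euclideanC.
Qed.

Lemma heat_kernel_ge0 t x : 0 <= heat_kernel t x.
Proof. by rewrite mulr_ge0 ?powR_ge0 ?expR_ge0. Qed.

Lemma integral_heat_kernel t x : 0 < t ->
  (\int[nu]_y (heat_kernel t (x - y))%:E = 1)%E.
Proof.
move=> t0.
under eq_integral do rewrite heat_kernel_prod//.
rewrite (integral_row_prod (h := fun i => normal_pdf (coor i x) (Num.sqrt (2 * t)))).
- by apply: big1 => i _; exact: integral_normal_pdf.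
- by move=> i; exact: measurable_normal_pdf.
- by move=> i a; exact: normal_pdf_ge0.
Qed.

(** Completing the square: the product of two Gaussians in [c] is a Gaussian in [c]
times a factor free of [c], which is the Gaussian at the sum of the times. *)
Lemma normal_pdf_mul s t (a b c : R) : 0 < s -> 0 < t ->
  normal_pdf a (Num.sqrt (2 * t)) c * normal_pdf b (Num.sqrt (2 * s)) c =
  normal_pdf a (Num.sqrt (2 * (t + s))) b *
  normal_pdf ((s * a + t * b) / (t + s))
    (Num.sqrt (2 * (t * s / (t + s)))) c.
Proof.
move=> s0 t0; have ts0 : 0 < t + s by rewrite addr_gt0.
have r0 : 0 < t * s / (t + s) by rewrite divr_gt0 ?mulr_gt0.
rewrite !normal_pdf_heat// [LHS]mulrACA [RHS]mulrACA -!expRD -!invfM.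
have p0 : 0 < pi :> R := pi_gt0 R.
rewrite -!sqrtrM ?mulr_ge0 ?ltW//; congr ((Num.sqrt _)^-1 * expR _).
  by field; rewrite gt_eqF.
by field; rewrite !gt_eqF// ?mulr_gt0.
Qed.

(** By [normal_pdf_mul] the integrand splits, coordinate by coordinate, into the
right-hand side and a probability density in [y]. *)
Lemma heat_kernel_semigroup s t x z : 0 < s -> 0 < t ->
  (\int[nu]_y (heat_kernel t (x - y) * heat_kernel s (y - z))%:E =
   (heat_kernel (t + s) (x - z))%:E)%E.
Proof.
move=> s0 t0; have ts0 : 0 < t + s by rewrite addr_gt0.
pose h i := normal_pdf ((s * coor i x + t * coor i z) / (t + s))
  (Num.sqrt (2 * (t * s / (t + s)))) : R -> R.
transitivity (\int[nu]_y ((heat_kernel (t + s) (x - z))%:E *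
   (\prod_(i < n) h i (coor i y))%:E))%E.
  apply: eq_integral => y _; rewrite -EFinM; congr (_%:E).
  rewrite (heat_kernel_sym s) !heat_kernel_prod// -!big_split/=.
  by apply: eq_bigr => i _; exact: normal_pdf_mul.
have mh i : measurable_fun setT (h i) by exact: measurable_normal_pdf.
have h0 i a : 0 <= h i a by exact: normal_pdf_ge0.
rewrite ge0_integralZl//; first last.
- by rewrite lee_fin heat_kernel_ge0.
- by move=> y _; rewrite lee_fin prodr_ge0.
- apply/measurable_EFinP; apply: measurable_prod => i _.
  exact: (measurableT_comp (mh _) (measurable_coor i)).
rewrite integral_row_prod// big1 ?mule1// => i _; exact: integral_normal_pdf.
Qed.

End heat_kernel_mass.

(** * Integrals depending on a parameter *)

Section parameter_integral.
Context {R : realType} d {Y : measurableType d} (mu : {measure set Y -> \bar R}).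
Variables (B : set Y) (mB : measurable B).

Lemma dominated_integrableR (f g : Y -> R) :
  measurable_fun B f -> mu.-integrable B (EFin \o g) ->
  (forall y, B y -> `|f y| <= g y) -> mu.-integrable B (EFin \o f).
Proof.
move=> mf ig fg; apply: (le_integrable mB _ _ ig).
  exact/measurable_EFinP.
move=> y By /=; rewrite lee_fin (le_trans (fg _ By))// ler_norm//.
Qed.

Lemma dominated_cvgR (f : nat -> Y -> R) (l g : Y -> R) :
  (forall k, measurable_fun B (f k)) -> measurable_fun B l ->
  {ae mu, forall y, B y -> f ^~ y @ \oo --> l y} ->
  mu.-integrable B (EFin \o g) ->
  (forall k y, B y -> `|f k y| <= g y) ->
  mu.-integrable B (EFin \o l) /\
  (fun k => \int[mu]_(y in B) f k y) @ \oo --> \int[mu]_(y in B) l y.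
Proof.
move=> mf ml fl ig fg.
have ae1 : {ae mu, forall y, B y -> (EFin \o f k) y @[k --> \oo] --> (EFin \o l) y}.
  by apply: filterS fl => y fl By; apply: cvg_EFin; [exact: nearW|exact: fl].
have ae2 : {ae mu, forall y k, B y -> (`|(EFin \o f k) y| <= (EFin \o g) y)%E}.
  by apply: aeW => y k By /=; rewrite lee_fin fg.
have mf' k : measurable_fun B (EFin \o f k) by exact/measurable_EFinP.
have ml' : measurable_fun B (EFin \o l) by exact/measurable_EFinP.
have [il _ cf] := dominated_convergence mB mf' ml' ae1 ig ae2.
split=> //; apply: fine_cvg; rewrite fineK//; exact: integrable_fin_num.
Qed.

(** Limits along sequences suffice in a pseudometric space; the dominated
convergence theorem speaks of sequences only. *)
Lemma sequential_continuity (P : pseudoMetricType R) (F : P -> R) (p : P) :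
  (forall u : nat -> P, u @ \oo --> p -> F \o u @ \oo --> F p) ->
  {for p, continuous F}.
Proof.
move=> seqF; apply/cvgrPdist_lt => e e0; apply: contrapT => nF.
have H k : exists q, ball p k.+1%:R^-1 q /\ e <= `|F p - F q|.
  apply: contrapT => Hk; apply: nF.
  have k0 : 0 < k.+1%:R^-1 :> R by rewrite invr_gt0.
  apply: filterS (nbhsx_ballx p (k.+1%:R^-1) k0) => q bq.
  by rewrite ltNge; apply/negP => Fq; apply: Hk; exists q.
have [u Hu] := choice H.
have cu : u @ \oo --> p.
  apply/cvg_ballP => r r0; near=> k.
  have [+ _] := Hu k; apply: le_ball.
  rewrite -[leRHS]invrK lef_pV2 ?posrE ?invr_gt0//.
  near: k; exists (Num.truncn r^-1) => // s /= rs.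
  by apply/ltW; rewrite -truncn_le_nat.
move/cvgrPdist_lt: (seqF u cu) => /(_ e e0)[N _ /(_ N (leqnn _))] /=.
by have [_ /le_lt_trans h] := Hu N => /h; rewrite ltxx.
Unshelve. all: end_near. Qed.

(** Dominated convergence along every sequence tending to [p]. Pointwise continuity
is asked almost everywhere only, because the truncated Duhamel integrand jumps
at one time. *)
Lemma continuous_param_integral (P : pseudoMetricType R) (f : P -> Y -> R)
    (g : Y -> R) (p : P) :
  mu.-integrable B (EFin \o g) ->
  (\forall q \near p, measurable_fun B (f q) /\ forall y, B y -> `|f q y| <= g y) ->
  {ae mu, forall y, B y -> {for p, continuous (f ^~ y)}} ->
  {for p, continuous (fun q => \int[mu]_(y in B) f q y)}.
Proof.
move=> ig nf cf; apply: sequential_continuity => u up.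
have [N _ HN] := up _ nf.
rewrite /comp -(cvg_shiftn N).
apply: (dominated_cvgR (f := fun k => f (u (k + N)%N)) (g := g) _ _ _ _ _).2 => //.
- by move=> k; apply: (HN (k + N)%N _).1; exact: leq_addl.
- exact: (nbhs_singleton nf).1.
- apply: filterS cf => y cf By.
  rewrite (cvg_shiftn N (fun k => f (u k) y)).
  exact: (cvg_comp u (f ^~ y) up (cf By)).
- by move=> k y By; apply: (HN (k + N)%N _).2 => //; exact: leq_addl.
Qed.

(** The mean value theorem bounds the increments of [f] by the majorant [g] of the
derivative; hence integrability at [a] propagates to the whole interval, and
differentiation under the integral applies there. *)
Lemma is_derive_param_integral (f f' : R -> Y -> R) (g : Y -> R) (a u v : R) :
  u < a < v ->
  (forall h, u < h < v -> measurable_fun B (f h)) ->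
  mu.-integrable B (EFin \o f a) ->
  (forall h y, u < h < v -> B y -> is_derive h 1 (f ^~ y) (f' h y)) ->
  mu.-integrable B (EFin \o g) ->
  (forall h y, u < h < v -> B y -> `|f' h y| <= g y) ->
  is_derive a 1 (fun h => \int[mu]_(y in B) f h y) (\int[mu]_(y in B) f' a y).
Proof.
move=> auv mf ifa df ig fg.
have g0 y : B y -> 0 <= g y by move=> By; exact: le_trans (fg a y auv By).
pose G := fun y => `|g y|.
have iG : mu.-integrable B (EFin \o G) by exact: (integrable_norm ig).
have mvt h y : u < h < v -> B y -> `|f h y - f a y| <= g y * `|h - a|.
  move=> huv By.
  have sub p q x : u < p < v -> u < q < v -> p <= x <= q -> u < x < v.
    move=> /andP[up _] /andP[_ qv] /andP[px xq].
    by rewrite (lt_le_trans up)//= (le_lt_trans xq).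
  have H p q : u < p < v -> u < q < v -> p < q ->
      `|f q y - f p y| <= g y * `|q - p|.
    move=> puv quv pq.
    have S x : x \in `[p, q] -> u < x < v by rewrite in_itv/=; exact: sub.
    have dS x : x \in `[p, q] -> is_derive x 1 (f ^~ y) (f' x y).
      by move=> /S xuv; exact: df.
    have cS : {within `[p, q], continuous (f ^~ y)}.
      apply: derivable_within_continuous => x /dS ?; exact: ex_derive.
    have [c /subset_itv_oo_cc cpq ->] := MVT pq
      (fun x xpq => dS x (subset_itv_oo_cc xpq)) cS.
    by rewrite normrM ler_wpM2r// fg//; exact: S.
  case: (ltgtP h a) => [ha|ah|->].
  - by rewrite distrC [`|h - a|]distrC; exact: H.
  - exact: H.
  - by rewrite !subrr normr0 mulr0.
have ifh h : u < h < v -> mu.-integrable B (EFin \o f h).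
  move=> huv.
  apply: (dominated_integrableR (g := fun y => `|f a y| + g y * `|h - a|)).
  - exact: mf.
  - have i1 : mu.-integrable B (fun y => (`|f a y|%:E + (g y * `|h - a|)%:E)%E).
      apply: integrableD => //; first exact: (integrable_norm ifa).
      by apply: eq_integrable (integrableZr mB (`|h - a|) ig).
    by apply: eq_integrable i1.
  - move=> y By; rewrite -[f h y](subrK (f a y)) addrC (le_trans (ler_normD _ _))//.
    by rewrite lerD2l mvt.
have Iauv : `]u, v[%classic a by rewrite /= in_itv.
have itvE h : `]u, v[%classic h -> u < h < v by rewrite /= in_itv.
have dv h y : `]u, v[%classic h -> B y -> partial1of2 f h y = f' h y.
  move=> /itvE huv By; rewrite /partial1of2 derive1E.
  exact: (@derive_val _ _ _ _ _ _ _ (df h y huv By)).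
have H1 x : `]u, v[%classic x -> mu.-integrable B (EFin \o f x).
  by move=> /itvE; exact: ifh.
have H2 x y : `]u, v[%classic x -> B y -> derivable (f ^~ y) x 1.
  by move=> /itvE xuv By; exact: (@ex_derive _ _ _ _ _ _ _ (df x y xuv By)).
have H3 x y : `]u, v[%classic x -> B y -> `|partial1of2 f x y| <= G y.
  move=> xuv By; rewrite dv// /G (le_trans (fg _ _ (itvE _ xuv) By))//.
  exact: ler_norm.
have G0 y : 0 <= G y by exact: normr_ge0.
apply: DeriveDef.
  exact: (derivable_under_integral mB Iauv H1 H2 G0 iG H3).
rewrite -derive1E (differentiation_under_integral mB Iauv H1 H2 G0 iG H3)//.
by apply: eq_Rintegral => y /set_mem By; rewrite dv.
Qed.

End parameter_integral.

Section calculus.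
Context {R : realType}.

(** Directional derivatives are derivatives of a function of one real variable, to
which differentiation under the integral and the chain rule apply. *)
Lemma is_derive_line (V W : normedModType R) (F : V -> W) x v l :
  is_derive (0 : R) (1 : R) (fun h : R => F (x + h *: v)) l -> is_derive x v F l.
Proof.
have E : (fun h : R => F (x + h *: v)) = (fun h => F (h *: v + x)).
  by apply/funext => h; rewrite addrC.
rewrite E => dF.
have dV : derivable F x v by apply/derivable1P; exact: (@ex_derive _ _ _ _ _ _ _ dF).
apply: DeriveDef => //; rewrite -(@derive_val _ _ _ _ _ _ _ dF) /derive.
set g1 := fun h => h^-1 *: _; set g2 := fun h => h^-1 *: _.
suff -> : g1 = g2 by [].
by apply/funext => h; rewrite /g1 /g2 /= addr0 scale0r add0r [_%:A]mulr1.
Qed.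

Lemma is_derive_comp_real (f g : R -> R) (x a b : R) :
  is_derive x 1 f a -> is_derive (f x) 1 g b -> is_derive x 1 (g \o f) (b * a).
Proof.
move=> df dg; apply: DeriveDef.
  apply/derivable1_diffP/differentiable_comp; apply/derivable1_diffP.
    exact: (@ex_derive _ _ _ _ _ _ _ df).
  exact: (@ex_derive _ _ _ _ _ _ _ dg).
by rewrite -derive1E derive1_comp ?derive1E ?derive_val.
Qed.

End calculus.

(** * Measurability and geometry of row vectors *)

Section measurability.
Context {R : realType}.

Lemma measurable_funV d (T : measurableType d) (f : T -> R) :
  measurable_fun setT f -> measurable_fun setT (fun x => (f x)^-1).
Proof.
move=> mf.
rewrite (_ : (fun x => _) = fun x =>
    if 0 <= f x then f x `^ (-1) else - ((- f x) `^ (-1))); last first.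
  apply/funext => x; case: leP => fx; first by rewrite powR_inv1.
  by rewrite powR_inv1 ?oppr_ge0 ?ltW// invrN opprK.
apply: measurable_fun_ifT.
- exact: measurable_fun_ler.
- exact: (measurableT_comp (measurable_powR _) mf).
- apply: measurable_funN.
  exact: (measurableT_comp (measurable_powR _) (measurable_funN mf)).
Qed.

Lemma measurable_param_Rintegral d1 d2 (T : measurableType d1)
    (Y : measurableType d2) (m : {sigma_finite_measure set Y -> \bar R})
    (F : T * Y -> R) :
  measurable_fun setT F ->
  measurable_fun setT (fun x => \int[m]_y F (x, y)).
Proof.
move=> mF; apply: (measurableT_comp (fine_measurable measurableT)).
have mFE : measurable_fun setT (EFin \o F) by exact/measurable_EFinP.
rewrite (_ : (fun x => _) = (fun x =>
   \int[m]_y (EFin \o F)^\+ (x, y) - \int[m]_y (EFin \o F)^\- (x, y))%E).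
  apply: emeasurable_funB.
    apply: (@measurable_fun_fubini_tonelli_F _ _ _ _ _ m (EFin \o F)^\+)%E => //.
    exact: measurable_funepos.
  apply: (@measurable_fun_fubini_tonelli_F _ _ _ _ _ m (EFin \o F)^\-)%E => //.
  exact: measurable_funeneg.
apply/funext => x; rewrite integralE.
by congr (_ - _)%E; apply: eq_integral => y _; rewrite ?funeposE ?funenegE.
Qed.

Lemma measurable_rowB n d (T : measurableType d) (f g : T -> 'rV[R]_n) :
  measurable_fun setT f -> measurable_fun setT g ->
  measurable_fun setT (fun p => f p - g p).
Proof.
move=> mf mg; apply: measurable_fun_rowP => i.
rewrite (_ : _ \o _ = (coor i \o f) \- (coor i \o g)); last first.
  by apply/funext => p; rewrite /= coorB.
by apply: measurable_funB; apply: measurableT_comp => //; exact: measurable_coor.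
Qed.

End measurability.

Lemma continuous_at_sum (R : realType) (T : topologicalType) (I : Type)
    (r : seq I) (F : I -> T -> R) (x : T) :
  (forall i, {for x, continuous (F i)}) ->
  {for x, continuous (fun y => \sum_(i <- r) F i y)}.
Proof.
move=> cF; elim: r => [|i r IH].
  rewrite (_ : (fun y => _) = cst 0); first exact: cst_continuous.
  by apply/funext => y; rewrite big_nil.
rewrite (_ : (fun y => _) = F i \+ (fun y => \sum_(j <- r) F j y)).
  exact: continuousD (cF i) IH.
by apply/funext => y; rewrite big_cons.
Qed.

Section row_geometry.
Context {R : realType} {n : nat}.
Implicit Types (x y v w : 'rV[R]_n).

Definition dot v x : R := \sum_(i < n) v ord0 i * x ord0 i.

Lemma norm_coor i x : `|x ord0 i| <= `|x|.
Proof.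
by rewrite [leRHS]/Num.norm /= mx_normrE; apply/bigmax_geP; right; exists (ord0, i).
Qed.

Lemma dot_le v x : `|dot v x| <= n%:R * `|v| * `|x|.
Proof.
have -> : n%:R * `|v| * `|x| = \sum_(i < n) (`|v| * `|x|).
  by rewrite sumr_const card_ord -mulrA mulr_natl.
rewrite (le_trans (ler_norm_sum _ _ _))// ler_sum// => i _.
by rewrite normrM ler_pM ?norm_coor.
Qed.

Lemma dotxx x : dot x x = sqr_euclidean x.
Proof. by apply: eq_bigr => i _; rewrite expr2. Qed.

Lemma dot_line w x v h : dot w (x + h *: v) = dot w x + h * dot w v.
Proof.
rewrite /dot mulr_sumr -big_split/=; apply: eq_bigr => i _.
by rewrite !mxE; ring.
Qed.

Lemma sqr_euclidean_line x v h : sqr_euclidean (x + h *: v) =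
  sqr_euclidean x + h * (2 * dot v x) + h ^+ 2 * sqr_euclidean v.
Proof.
rewrite /sqr_euclidean /dot !mulr_sumr -!big_split/=; apply: eq_bigr => i _.
by rewrite !mxE; ring.
Qed.

Lemma sqr_euclidean_ge0 x : 0 <= sqr_euclidean x.
Proof. by apply: sumr_ge0 => i _; rewrite sqr_ge0. Qed.

Lemma sqr_norm_le x : `|x| ^+ 2 <= sqr_euclidean x.
Proof.
have [->|] := eqVneq (`|x|) 0; first by rewrite expr0n/= sqr_euclidean_ge0.
move=> /mx_norm_neq0[[i j]] /=; rewrite ord1 => E.
rewrite [`|x|]E real_normK ?num_real// /sqr_euclidean (bigD1 j)//= lerDl.
by apply: sumr_ge0 => k _; rewrite sqr_ge0.
Qed.

Lemma sqr_euclidean_le x : sqr_euclidean x <= n%:R * `|x| ^+ 2.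
Proof.
have -> : n%:R * `|x| ^+ 2 = \sum_(i < n) `|x| ^+ 2.
  by rewrite sumr_const card_ord mulr_natl.
apply: ler_sum => i _.
by rewrite -real_normK ?num_real// ler_pXn2r ?nnegrE// norm_coor.
Qed.

Lemma sqr_euclidean_translate x y z :
  sqr_euclidean (z - y) <= 2 * sqr_euclidean (x - y) + 2 * sqr_euclidean (x - z).
Proof.
rewrite /sqr_euclidean !mulr_sumr -big_split/=; apply: ler_sum => i _.
rewrite !mxE; set a := x _ _; set b := y _ _; set c := z _ _.
rewrite -subr_ge0 (_ : _ - _ = (2 * a - b - c) ^+ 2) ?sqr_ge0//.
by ring.
Qed.

Lemma dot_delta i x : dot (delta_mx ord0 i) x = x ord0 i.
Proof.
rewrite /dot (bigD1 i)//= big1 ?addr0 => [|j ji].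
  by rewrite mxE !eqxx mul1r.
by rewrite mxE (negbTE ji) andbF mul0r.
Qed.

Lemma norm_delta i : `|delta_mx ord0 i : 'rV[R]_n| <= 1.
Proof.
rewrite [leLHS]/Num.norm /= mx_normrE; apply/bigmax_leP; split=> // j _.
by rewrite mxE; case: (_ && _); rewrite ?normr1 ?normr0.
Qed.

Lemma continuous_coor i : continuous (fun x : 'rV[R]_n => x ord0 i).
Proof. exact: coord_continuous. Qed.

Lemma continuous_dot v : continuous (dot v).
Proof.
move=> x; apply: continuous_at_sum => i.
by apply: continuousM; [exact: cst_continuous|exact: continuous_coor].
Qed.

Lemma continuous_sqr_euclidean : continuous (@sqr_euclidean R n).
Proof.
move=> x; apply: continuous_at_sum => i.
rewrite (_ : (fun y => _) = (fun y : 'rV[R]_n => y ord0 i * y ord0 i)).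
  by apply: continuousM; exact: continuous_coor.
by apply/funext => y; rewrite expr2.
Qed.

Lemma measurable_dot v d (T : measurableType d) (f : T -> 'rV[R]_n) :
  measurable_fun setT f -> measurable_fun setT (fun p => dot v (f p)).
Proof.
move=> mf; apply: measurable_sum => i; apply: measurable_funM => //.
exact: (measurableT_comp (measurable_coor i) mf).
Qed.

Lemma measurable_sqr_euclidean d (T : measurableType d) (f : T -> 'rV[R]_n) :
  measurable_fun setT f -> measurable_fun setT (fun p => sqr_euclidean (f p)).
Proof.
move=> mf; apply: measurable_sum => i; apply: measurable_funX.
exact: (measurableT_comp (measurable_coor i) mf).
Qed.

End row_geometry.

(** * Derivatives of the heat kernel and Gaussian bounds *)

Section heat_kernels.
Context {R : realType} {n : nat}.
Implicit Types (x y v w : 'rV[R]_n) (s t : R) (k : R -> 'rV[R]_n -> R) (m : nat).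
Local Notation K := (@heat_kernel R n).

(** The derivative of the heat kernel in the direction [v]. *)
Definition hk1 v t x : R := - (dot v x / (2 * t)) * K t x.

(** The second derivative of the heat kernel in the directions [v] and [w]. *)
Definition hk2 v w t x : R :=
  (dot v x * dot w x / (4 * t ^+ 2) - dot v w / (2 * t)) * K t x.

(** The time derivative of the heat kernel. *)
Definition hkt t x : R :=
  (sqr_euclidean x / (4 * t ^+ 2) - n%:R / (2 * t)) * K t x.

(** The heat kernel solves the heat equation. *)
Lemma hkt_sum t x :
  hkt t x = \sum_(i < n) hk2 (delta_mx ord0 i) (delta_mx ord0 i) t x.
Proof.
rewrite -mulr_suml; congr (_ * _); rewrite sumrB -!mulr_suml; congr (_ / _ - _ / _).
  by apply: eq_bigr => i _; rewrite dot_delta expr2.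
by under eq_bigr do rewrite dot_delta mxE !eqxx; rewrite sumr_const card_ord.
Qed.

Lemma is_derive_heat_kernel_line v t x (h : R) : 0 < t ->
  is_derive h 1 (fun h => K t (x + h *: v)) (hk1 v t (x + h *: v)).
Proof.
move=> t0.
pose q (h : R) := sqr_euclidean x + h * (2 * dot v x) + h * h * sqr_euclidean v.
pose p (h : R) := - (4 * t)^-1 * q h.
rewrite (_ : (fun h => _) =
    cst ((4 * pi * t) `^ (- (n%:R / 2))) \* (expR \o p)); last first.
  apply/funext => h'; rewrite /heat_kernel sqr_euclidean_line /= /p /q.
  by congr (_ * expR _); rewrite mulNr mulrC expr2.
have dq : is_derive h 1 q (2 * dot v x + 2 * h * sqr_euclidean v).
  apply: is_derive_eq.
  rewrite ?(scaler0, addr0, add0r) /GRing.scale /=; ring.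
have dp : is_derive h 1 p (- (4 * t)^-1 * (2 * dot v x + 2 * h * sqr_euclidean v)).
  apply: is_derive_eq.
  rewrite ?(scaler0, addr0, add0r) /GRing.scale /=; ring.
have dE := is_derive_comp_real dp (is_derive_expR (p h)).
apply: is_derive_eq; rewrite /hk1 /heat_kernel sqr_euclidean_line dot_line dotxx.
rewrite ?scaler0 /GRing.scale /= ?mulr0 ?addr0.
rewrite (_ : expR (p h) = expR (- ((sqr_euclidean x + h * (2 * dot v x) +
    h ^+ 2 * sqr_euclidean v) / (4 * t)))); last first.
  by congr expR; rewrite /p /q mulNr mulrC expr2.
by field; rewrite gt_eqF.
Qed.

Lemma is_derive_hk1_line v w t x (h : R) : 0 < t ->
  is_derive h 1 (fun h => hk1 v t (x + h *: w)) (hk2 v w t (x + h *: w)).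
Proof.
move=> t0.
pose p (h : R) := - (2 * t)^-1 * (dot v x + h * dot v w).
have dp : is_derive h 1 p (- (2 * t)^-1 * dot v w).
  apply: is_derive_eq.
  rewrite ?(scaler0, addr0, add0r) /GRing.scale /=; ring.
rewrite (_ : (fun h => _) = p \* (fun h => K t (x + h *: w))); last first.
  by apply/funext => h'; rewrite /hk1 dot_line /p /=; congr (_ * _); rewrite mulNr [in RHS]mulrC.
have dK := is_derive_heat_kernel_line w x h t0.
apply: is_derive_eq; rewrite /hk2 /hk1 /GRing.scale /= /p !dot_line.
by field; rewrite gt_eqF.
Qed.

Lemma is_derive_heat_kernel_time t x : 0 < t ->
  is_derive t 1 (fun t => K t x) (hkt t x).
Proof.
move=> t0.
have p0 : 0 < 4 * pi * t by rewrite !mulr_gt0 ?pi_gt0.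
have tn0 : t != 0 by rewrite gt_eqF.
pose a : R := - (n%:R / 2).
have d1 : is_derive t 1 (fun t : R => 4 * pi * t) (4 * pi).
  by apply: is_derive_eq; rewrite /GRing.scale /= mulr1.
have d2 := is_derive_comp_real d1 (@is_derive1_powR _ a _ p0).
have d3 : is_derive t 1 (fun t : R => t^-1) (- t ^- 2).
  by apply: is_derive_eq; [exact: is_deriveV|rewrite /GRing.scale /= mulr1].
pose q (t : R) := - (sqr_euclidean x / 4) * t^-1.
have d4 : is_derive t 1 q (sqr_euclidean x / 4 * t ^- 2).
  by apply: is_derive_eq; rewrite /GRing.scale /= mulrN mulNr opprK.
have d5 := is_derive_comp_real d4 (is_derive_expR (q t)).
rewrite (_ : (fun t => _) = ((fun b => b `^ a) \o (fun t => 4 * pi * t)) \*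
    (expR \o q)); last first.
  apply/funext => s; rewrite /heat_kernel /= /q /a; congr (_ * expR _).
  by rewrite invfM mulNr mulrA.
apply: is_derive_eq; rewrite /hkt /heat_kernel /GRing.scale /=.
rewrite (_ : expR (q t) = expR (- (sqr_euclidean x / (4 * t)))); last first.
  by congr expR; rewrite /q invfM mulNr mulrA.
rewrite powRB ?(gt_eqF p0) ?implybT// powRr1 ?ltW// /a.
move: (pi_gt0 R); move: (pi : R) => P P0; field; rewrite tn0 gt_eqF//.
Qed.

(** The size of a space derivative of order [m] of the heat kernel. The Gaussian is
taken at the doubled time: its slower decay absorbs the polynomial factors that
differentiation produces. *)
Definition gauss_bounded m k := exists2 C, 0 <= C &
  forall t x, 0 < t -> `|k t x| <= C * (Num.sqrt t)^-1 ^+ m * K (2 * t) x.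

(** By [1 + a <= exp a] with [a = z^2 / (m + 1)], since
[z <= 1 + z^2 <= (m + 1) (1 + a)], raised to the power [m]. *)
Lemma expR_sqr_bound m (z : R) : 0 <= z -> z ^+ m <= m.+1%:R ^+ m * expR (z ^+ 2).
Proof.
move=> z0.
have m0 : 0 < m.+1%:R :> R by rewrite ltr0n.
apply: (@le_trans _ _ ((m.+1%:R * expR (z ^+ 2 / m.+1%:R)) ^+ m)).
  apply: lerXn2r; rewrite ?nnegrE ?mulr_ge0 ?expR_ge0 ?(ltW m0)//.
  apply: (@le_trans _ _ (m.+1%:R * (1 + z ^+ 2 / m.+1%:R))); last first.
    by rewrite ler_pM2l// expR_ge1Dx.
  rewrite mulrDr mulr1 mulrCA divff ?gt_eqF// mulr1.
  apply: (@le_trans _ _ (1 + z ^+ 2)); first nra.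
  by rewrite lerD2r ler1n.
rewrite exprMn ler_pM2l ?exprn_gt0// -expRM_natr ler_expR.
rewrite -mulrA ler_piMr ?sqr_ge0// mulrC ler_pdivrMr// mul1r ler_nat//.
Qed.

Lemma heat_kernel_double t x : 0 < t ->
  K t x = 2 `^ (n%:R / 2) * expR (- (sqr_euclidean x / (8 * t))) * K (2 * t) x.
Proof.
move=> t0; have p0 : 0 < 4 * pi * t by rewrite !mulr_gt0 ?pi_gt0.
rewrite /heat_kernel mulrACA -expRD; congr (_ * expR _); last first.
  by field; rewrite gt_eqF.
rewrite (_ : 4 * pi * (2 * t) = 2 * (4 * pi * t)); last by ring.
rewrite [(2 * _) `^ _]powRM ?ltW// mulrA -powRD; last by rewrite pnatr_eq0 implybT.
by rewrite subrr powRr0 mul1r.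
Qed.

(** The factor [|x|^j] is absorbed by the ratio [exp(- |x|^2 / (8 t))] of the
Gaussians at times [t] and [2 t], at the price of [(sqrt t)^j]. *)
Lemma gauss_bounded_pow m j k (c : R) : 0 <= c ->
  (forall t x, 0 < t ->
    `|k t x| <= c * (Num.sqrt t)^-1 ^+ (j + m) * `|x| ^+ j * K t x) ->
  gauss_bounded m k.
Proof.
move=> c0 kb.
exists (c * (2 `^ (n%:R / 2) * (Num.sqrt 8 ^+ j * j.+1%:R ^+ j))).
  by rewrite !mulr_ge0 ?powR_ge0 ?exprn_ge0 ?sqrtr_ge0 ?ler0n.
move=> t x t0; apply: le_trans (kb _ _ t0) _.
set s := Num.sqrt t; have s0 : 0 < s by rewrite sqrtr_gt0.
rewrite heat_kernel_double//.
move: (heat_kernel_ge0 (2 * t) x); move: (heat_kernel (2 * t) x) => k2 k20.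
rewrite -!mulrA ler_wpM2l// !mulrA ler_wpM2r//.
have e0 : 0 <= Num.sqrt 8 * s by rewrite mulr_ge0 ?sqrtr_ge0 ?ltW.
have e1 : 0 < Num.sqrt 8 * s by rewrite mulr_gt0 ?sqrtr_gt0.
have xb : `|x| ^+ j <= (Num.sqrt 8 * s) ^+ j * (j.+1%:R ^+ j *
    expR (sqr_euclidean x / (8 * t))).
  have := @expR_sqr_bound j (`|x| / (Num.sqrt 8 * s)) (divr_ge0 (normr_ge0 _) e0).
  rewrite expr_div_n ler_pdivrMr ?exprn_gt0// => /le_trans; apply.
  rewrite mulrC ler_wpM2l ?exprn_ge0// ler_wpM2l ?exprn_ge0 ?ler0n// ler_expR.
  rewrite expr_div_n exprMn /s !sqr_sqrtr ?ler0n ?(ltW t0)//.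
  apply: ler_wpM2r; last exact: sqr_norm_le.
  by rewrite invr_ge0 mulr_ge0 ?ltW.
apply: (@le_trans _ _ (s^-1 ^+ (j + m) * ((Num.sqrt 8 * s) ^+ j * (j.+1%:R ^+ j *
    expR (sqr_euclidean x / (8 * t)))) * 2 `^ (n%:R / 2) *
    expR (- (sqr_euclidean x / (8 * t))))).
  rewrite -!mulrA ler_wpM2l ?exprn_ge0 ?invr_ge0 ?(ltW s0)// !mulrA.
  by rewrite !ler_wpM2r ?expR_ge0 ?powR_ge0// -!mulrA.
rewrite expRN exprD exprMn exprVn le_eqVlt; apply/orP; left; apply/eqP.
have eE := expR_gt0 (sqr_euclidean x / (8 * t)).
have sj : 0 < s ^+ j by rewrite exprn_gt0.
by field; rewrite !gt_eqF.
Qed.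

Lemma gauss_boundedW m k k' : gauss_bounded m k ->
  (forall t x, 0 < t -> `|k' t x| <= `|k t x|) -> gauss_bounded m k'.
Proof.
by move=> [C C0 H] kk'; exists C => // t x t0; exact: le_trans (kk' _ _ t0) (H _ _ t0).
Qed.

Lemma gauss_boundedD m k k' : gauss_bounded m k -> gauss_bounded m k' ->
  gauss_bounded m (fun t x => k t x + k' t x).
Proof.
move=> [C C0 H] [C' C'0 H']; exists (C + C'); first exact: addr_ge0.
move=> t x t0; apply: le_trans (ler_normD _ _) _.
by rewrite 2!mulrDl; apply: lerD; [exact: H|exact: H'].
Qed.

Lemma gauss_bounded_heat : gauss_bounded 0 K.
Proof.
apply: (@gauss_bounded_pow 0 0 K 1) => // t x t0.
by rewrite !expr0 !mul1r ger0_norm ?heat_kernel_ge0.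
Qed.

Lemma gauss_bounded_moment : gauss_bounded 1 (fun t x => t^-1 * `|x| * K t x).
Proof.
apply: (@gauss_bounded_pow 1 1 _ 1) => // t x t0.
rewrite normrM [`|K t x|]ger0_norm ?heat_kernel_ge0//.
rewrite normrM normr_id ger0_norm ?invr_ge0 ?(ltW t0)//.
by rewrite (_ : (1 + 1 = 2)%N)// exprVn sqr_sqrtr ?(ltW t0)// mul1r expr1.
Qed.

Let sqrtK t : 0 < t -> t^-1 = (Num.sqrt t)^-1 ^+ 2.
Proof. by move=> t0; rewrite exprVn sqr_sqrtr ?ltW. Qed.

Lemma gauss_bounded_hk1 v : gauss_bounded 1 (hk1 v).
Proof.
apply: (@gauss_bounded_pow 1 1 _ (n%:R * `|v| / 2)) => [|t x t0].
  by rewrite !mulr_ge0 ?invr_ge0 ?ler0n.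
rewrite /hk1 normrM [`|K t x|]ger0_norm ?heat_kernel_ge0//.
apply: ler_wpM2r; first exact: heat_kernel_ge0.
rewrite normrN normrM [`|_^-1|]ger0_norm ?invr_ge0 ?mulr_ge0 ?(ltW t0)//.
rewrite invfM (sqrtK t0)// expr1 (_ : (1 + 1 = 2)%N)//.
set s := _^-1 ^+ 2; have s0 : 0 <= s by rewrite exprn_ge0 ?invr_ge0 ?sqrtr_ge0.
have -> : n%:R * `|v| / 2 * s * `|x| = n%:R * `|v| * `|x| * (2^-1 * s) by ring.
by apply: ler_wpM2r (dot_le v x); rewrite mulr_ge0 ?invr_ge0.
Qed.

Let hk2_bounded_aux v w (b m : nat) : (m <= 2)%N -> (m + b = 2)%N ->
  gauss_bounded m (fun t x => `|x| ^+ b * hk2 v w t x).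
Proof.
move=> m2 mb.
pose N : R := n%:R.
have N0 : 0 <= N by rewrite ler0n.
have H1 : gauss_bounded m (fun t x =>
    `|x| ^+ b * (dot v x * dot w x / (4 * t ^+ 2)) * K t x).
  apply: (@gauss_bounded_pow m b.+2 _ (N * `|v| * (N * `|w|) / 4)) => [|t x t0].
    by rewrite !mulr_ge0 ?invr_ge0 ?ler0n.
  rewrite normrM [`|K t x|]ger0_norm ?heat_kernel_ge0//.
  apply: ler_wpM2r; first exact: heat_kernel_ge0.
  rewrite normrM normrX normr_id normrM normrM.
  rewrite [`|_^-1|]ger0_norm ?invr_ge0 ?mulr_ge0 ?exprn_ge0 ?(ltW t0)//.
  have -> : (b.+2 + m = 4)%N by rewrite addSn addSn addnC mb.
  rewrite invfM -exprVn (sqrtK t0)// -exprM.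
  set s := _^-1 ^+ 4; have s0 : 0 <= s by rewrite exprn_ge0 ?invr_ge0 ?sqrtr_ge0.
  have dd : `|dot v x| * `|dot w x| <= N * `|v| * (N * `|w|) * `|x| ^+ 2.
    by rewrite expr2 mulrACA; apply: ler_pM => //; exact: dot_le.
  have -> : N * `|v| * (N * `|w|) / 4 * s * `|x| ^+ b.+2 =
    `|x| ^+ b * (N * `|v| * (N * `|w|) * `|x| ^+ 2 * (4^-1 * s)).
    by rewrite -[b.+2]addn2 exprD; ring.
  by rewrite ler_wpM2l ?exprn_ge0// ler_wpM2r// mulr_ge0// invr_ge0.
have H2 : gauss_bounded m (fun t x =>
    `|x| ^+ b * (- (dot v w / (2 * t))) * K t x).
  apply: (@gauss_bounded_pow m b _ (`|dot v w| / 2)) => [|t x t0].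
    by rewrite mulr_ge0 ?invr_ge0 ?ler0n.
  rewrite normrM [`|K t x|]ger0_norm ?heat_kernel_ge0//.
  apply: ler_wpM2r; first exact: heat_kernel_ge0.
  rewrite normrM normrX normr_id normrN normrM.
  rewrite [`|_^-1|]ger0_norm ?invr_ge0 ?mulr_ge0 ?(ltW t0)//.
  rewrite addnC mb invfM (sqrtK t0)// le_eqVlt; apply/orP; left; apply/eqP; ring.
apply: gauss_boundedW (gauss_boundedD H1 H2) _ => t x t0.
by rewrite /hk2 -mulrDl -mulrDr mulrA.
Qed.

Lemma gauss_bounded_hk2 v w : gauss_bounded 2 (hk2 v w).
Proof.
apply: gauss_boundedW (hk2_bounded_aux v w (b := 0) (leqnn _) erefl) _ => t x t0.
by rewrite expr0 mul1r.
Qed.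

(** Multiplication by [|x|] gains half a power of [t]; this is what makes second
derivatives integrable in time against Lipschitz functions. *)
Lemma gauss_bounded_norm_hk2 v w : gauss_bounded 1 (fun t x => `|x| * hk2 v w t x).
Proof. exact: (hk2_bounded_aux v w (b := 1) (m := 1)). Qed.

Lemma gauss_bounded_sum m I (r : seq I) (k : I -> R -> 'rV[R]_n -> R) :
  (forall i, gauss_bounded m (k i)) ->
  gauss_bounded m (fun t x => \sum_(i <- r) k i t x).
Proof.
move=> H; elim: r => [|i r IH].
  exists 0 => // t x t0; rewrite big_nil normr0 !mul0r//.
apply: gauss_boundedW (gauss_boundedD (H i) IH) _ => t x _.
by rewrite big_cons.
Qed.

(** For times between [a] and [b] and points within [r] of [z], all translates of [k] lie
below one wider Gaussian, because [|z - y|^2 <= 2 |x - y|^2 + 2 |x - z|^2]. It is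
the majorant for continuity and differentiation under the integral. *)
Lemma gauss_bounded_dom m k (a b r : R) : gauss_bounded m k -> 0 < a ->
  exists2 D, 0 <= D & forall t x y z, a <= t <= b -> `|x - z| <= r ->
    `|k t (x - y)| <= D * K (4 * b) (z - y).
Proof.
move=> [C C0 kb] a0.
pose A := (Num.sqrt a)^-1 ^+ m; pose P := (4 * pi * (2 * a)) `^ (- (n%:R / 2)).
pose Q := (4 * pi * (4 * b)) `^ (- (n%:R / 2)).
exists (C * A * (P * expR (n%:R * r ^+ 2 / (8 * b)) * Q^-1)).
  rewrite !mulr_ge0 ?expR_ge0 ?invr_ge0 ?powR_ge0//.
  by rewrite exprn_ge0 ?invr_ge0 ?sqrtr_ge0.
move=> t x y z /andP[at_ tb] xz.
have t0 : 0 < t := lt_le_trans a0 at_.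
have b0 : 0 < b := lt_le_trans t0 tb.
apply: le_trans (kb _ _ t0) _.
have A_ : (Num.sqrt t)^-1 ^+ m <= A.
  apply: lerXn2r; rewrite ?nnegrE ?invr_ge0 ?sqrtr_ge0//.
  by rewrite lef_pV2 ?posrE ?sqrtr_gt0// ler_wsqrtr.
have P_ : (4 * pi * (2 * t)) `^ (- (n%:R / 2)) <= P.
  rewrite /P !powRN lef_pV2 ?posrE ?powR_gt0 ?mulr_gt0 ?pi_gt0//.
  apply: ge0_ler_powR; rewrite ?nnegrE ?divr_ge0 ?mulr_ge0 ?pi_ge0 ?(ltW a0) ?(ltW t0)//.
  by rewrite ler_pM2l ?mulr_gt0 ?pi_gt0// ler_pM2l.
have Q0 : 0 < Q by rewrite powR_gt0 ?mulr_gt0 ?pi_gt0.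
rewrite -mulrA -[leRHS]mulrA -[leRHS]mulrA ler_wpM2l//.
apply: ler_pM; rewrite ?exprn_ge0 ?invr_ge0 ?sqrtr_ge0 ?heat_kernel_ge0//.
rewrite {2}/heat_kernel -/Q.
rewrite (_ : _ * (Q * _) = P * (expR (n%:R * r ^+ 2 / (8 * b)) *
    expR (- (sqr_euclidean (z - y) / (4 * (4 * b)))))); last first.
  by move: (expR _) (expR _) => e1 e2; field; rewrite gt_eqF.
apply: ler_pM; rewrite ?powR_ge0 ?expR_ge0// -expRD ler_expR.
have q1 := sqr_euclidean_translate x y z.
have q2 : sqr_euclidean (x - z) <= n%:R * r ^+ 2.
  apply: le_trans (sqr_euclidean_le _) _; rewrite ler_wpM2l//.
  by apply: lerXn2r; rewrite ?nnegrE// (le_trans _ xz).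
have q3 := sqr_euclidean_ge0 (x - y).
apply: (@le_trans _ _ (- (sqr_euclidean (x - y) / (8 * b)))).
  rewrite lerN2 ler_wpM2l// lef_pV2 ?posrE ?mulr_gt0//; lra.
rewrite -subr_ge0.
rewrite (_ : _ - _ = (2 * (n%:R * r ^+ 2) + 2 * sqr_euclidean (x - y) -
    sqr_euclidean (z - y)) / (16 * b)); last by field; rewrite gt_eqF.
apply: divr_ge0; [lra|by rewrite mulr_ge0 ?(ltW b0)].
Qed.

End heat_kernels.

(** * Convolution with kernels of Gaussian type *)

Section heat_convolution.
Context {R : realType} {n : nat}.
Implicit Types (x y v w : 'rV[R]_n) (s t : R) (k : R -> 'rV[R]_n -> R) (m : nat)
  (g : 'rV[R]_n -> R) (M : R).
Local Notation K := (@heat_kernel R n).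
Local Notation nu := (lebesgue_row R n).
Local Notation rV := 'rV[R]_n.

(** The heat kernel and its derivatives share these properties, on which the
measurability, continuity and size of convolutions and Duhamel integrals rest. *)
Record gauss_kernel m k : Prop := GaussKernel {
  gk_measurable : measurable_fun [set: R * rV] (fun p => k p.1 p.2) ;
  gk_continuous : forall t x, 0 < t -> {for (t, x), continuous (fun p => k p.1 p.2)} ;
  gk_bounded : gauss_bounded m k }.

Arguments gk_continuous {m k} _ t x _.

Let continuous_fst (p : R * rV) : {for p, continuous (fun q : R * rV => q.1)}.
Proof. exact: cvg_fst. Qed.

Let continuous_snd (p : R * rV) : {for p, continuous (fun q : R * rV => q.2)}.
Proof. exact: cvg_snd. Qed.

Let continuous_c1 (c : R) (p : R * rV) :
  {for p, continuous (fun q : R * rV => c * q.1)}.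
Proof. by apply: continuousM; [exact: cst_continuous|exact: continuous_fst]. Qed.

Let continuous_c1V (c : R) (p : R * rV) : 0 < c * p.1 ->
  {for p, continuous (fun q : R * rV => (c * q.1)^-1)}.
Proof. by move=> c0; apply: continuousV; [rewrite gt_eqF|exact: continuous_c1]. Qed.

Let continuous_c2 (f : rV -> R) (p : R * rV) : continuous f ->
  {for p, continuous (fun q : R * rV => f q.2)}.
Proof. by move=> cf; apply: continuous_comp; [exact: continuous_snd|exact: cf]. Qed.

Lemma gauss_kernel_heat : gauss_kernel 0 K.
Proof.
split; last exact: gauss_bounded_heat.
- apply: measurable_funM.
    apply: (measurableT_comp (measurable_powR _)).
    by apply: measurable_funM => //; exact: measurable_fst.
  apply: measurableT_comp => //; apply: measurable_funN; apply: measurable_funM.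
    exact: (measurable_sqr_euclidean measurable_snd).
  apply: measurable_funV; apply: measurable_funM => //; exact: measurable_fst.
- move=> t x t0; apply: continuousM.
    have cp : {for 4 * pi * t, continuous (fun a : R => a `^ (- (n%:R / 2)))}.
      apply: differentiable_continuous; apply/derivable1_diffP.
      by apply: derivable_powR; rewrite in_itv/= andbT !mulr_gt0 ?pi_gt0.
    exact: (continuous_comp (@continuous_c1 (4 * pi) (t, x)) cp).
  apply: continuous_comp; last exact: continuous_expR.
  apply: continuousN; apply: continuousM.
    by apply: continuous_c2; exact: continuous_sqr_euclidean.
  by apply: continuous_c1V; rewrite mulr_gt0.
Qed.

Lemma gauss_kernel_hk1 v : gauss_kernel 1 (hk1 v).
Proof.
have [mK cK _] := gauss_kernel_heat.
split; last exact: gauss_bounded_hk1.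
- apply: measurable_funM => //; apply: measurable_funN; apply: measurable_funM.
    exact: (measurable_dot v measurable_snd).
  apply: measurable_funV; apply: measurable_funM => //; exact: measurable_fst.
- move=> t x t0; apply: continuousM; last exact: cK.
  apply: continuousN; apply: continuousM.
    by apply: continuous_c2; exact: continuous_dot.
  by apply: continuous_c1V; rewrite mulr_gt0.
Qed.

Lemma gauss_kernel_hk2 v w : gauss_kernel 2 (hk2 v w).
Proof.
have [mK cK _] := gauss_kernel_heat.
split; last exact: gauss_bounded_hk2.
- apply: measurable_funM => //; apply: measurable_funB; apply: measurable_funM => //.
  + apply: measurable_funM.
      exact: (measurable_dot v measurable_snd).
    exact: (measurable_dot w measurable_snd).
  + apply: measurable_funV; apply: measurable_funM => //.
    by apply: measurable_funX; exact: measurable_fst.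
  + apply: measurable_funV; apply: measurable_funM => //; exact: measurable_fst.
- move=> t x t0; apply: continuousM; last exact: cK.
  apply: continuousB; apply: continuousM.
  + by apply: continuousM; apply: continuous_c2; exact: continuous_dot.
  + rewrite (_ : (fun q => _) = (fun q : R * rV => (4 * q.1)^-1 * (1 * q.1)^-1)).
      by apply: continuousM; apply: continuous_c1V; rewrite mulr_gt0.
    by apply/funext => q; rewrite expr2 mul1r !invfM mulrA.
  + exact: cst_continuous.
  + by apply: continuous_c1V; rewrite mulr_gt0.
Qed.

Lemma gauss_kernel_sum m I (r : seq I) (k : I -> R -> rV -> R) :
  (forall i, gauss_kernel m (k i)) ->
  gauss_kernel m (fun t x => \sum_(i <- r) k i t x).
Proof.
move=> gk; split.
- by apply: measurable_sum => i; exact: gk_measurable (gk i).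
- by move=> t x t0; apply: continuous_at_sum => i; exact: (gk_continuous (gk i)).
- by apply: gauss_bounded_sum => i; exact: gk_bounded (gk i).
Qed.

Lemma gauss_kernel_hkt : gauss_kernel 2 hkt.
Proof.
rewrite (_ : hkt = fun t x => \sum_(i < n) hk2 (delta_mx ord0 i) (delta_mx ord0 i) t x).
  by apply: gauss_kernel_sum => i; exact: gauss_kernel_hk2.
by apply/funext => t; apply/funext => x; exact: hkt_sum.
Qed.

(** For [k] the heat kernel this is the heat semigroup at positive times; for the
derivatives of the heat kernel it is the corresponding derivative of it. *)
Definition heat_conv k t (g : rV -> R) x : R := \int[nu]_y (k t (x - y) * g y).

Lemma heat_semigroupE t g x : 0 < t -> heat_semigroup t g x = heat_conv K t g x.
Proof. by rewrite /heat_semigroup => ->. Qed.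

Lemma measurable_kernel_translate m k t x : gauss_kernel m k ->
  measurable_fun [set: rV] (fun y => k t (x - y)).
Proof.
move=> gk; apply: (measurableT_comp (gk_measurable gk)
  (g := fun y => (t, x - y))).
by apply: measurable_fun_pair => //; exact: measurable_rowB.
Qed.

Lemma integrable_heat_kernel t x : 0 < t ->
  nu.-integrable setT (EFin \o (fun y => K t (x - y))).
Proof.
move=> t0; apply/integrableP; split.
  apply/measurable_EFinP; exact: measurable_kernel_translate gauss_kernel_heat.
under eq_integral do rewrite /= ger0_norm ?heat_kernel_ge0//.
by rewrite integral_heat_kernel// ltry.
Qed.

Lemma Rintegral_heat_kernel t x : 0 < t -> \int[nu]_y K t (x - y) = 1.
Proof. by move=> t0; rewrite /Rintegral integral_heat_kernel. Qed.

Lemma measurable_heat_conv m k d (T : measurableType d) (tau : T -> R)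
    (xi : T -> rV) (G : T -> rV -> R) : gauss_kernel m k ->
  measurable_fun setT tau -> measurable_fun setT xi ->
  measurable_fun setT (fun p : T * rV => G p.1 p.2) ->
  measurable_fun setT (fun p => heat_conv k (tau p) (G p) (xi p)).
Proof.
move=> gk mtau mxi mG.
apply: (measurable_param_Rintegral nu
  (F := fun q : T * rV => k (tau q.1) (xi q.1 - q.2) * G q.1 q.2)).
apply: measurable_funM => //.
apply: (measurableT_comp (gk_measurable gk)
  (g := fun q : T * rV => (tau q.1, xi q.1 - q.2))).
apply: measurable_fun_pair.
  exact: (measurableT_comp mtau measurable_fst).
apply: measurable_rowB; last exact: measurable_snd.
exact: (measurableT_comp mxi measurable_fst).
Qed.

Section bounded_datum.
Variables (g : rV -> R) (M : R).
Hypotheses (mg : measurable_fun setT g) (gM : forall y, `|g y| <= M).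

Let M0 : 0 <= M. Proof. exact: le_trans (normr_ge0 _) (gM 0). Qed.

Lemma integrable_heat_conv m k t x : gauss_kernel m k -> 0 < t ->
  nu.-integrable setT (EFin \o (fun y => k t (x - y) * g y)).
Proof.
move=> gk t0; have [C C0 kb] := gk_bounded gk.
have i0 := integrable_heat_kernel x (mulr_gt0 (ltr0n _ 2) t0).
apply: (dominated_integrableR measurableT (g := fun y =>
  (C * (Num.sqrt t)^-1 ^+ m * M) * K (2 * t) (x - y))) => //.
- by apply: measurable_funM => //; exact: measurable_kernel_translate gk.
- by apply: eq_integrable (integrableZl measurableT _ i0).
- move=> y _; rewrite normrM mulrAC ler_pM//; exact: kb.
Qed.

Lemma heat_conv_le k t x (c : R) : 0 < t -> 0 <= c ->
  nu.-integrable setT (EFin \o (fun y => k t (x - y) * g y)) ->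
  (forall y, `|k t (x - y) * g y| <= c * K (2 * t) (x - y)) ->
  `|heat_conv k t g x| <= c.
Proof.
move=> t0 c0 ik kc; apply: le_trans (le_normr_Rintegral measurableT ik) _.
have t20 : 0 < 2 * t by rewrite mulr_gt0.
have i0 := integrable_heat_kernel x t20.
apply: (@le_trans _ _ (\int[nu]_y (c * K (2 * t) (x - y)))); last first.
  by rewrite RintegralZl// Rintegral_heat_kernel// mulr1.
apply: le_Rintegral => //.
- exact: integrable_norm ik.
- by apply: eq_integrable (integrableZl measurableT c i0).
Qed.

End bounded_datum.

(** The Gaussian at time [2 t] has mass one. *)
Lemma heat_conv_bounded m k : gauss_kernel m k -> exists2 C, 0 <= C &
  forall g M t x, measurable_fun setT g -> (forall y, `|g y| <= M) -> 0 < t ->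
    `|heat_conv k t g x| <= C * M * (Num.sqrt t)^-1 ^+ m.
Proof.
move=> gk; have [C C0 kb] := gk_bounded gk.
exists C => // g M t x mg gM t0.
have M0 : 0 <= M by exact: le_trans (normr_ge0 _) (gM 0).
apply: heat_conv_le => //.
- by rewrite !mulr_ge0 ?exprn_ge0 ?invr_ge0 ?sqrtr_ge0.
- exact: (integrable_heat_conv mg gM x gk t0).
- move=> y; rewrite normrM.
  have := ler_pM (normr_ge0 _) (normr_ge0 _) (kb t (x - y) t0) (gM y).
  by move=> /le_trans; apply; rewrite mulrAC [_ * M]mulrAC.
Qed.

Lemma near_slab t x (a b r : R) : a < t < b -> 0 < r ->
  \forall p \near (t, x), a < p.1 < b /\ `|p.2 - x| < r.
Proof.
move=> tab r0.
exists (`]a, b[%classic, ball x r) => /=.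
  split; last exact: nbhsx_ballx.
  have tI : t \in `]a, b[ by rewrite in_itv.
  exact: (near_in_itvoo tI).
move=> [s y] [/= sab]; rewrite -ball_normE /= distrC => xy; split=> //.
Qed.

Lemma continuous_kernel_translate m k t x y : gauss_kernel m k -> 0 < t ->
  {for (t, x), continuous (fun p : R * rV => k p.1 (p.2 - y))}.
Proof.
move=> gk t0.
have c : {for (t, x), continuous (fun p : R * rV => (p.1, p.2 - y))}.
  have c2 : {for (t, x), continuous (fun p : R * rV => p.2 - y)}.
    by apply: continuousB; [exact: continuous_snd|exact: cst_continuous].
  by apply: (@cvg_pair _ _ _ (nbhs (t, x)) (nbhs t) (nbhs (x - y))); [exact: cvg_fst|exact: c2].
exact: (continuous_comp c (gk_continuous gk t (x - y) t0)).
Qed.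

Lemma continuous_heat_conv m k g M t x : gauss_kernel m k ->
  measurable_fun setT g -> (forall y, `|g y| <= M) -> 0 < t ->
  {for (t, x), continuous (fun p : R * rV => heat_conv k p.1 g p.2)}.
Proof.
move=> gk mg gM t0.
have a0 : 0 < t / 2 by rewrite divr_gt0.
have [D D0 HD] := gauss_bounded_dom (t + t) 1 (gk_bounded gk) a0.
have i0 : nu.-integrable setT (EFin \o (fun y => K (4 * (t + t)) (x - y))).
  by apply: integrable_heat_kernel; rewrite mulr_gt0 ?addr_gt0.
apply: (continuous_param_integral (B := setT) (f := fun p y => k p.1 (p.2 - y) * g y)
  measurableT (g := fun y => D * M * K (4 * (t + t)) (x - y))).
- by apply: eq_integrable (integrableZl measurableT (D * M) i0).
- have tab : t / 2 < t < t + t by lra.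
  apply: filterS (near_slab x tab ltr01) => p [/andP[p1 p2] px]; split.
    by apply: measurable_funM => //; exact: measurable_kernel_translate gk.
  move=> y _; rewrite normrM mulrAC; apply: ler_pM => //.
  by apply: HD; rewrite ?ltW.
- apply: aeW => y _; apply: continuousM; last exact: cst_continuous.
  exact: continuous_kernel_translate gk t0.
Qed.

Definition line_derivative k k' v :=
  forall t x (h : R), 0 < t -> is_derive h 1 (fun h : R => k t (x + h *: v)) (k' t (x + h *: v)).

Definition time_derivative k k' :=
  forall t x, 0 < t -> is_derive t 1 (k ^~ x) (k' t x).

Lemma is_derive_heat_conv_line m m' k k' v g M t x (h : R) :
  gauss_kernel m k -> gauss_kernel m' k' -> line_derivative k k' v ->
  measurable_fun setT g -> (forall y, `|g y| <= M) -> 0 < t ->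
  is_derive h 1 (fun h : R => heat_conv k t g (x + h *: v))
    (heat_conv k' t g (x + h *: v)).
Proof.
move=> gk gk' kk' mg gM t0.
have M0 : 0 <= M by exact: le_trans (normr_ge0 _) (gM 0).
have [D D0 HD] := gauss_bounded_dom t `|v| (gk_bounded gk') t0.
have i0 : nu.-integrable setT (EFin \o (fun y => K (4 * t) (x + h *: v - y))).
  by apply: integrable_heat_kernel; rewrite mulr_gt0.
apply: (is_derive_param_integral (B := setT) measurableT
  (f := fun h y => k t (x + h *: v - y) * g y)
  (f' := fun h y => k' t (x + h *: v - y) * g y)
  (g := fun y => D * M * K (4 * t) (x + h *: v - y)) (u := h - 1) (v := h + 1)).
- lra.
- by move=> h' _; apply: measurable_funM => //; exact: measurable_kernel_translate gk.
- exact: integrable_heat_conv gk t0.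
- move=> h' y _ _.
  have := kk' t (x - y) h' t0.
  have E b : x - y + b *: v = x + b *: v - y by rewrite addrAC.
  rewrite E; under eq_fun do rewrite E; move=> d.
  by apply: is_derive_eq; rewrite scaler0 add0r /GRing.scale /= mulrC.
- by apply: eq_integrable (integrableZl measurableT (D * M) i0).
- move=> h' y hh' _; rewrite normrM mulrAC; apply: ler_pM => //; apply: HD.
    by rewrite !lexx.
  rewrite [x + _]addrC opprD addrA addrK -scalerBl normrZ ler_piMl//.
  by rewrite ler_norml; lra.
Qed.

Lemma is_derive_heat_conv_time m m' k k' g M t x :
  gauss_kernel m k -> gauss_kernel m' k' -> time_derivative k k' ->
  measurable_fun setT g -> (forall y, `|g y| <= M) -> 0 < t ->
  is_derive t 1 (fun t => heat_conv k t g x) (heat_conv k' t g x).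
Proof.
move=> gk gk' kk' mg gM t0.
have M0 : 0 <= M by exact: le_trans (normr_ge0 _) (gM 0).
have a0 : 0 < t / 2 by rewrite divr_gt0.
have [D D0 HD] := gauss_bounded_dom (t + t) 0 (gk_bounded gk') a0.
have i0 : nu.-integrable setT (EFin \o (fun y => K (4 * (t + t)) (x - y))).
  by apply: integrable_heat_kernel; rewrite mulr_gt0 ?addr_gt0.
have pos s : t / 2 < s < t + t -> 0 < s by lra.
apply: (is_derive_param_integral (B := setT) measurableT
  (f := fun t y => k t (x - y) * g y) (f' := fun t y => k' t (x - y) * g y)
  (g := fun y => D * M * K (4 * (t + t)) (x - y)) (u := t / 2) (v := t + t)).
- lra.
- by move=> s _; apply: measurable_funM => //; exact: measurable_kernel_translate gk.
- exact: integrable_heat_conv gk t0.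
- move=> s y /pos s0 _; have d := kk' s (x - y) s0.
  by apply: is_derive_eq; rewrite scaler0 add0r /GRing.scale /= mulrC.
- by apply: eq_integrable (integrableZl measurableT (D * M) i0).
- move=> s y hs _; rewrite normrM mulrAC; apply: ler_pM => //; apply: HD.
    by case/andP: hs => /ltW -> /ltW ->.
  by rewrite subrr normr0.
Qed.

Lemma heat_conv_sum m I (r : seq I) (k : I -> R -> rV -> R) g M t x :
  (forall i, gauss_kernel m (k i)) ->
  measurable_fun setT g -> (forall y, `|g y| <= M) -> 0 < t ->
  heat_conv (fun t x => \sum_(i <- r) k i t x) t g x =
  \sum_(i <- r) heat_conv (k i) t g x.
Proof.
move=> gk mg gM t0; elim: r => [|i r IH].
  rewrite big_nil /heat_conv.
  under eq_Rintegral do rewrite big_nil mul0r.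
  by rewrite Rintegral_cst// mul0r.
rewrite big_cons -IH /heat_conv -RintegralD//.
- by apply: eq_Rintegral => y _; rewrite big_cons mulrDl.
- exact: (integrable_heat_conv mg gM x (gk i) t0).
- exact: (integrable_heat_conv mg gM x (gauss_kernel_sum r gk) t0).
Qed.

Lemma heat_conv_cst t x (c : R) : 0 < t -> heat_conv K t (cst c) x = c.
Proof.
move=> t0; rewrite /heat_conv /= RintegralZr ?Rintegral_heat_kernel ?mul1r//.
exact: integrable_heat_kernel.
Qed.

(** The convolution of a constant with the heat kernel is constant, so its
derivatives vanish. *)
Lemma heat_conv_hk2_cst v w t x (c : R) : 0 < t ->
  heat_conv (hk2 v w) t (cst c) x = 0.
Proof.
move=> t0.
have mc : measurable_fun [set: rV] (cst c) by [].
have cM (y : rV) : `|(cst c y : R)| <= `|c| by [].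
have E1 y := heat_conv_cst y c t0.
have E2 y : heat_conv (hk1 v) t (cst c) y = 0.
  have := is_derive_heat_conv_line y 0 gauss_kernel_heat (gauss_kernel_hk1 v)
    (is_derive_heat_kernel_line v) mc cM t0.
  rewrite scale0r addr0; under eq_fun do rewrite E1.
  by move=> d; rewrite -(@derive_val _ _ _ _ _ _ _ d) derive_cst.
have := is_derive_heat_conv_line x 0 (gauss_kernel_hk1 v) (gauss_kernel_hk2 v w)
  (is_derive_hk1_line v w) mc cM t0.
rewrite scale0r addr0; under eq_fun do rewrite E2.
by move=> d; rewrite -(@derive_val _ _ _ _ _ _ _ d) derive_cst.
Qed.

Lemma heat_convB m k g g' M M' t x : gauss_kernel m k ->
  measurable_fun setT g -> (forall y, `|g y| <= M) ->
  measurable_fun setT g' -> (forall y, `|g' y| <= M') -> 0 < t ->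
  heat_conv k t (fun y => g y - g' y) x = heat_conv k t g x - heat_conv k t g' x.
Proof.
move=> gk mg gM mg' gM' t0.
rewrite /heat_conv -RintegralB//.
- by apply: eq_Rintegral => y _; rewrite mulrBr.
- exact: (integrable_heat_conv mg gM x gk t0).
- exact: (integrable_heat_conv mg' gM' x gk t0).
Qed.

(** Since the kernel has mean zero, [g x] may be subtracted from [g]; the resulting
factor [|x - y|] lowers the order of the singularity from [1/t] to
[1/sqrt t]. *)
Lemma heat_conv_hk2_lipschitz v w : exists2 C, 0 <= C & forall g M (L : R) t x,
  measurable_fun setT g -> (forall y, `|g y| <= M) ->
  0 <= L -> (forall y, `|g y - g x| <= L * `|x - y|) -> 0 < t ->
  `|heat_conv (hk2 v w) t g x| <= C * L * (Num.sqrt t)^-1.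
Proof.
have [C C0 HC] := gauss_bounded_norm_hk2 v w.
exists C => // g M L t x mg gM L0 gL t0.
have mc : measurable_fun [set: rV] (cst (g x)) by [].
have cM (y : rV) : `|(cst (g x) y : R)| <= `|g x| by [].
rewrite -[X in `|X|]subr0 -(heat_conv_hk2_cst v w x (g x) t0).
rewrite -(heat_convB x (gauss_kernel_hk2 v w) mg gM mc cM t0).
have mB : measurable_fun setT (fun y => g y - g x) by exact: measurable_funB.
have BM y : `|g y - g x| <= M + M by rewrite (le_trans (ler_normB _ _))// lerD.
apply: heat_conv_le => //.
- by rewrite !mulr_ge0 ?invr_ge0 ?sqrtr_ge0.
- exact: (integrable_heat_conv mB BM x (gauss_kernel_hk2 v w) t0).
- move=> y; have := HC t (x - y) t0; rewrite expr1 normrM normr_id => HC'.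
  rewrite normrM.
  apply: (@le_trans _ _ (`|x - y| * `|hk2 v w t (x - y)| * L)).
    rewrite mulrC -mulrA [_ * L]mulrC mulrA; apply: ler_wpM2r => //.
    by rewrite mulrC.
  apply: le_trans (ler_wpM2r L0 HC') _.
  by rewrite mulrAC [C * _ * L]mulrAC.
Qed.

(** The first absolute moment of the heat kernel is of order [sqrt t]. *)
Lemma heat_conv_approx : exists2 C, 0 <= C & forall g M (L : R) t x,
  measurable_fun setT g -> (forall y, `|g y| <= M) ->
  0 <= L -> (forall y, `|g y - g x| <= L * `|x - y|) -> 0 < t ->
  `|heat_conv K t g x - g x| <= C * L * Num.sqrt t.
Proof.
have [C C0 HC] := @gauss_bounded_moment R n; exists C => // g M L t x mg gM L0 gL t0.
have mc : measurable_fun [set: rV] (cst (g x)) by [].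
have cM (y : rV) : `|(cst (g x) y : R)| <= `|g x| by [].
have E1 := heat_conv_cst x (g x) t0.
rewrite -{1}E1 -(heat_convB x gauss_kernel_heat mg gM mc cM t0).
have mB : measurable_fun setT (fun y => g y - g x) by exact: measurable_funB.
have BM y : `|g y - g x| <= M + M by rewrite (le_trans (ler_normB _ _))// lerD.
apply: heat_conv_le => //.
- by rewrite !mulr_ge0 ?sqrtr_ge0.
- exact: (integrable_heat_conv mB BM x gauss_kernel_heat t0).
- move=> y; have := HC t (x - y) t0.
  have s0 : 0 < Num.sqrt t by rewrite sqrtr_gt0.
  have ts : t^-1 = (Num.sqrt t)^-1 * (Num.sqrt t)^-1.
    by rewrite -expr2 exprVn sqr_sqrtr ?(ltW t0).
  rewrite expr1 ts ger0_norm ?mulr_ge0 ?invr_ge0 ?powR_ge0 ?expR_ge0 ?(ltW s0)//.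
  set k2 := K (2 * t) _; set k1 := K t _; set s := Num.sqrt t => HC'.
  have k10 : 0 <= k1 by exact: heat_kernel_ge0.
  rewrite normrM (ger0_norm k10).
  apply: (@le_trans _ _ (k1 * (L * `|x - y|))); first by rewrite ler_wpM2l.
  have := ler_wpM2r (mulr_ge0 L0 (mulr_ge0 (ltW s0) (ltW s0))) HC'; rewrite -/s.
  rewrite (_ : _ * (L * _) = k1 * (L * `|x - y|)); last first.
    by field; rewrite gt_eqF.
  move=> /le_trans; apply; rewrite le_eqVlt; apply/orP; left; apply/eqP.
  by field; rewrite gt_eqF.
Qed.

End heat_convolution.

(** * Inverse square root singularities in time *)

Section singular_weights.
Context {R : realType}.
Implicit Types (a b c s t x y : R).
Local Notation leb := (@lebesgue_measure R).

(** The fundamental theorem of calculus on compact subintervals, and monotone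
convergence: this covers integrands that are singular at the end points. *)
Lemma ge0_improper_integral_le (f F : R -> R) a b c :
  a < b -> (forall x, a < x < b -> is_derive x 1 F (f x)) ->
  (forall x, a < x < b -> 0 <= f x) ->
  (forall x, a < x < b -> {for x, continuous f}) ->
  (forall x y, a < x < b -> a < y < b -> F y - F x <= c) ->
  measurable_fun `]a, b[ f /\ (\int[leb]_(x in `]a, b[) (f x)%:E <= c%:E)%E.
Proof.
move=> ab dF f0 cf Fc.
have mf : measurable_fun `]a, b[ f.
  apply: subspace_continuous_measurable_fun => //.
  apply: continuous_in_subspaceT => x; rewrite inE /= in_itv /=; exact: cf.
split=> //.
(* The denominator starts at 3 so that [a + e k < b - e k] for all [k]. *)
pose e k : R := (b - a) / k.+3%:R.
have e0 k : 0 < e k by rewrite divr_gt0 ?subr_gt0.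
have e2 k : e k + e k < b - a.
  have E : e k * k.+3%:R = b - a by rewrite divfK// pnatr_eq0.
  have k3 : 3%:R <= k.+3%:R :> R by rewrite ler_nat.
  by have := e0 k; nra.
pose I k : set R := `[a + e k, b - e k]%classic.
have Iab k x : I k x -> a < x < b.
  by rewrite /I /= in_itv /=; have := e0 k; lra.
have UI : \bigcup_k I k = `]a, b[%classic.
  apply/seteqP; split => [x [k _ /Iab]|x]; first by rewrite /= in_itv.
  rewrite /= in_itv /= => /andP[ax xb].
  pose d := Num.min (x - a) (b - x).
  have d0 : 0 < d by rewrite lt_min !subr_gt0 ax.
  exists (Num.truncn ((b - a) / d)) => //.
  rewrite /I /= in_itv /=; set k := Num.truncn _.
  have ek : e k < d.
    rewrite /e ltr_pdivrMr// mulrC -ltr_pdivrMr//.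
    apply: (lt_trans (Num.Theory.truncnS_gt _)); rewrite ltr_nat//.
  have [d1 d2] : d <= x - a /\ d <= b - x by rewrite /d !ge_min !lexx orbT.
  by apply/andP; split; lra.
have ndI : nondecreasing_seq I.
  apply/nondecreasing_seqP => k; apply/subsetPset => x.
  rewrite /I /= !in_itv /= => /andP[x1 x2].
  have : e k.+1 <= e k.
    by rewrite /e ler_wpM2l ?subr_ge0 ?ltW// ltf_pV2 ?posrE// ltr_nat.
  by move=> ?; apply/andP; split; lra.
have mI k : measurable_fun (I k) (EFin \o f).
  apply/measurable_EFinP; apply: measurable_funS mf => //.
  by move=> x /Iab; rewrite /= in_itv.
have := @ge0_nondecreasing_set_cvg_integral _ (measurableTypeR R) R I (EFin \o f) leb ndI
  (fun k => measurable_itv _) mI (fun k x Ix => f0 _ (Iab _ _ Ix)).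
rewrite UI => /cvge_to_le; apply.
apply: nearW => k /=.
have lt_k : a + e k < b - e k by have := e2 k; lra.
have dI x : a + e k <= x <= b - e k -> is_derive x 1 F (f x).
  by move=> xk; apply: dF; have := e0 k; lra.
have cF x : a + e k <= x <= b - e k -> {for x, continuous F}.
  move=> /dI d; apply: differentiable_continuous; apply/derivable1_diffP.
  exact: (@ex_derive _ _ _ _ _ _ _ d).
rewrite (@continuous_FTC2 _ f F) //.
- by rewrite -EFinB lee_fin; apply: Fc; have := e0 k; lra.
- apply: continuous_in_subspaceT => x; rewrite inE /= in_itv /= => xk.
  by apply: cf; have := e0 k; lra.
- split.
  + move=> x; rewrite in_itv/= => xk; apply: (@ex_derive _ _ _ _ _ _ _ (dI x _)); lra.
  + by apply: cvg_at_right_filter; apply: cF; lra.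
  + by apply: cvg_at_left_filter; apply: cF; lra.
- move=> x; rewrite in_itv/= => xk; rewrite derive1E.
  by apply: (@derive_val _ _ _ _ _ _ _ (dI x _)); lra.
Qed.

Let continuous_sqrtV x : 0 < x -> {for x, continuous (fun x : R => (Num.sqrt x)^-1)}.
Proof.
by move=> x0; apply: continuousV; [rewrite gt_eqF ?sqrtr_gt0|exact: sqrt_continuous].
Qed.

Let is_derive_2sqrt x : 0 < x ->
  is_derive x 1 (fun y : R => 2 * Num.sqrt y) (Num.sqrt x)^-1.
Proof.
move=> x0; have d := is_derive1_sqrt x0.
apply: is_derive_eq; rewrite ?scaler0 ?addr0 ?add0r /GRing.scale /= invfM.
by rewrite mulrA divff ?mul1r// pnatr_eq0.
Qed.

Let integrable_of (f : R -> R) a b c :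
  (forall s, a < s < b -> 0 <= f s) ->
  measurable_fun `]a, b[ f /\ (\int[leb]_(x in `]a, b[) (f x)%:E <= c%:E)%E ->
  leb.-integrable `]a, b[ (EFin \o f) /\ \int[leb]_(s in `]a, b[) f s <= c.
Proof.
move=> f0 [mf fc].
have f0' s : `]a, b[%classic s -> (0 <= (f s)%:E)%E.
  by rewrite /= in_itv /= lee_fin; exact: f0.
have ic : leb.-integrable `]a, b[ (EFin \o f).
  apply/integrableP; split; first exact/measurable_EFinP.
  apply: le_lt_trans (ltry c); apply: le_trans fc.
  rewrite le_eqVlt; apply/orP; left; apply/eqP.
  by apply: eq_integral => s /set_mem /f0' fs /=; rewrite ger0_norm -?lee_fin.
split=> //; rewrite -lee_fin /Rintegral fineK//.
exact: integrable_fin_num.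
Qed.

Lemma integral_left_singularity a b : a < b ->
  leb.-integrable `]a, b[ (EFin \o (fun s => (Num.sqrt (s - a))^-1)) /\
  \int[leb]_(s in `]a, b[) (Num.sqrt (s - a))^-1 <= 2 * Num.sqrt (b - a).
Proof.
move=> ab; apply: integrable_of => [s _|]; first by rewrite invr_ge0 sqrtr_ge0.
apply: (@ge0_improper_integral_le (fun s => (Num.sqrt (s - a))^-1)
  (fun s => 2 * Num.sqrt (s - a))); first exact: ab.
- move=> s /andP[s1 _].
  have d1 : is_derive s 1 (fun x => x - a) 1.
    by apply: is_derive_eq; rewrite subr0.
  have sa : 0 < s - a by rewrite subr_gt0.
  by have := is_derive_comp_real d1 (is_derive_2sqrt sa); rewrite mulr1.
- by move=> s _; rewrite invr_ge0 sqrtr_ge0.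
- move=> s /andP[s1 _].
  apply: (@continuous_comp _ _ _ (fun x => x - a) (fun x : R => (Num.sqrt x)^-1)).
    by apply: continuousB => //; exact: cst_continuous.
  by apply: continuous_sqrtV; rewrite subr_gt0.
- move=> x y /andP[x1 _] /andP[_ y2].
  have h : Num.sqrt (y - a) <= Num.sqrt (b - a) by rewrite ler_wsqrtr// lerB// ltW.
  by have := sqrtr_ge0 (x - a); lra.
Qed.

Lemma integral_right_singularity a b : a < b ->
  leb.-integrable `]a, b[ (EFin \o (fun s => (Num.sqrt (b - s))^-1)) /\
  \int[leb]_(s in `]a, b[) (Num.sqrt (b - s))^-1 <= 2 * Num.sqrt (b - a).
Proof.
move=> ab; apply: integrable_of => [s _|]; first by rewrite invr_ge0 sqrtr_ge0.
apply: (@ge0_improper_integral_le (fun s => (Num.sqrt (b - s))^-1)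
  (fun s => - (2 * Num.sqrt (b - s)))); first exact: ab.
- move=> s /andP[_ s1].
  have d1 : is_derive s 1 (fun x => b - x) (- 1).
    apply: is_derive_eq; ring.
  have sa : 0 < b - s by rewrite subr_gt0.
  have d2 := is_derive_comp_real d1 (is_derive_2sqrt sa).
  by apply: is_derive_eq; rewrite mulrN mulr1 opprK.
- by move=> s _; rewrite invr_ge0 sqrtr_ge0.
- move=> s /andP[_ s1].
  apply: (@continuous_comp _ _ _ (fun x => b - x) (fun x : R => (Num.sqrt x)^-1)).
    by apply: continuousB => //; exact: cst_continuous.
  by apply: continuous_sqrtV; rewrite subr_gt0.
- move=> x y /andP[x1 _] /andP[_ y2].
  have h : Num.sqrt (b - x) <= Num.sqrt (b - a).
    by rewrite ler_wsqrtr// lerD2l lerN2 ltW.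
  by have := sqrtr_ge0 (b - y); lra.
Qed.

(** The size of the Duhamel integrand at time [s]: one factor comes from the
singularity of the kernel, the other from the Lipschitz constant of the source
at small times. *)
Definition weight s t : R := (Num.sqrt s)^-1 * (Num.sqrt (t - s))^-1.

Lemma weight_ge0 s t : 0 <= weight s t.
Proof. by rewrite mulr_ge0 ?invr_ge0 ?sqrtr_ge0. Qed.

Let sqrtV_le x y : 0 < x -> x <= y -> (Num.sqrt y)^-1 <= (Num.sqrt x)^-1.
Proof.
move=> x0 xy; have y0 := lt_le_trans x0 xy.
by rewrite lef_pV2 ?posrE ?sqrtr_gt0// ler_wsqrtr.
Qed.

(** On each half of the interval one of the two factors is bounded. *)
Lemma weight_le s t : 0 < s < t -> weight s t <=
  (Num.sqrt (t / 2))^-1 * ((Num.sqrt (s - 0))^-1 + (Num.sqrt (t - s))^-1).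
Proof.
move=> /andP[s0 st]; rewrite /weight subr0 mulrDr.
have [h|h] := leP (t / 2) s.
  apply: ler_wpDl; first by rewrite mulr_ge0 ?invr_ge0 ?sqrtr_ge0.
  by rewrite ler_wpM2r ?invr_ge0 ?sqrtr_ge0// sqrtV_le//; lra.
apply: ler_wpDr; first by rewrite mulr_ge0 ?invr_ge0 ?sqrtr_ge0.
by rewrite mulrC ler_wpM2r ?invr_ge0 ?sqrtr_ge0// sqrtV_le//; lra.
Qed.

Lemma measurable_weight d (T : measurableType d) (f g : T -> R) :
  measurable_fun setT f -> measurable_fun setT g ->
  measurable_fun setT (fun p => weight (f p) (g p)).
Proof.
have msqrt (h : T -> R) : measurable_fun setT h ->
    measurable_fun setT (fun p => (Num.sqrt (h p))^-1).
  move=> mh; apply: measurable_funV.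
  have ms : measurable_fun [set: R] (@Num.sqrt R).
    by apply: continuous_measurable_fun; exact: sqrt_continuous.
  exact: (measurableT_comp ms mh).
move=> mf mg; apply: measurable_funM; apply: msqrt => //.
exact: measurable_funB.
Qed.

Lemma integral_weight t : 0 < t ->
  leb.-integrable `]0, t[ (EFin \o (fun s => weight s t)) /\
  \int[leb]_(s in `]0, t[) weight s t <= 8.
Proof.
move=> t0.
have [i1 l1] := integral_left_singularity t0.
have [i2 l2] := integral_right_singularity t0.
set c := (Num.sqrt (t / 2))^-1.
have i3 : leb.-integrable `]0, t[ (EFin \o (fun s =>
   c * ((Num.sqrt (s - 0))^-1 + (Num.sqrt (t - s))^-1))).
  by apply: eq_integrable (integrableZl _ c (integrableD _ i1 i2)).
have mw : measurable_fun (`]0, t[ : set R) (fun s => weight s t).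
  by apply: measurable_funTS; exact: measurable_weight.
have iw : leb.-integrable `]0, t[ (EFin \o (fun s => weight s t)).
  apply: (@dominated_integrableR R _ (measurableTypeR R) leb _ (measurable_itv _)
    _ _ mw i3) => // s; rewrite /= in_itv /= => st.
  by rewrite ger0_norm ?weight_ge0// weight_le.
split=> //.
apply: (@le_trans _ _ (\int[leb]_(s in `]0, t[)
   (c * ((Num.sqrt (s - 0))^-1 + (Num.sqrt (t - s))^-1)))).
  by apply: le_Rintegral => // s; rewrite /= in_itv /=; exact: weight_le.
rewrite RintegralZl//; last by apply: eq_integrable (integrableD _ i1 i2).
rewrite RintegralD// subr0 in l1 l2 *.
have ct : c * Num.sqrt t <= 2.
  rewrite /c mulrC ler_pdivrMr ?sqrtr_gt0 ?divr_gt0//.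
  rewrite -ler_sqr ?nnegrE ?mulr_ge0 ?sqrtr_ge0// exprMn !sqr_sqrtr ?divr_ge0 ?ltW//.
  lra.
have c0 : 0 <= c by rewrite invr_ge0 sqrtr_ge0.
apply: (@le_trans _ _ (c * (2 * Num.sqrt t + 2 * Num.sqrt t))).
  by apply: ler_wpM2l => //; exact: lerD.
by lra.
Qed.

End singular_weights.

(** * The Duhamel integral *)

(** The Duhamel integral is a locally uniform limit of its truncations away from
the singularity of the kernel. *)
Lemma continuous_at_uniform_limit (R : realType) (P : topologicalType)
    (F : P -> R) (p : P) :
  (forall e : R, 0 < e -> exists2 G : P -> R, {for p, continuous G} &
    \forall q \near p, `|F q - G q| <= e) ->
  {for p, continuous F}.
Proof.
move=> H; apply/cvgrPdist_le => e e0.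
have e3 : 0 < e / 3 by rewrite divr_gt0.
have [G cG FG] := H _ e3.
move/cvgrPdist_le : cG => /(_ _ e3) cG.
have FGp := nbhs_singleton FG.
near=> q.
have h1 : `|G p - G q| <= e / 3 by near: q; exact: cG.
have h2 : `|F q - G q| <= e / 3 by near: q; exact: FG.
move: FGp h1 h2; rewrite !ler_norml; lra.
Unshelve. all: end_near. Qed.

Lemma near_eq_continuous (R : realType) (P : topologicalType) (F G : P -> R) (p : P) :
  {near p, F =1 G} -> {for p, continuous F} -> {for p, continuous G}.
Proof.
move=> FG cF; rewrite /prop_for /continuous_at -(nbhs_singleton FG).
apply: cvg_trans cF; exact: near_eq_cvg.
Qed.

Section duhamel.
Context {R : realType} {n : nat}.
Local Notation K := (@heat_kernel R n).
Local Notation rV := 'rV[R]_n.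
Local Notation leb := (@lebesgue_measure R).
Implicit Types (x y v w : rV) (s t T B : R) (k : R -> rV -> R) (m : nat).

Definition duhamel k (g : R -> rV -> R) t x : R :=
  \int[leb]_(s in `]0, t[) heat_conv k (t - s) (g s) x.

(** The bound under which the Duhamel integral of [k] against [g] converges. *)
Definition weight_bound k (g : R -> rV -> R) T B := forall s t x,
  0 < s < t -> t <= T -> `|heat_conv k (t - s) (g s) x| <= B * weight s t.

Variables (g : R -> rV -> R) (M : R).
Hypothesis mg : measurable_fun [set: R * rV] (fun p => g p.1 p.2).
Hypothesis gM : forall s y, `|g s y| <= M.

Let M0 : 0 <= M. Proof. exact: le_trans (normr_ge0 _) (gM 0 0). Qed.

Lemma continuous_heat_conv_shift m k (h : rV -> R) N s t x : gauss_kernel m k ->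
  measurable_fun setT h -> (forall y, `|h y| <= N) -> 0 < t - s ->
  {for (t, x), continuous (fun p : R * rV => heat_conv k (p.1 - s) h p.2)}.
Proof.
move=> gk mh hN ts.
have c : {for (t, x), continuous (fun p : R * rV => (p.1 - s, p.2))}.
  have c1 : {for (t, x), continuous (fun p : R * rV => p.1 - s)}.
    by apply: continuousB; [exact: cvg_fst|exact: cst_continuous].
  by apply: (@cvg_pair _ _ _ (nbhs (t, x)) (nbhs (t - s)) (nbhs x));
    [exact: c1|exact: cvg_snd].
exact: (continuous_comp c (continuous_heat_conv gk mh hN ts)).
Qed.

Lemma measurable_slice s : measurable_fun setT (g s).
Proof. exact: (measurable_fun_pair2 s mg). Qed.

(** For orders 0 and 1 boundedness of [g] is enough; the missing negative powers
of [s] and [t - s] are at least powers of [T]. *)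
Lemma gauss_kernel_weight_bound m k T : gauss_kernel m k -> (m <= 1)%N ->
  0 < T -> exists2 B, 0 <= B & weight_bound k g T B.
Proof.
move=> gk m1 T0; have [C C0 HC] := heat_conv_bounded gk.
pose q := Num.sqrt T.
have q0 : 0 < q by rewrite sqrtr_gt0.
exists (C * M * q ^+ (2 - m)); first by rewrite !mulr_ge0 ?exprn_ge0 ?sqrtr_ge0.
move=> s t x /andP[s0 st] tT.
have ts0 : 0 < t - s by rewrite subr_gt0.
apply: le_trans (HC _ _ _ x (measurable_slice s) (gM s) ts0) _.
rewrite -[leRHS]mulrA ler_wpM2l ?mulr_ge0// /weight.
set a := Num.sqrt s; set b := Num.sqrt (t - s).
have a0 : 0 < a by rewrite sqrtr_gt0.
have b0 : 0 < b by rewrite sqrtr_gt0.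
have aq : 1 <= q * a^-1.
  by rewrite ler_pdivlMr// mul1r ler_wsqrtr//; lra.
have bq : 1 <= q * b^-1.
  by rewrite ler_pdivlMr// mul1r ler_wsqrtr//; lra.
have bV : 0 < b^-1 by rewrite invr_gt0.
case: m m1 {gk HC} => [|[|//]] _ /=.
  by rewrite expr0 subn0 expr2 mulrACA -[leLHS]mulr1 ler_pM.
by rewrite !expr1 mulrA ler_peMl// ltW.
Qed.

Lemma measurable_heat_conv_slice m k t x : gauss_kernel m k ->
  measurable_fun setT (fun s => heat_conv k (t - s) (g s) x).
Proof.
move=> gk; apply: (measurable_heat_conv (tau := fun s : R => t - s) (xi := cst x)
   (G := g) gk) => //.
by apply: measurable_funB.
Qed.

Lemma integrable_duhamel m k T B t x : gauss_kernel m k -> weight_bound k g T B ->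
  0 < t <= T ->
  leb.-integrable `]0, t[ (EFin \o (fun s => heat_conv k (t - s) (g s) x)).
Proof.
move=> gk kB /andP[t0 tT].
have iw : leb.-integrable `]0, t[ (EFin \o (fun s => B * weight s t)).
  by apply: eq_integrable (integrableZl _ B (integral_weight t0).1).
apply: (@dominated_integrableR R _ (measurableTypeR R) leb _ (measurable_itv _) _ _ _ iw).
  by apply: measurable_funTS; exact: (measurable_heat_conv_slice t x gk).
by move=> s; rewrite /= in_itv /= => st; exact: kB.
Qed.

Lemma duhamel_le m k T B t x : gauss_kernel m k -> 0 <= B -> weight_bound k g T B ->
  0 < t <= T -> `|duhamel k g t x| <= B * 8.
Proof.
move=> gk B0 kB /[dup] tT /andP[t0 _].
have ik := integrable_duhamel x gk kB tT.
have [iw w8] := integral_weight t0.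
apply: le_trans (le_normr_Rintegral _ ik) _ => //.
apply: (@le_trans _ _ (\int[leb]_(s in `]0, t[) (B * weight s t))); last first.
  by rewrite RintegralZl// ler_wpM2l.
apply: le_Rintegral => //.
- exact: integrable_norm ik.
- by apply: eq_integrable (integrableZl _ B iw).
- by move=> s; rewrite /= in_itv /= => st; apply: kB => //; case/andP: tT.
Qed.

Lemma is_derive_duhamel_line m m' k k' v T B B' t x (h : R) :
  gauss_kernel m k -> gauss_kernel m' k' -> line_derivative k k' v ->
  weight_bound k g T B -> weight_bound k' g T B' -> 0 < t <= T ->
  is_derive h 1 (fun h : R => duhamel k g t (x + h *: v))
    (duhamel k' g t (x + h *: v)).
Proof.
move=> gk gk' kk' kB kB' /[dup] tT /andP[t0 tT'].
apply: (@is_derive_param_integral R _ (measurableTypeR R) leb `]0, t[ (measurable_itv _)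
  (fun h s => heat_conv k (t - s) (g s) (x + h *: v))
  (fun h s => heat_conv k' (t - s) (g s) (x + h *: v))
  (fun s => B' * weight s t) h (h - 1) (h + 1)).
- lra.
- by move=> h' _; apply: measurable_funTS; exact: (measurable_heat_conv_slice t _ gk).
- exact: integrable_duhamel gk kB tT.
- move=> h' s _; rewrite /= in_itv /= => /andP[s0 st].
  apply: (is_derive_heat_conv_line x h' gk gk' kk' (measurable_slice s) (gM s)).
  by rewrite subr_gt0.
- by apply: eq_integrable (integrableZl _ B' (integral_weight t0).1).
- by move=> h' s _; rewrite /= in_itv /= => st; exact: kB'.
Qed.

(** The part of the integral from [t - eta] to [t] is at most [2 B c sqrt eta]
uniformly near [t], with [c] a bound of [1 / sqrt s] there; the truncated
integral is continuous by dominated convergence. *)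
Lemma continuous_duhamel m k T B t x : gauss_kernel m k -> 0 <= B ->
  weight_bound k g T B -> 0 < t < T ->
  {for (t, x), continuous (fun p : R * rV => duhamel k g p.1 p.2)}.
Proof.
move=> gk B0 kB /andP[t0 tT].
apply: continuous_at_uniform_limit => e e0.
(* Times near [t] exceed [t / 2], so after removing [eta <= t / 4] the factor
[1 / sqrt s] is still at most [c]. *)
pose c := (Num.sqrt (t / 4))^-1.
have c0 : 0 < c by rewrite invr_gt0 sqrtr_gt0 divr_gt0.
pose d := e / (2 * (B + 1) * c).
have d0 : 0 < d by rewrite divr_gt0// !mulr_gt0// ltr_wpDl.
pose eta := Num.min (t / 4) (d ^+ 2).
have eta0 : 0 < eta by rewrite lt_min divr_gt0//= exprn_gt0.
have eta1 : eta <= t / 4 by rewrite ge_min lexx.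
have eta2 : Num.sqrt eta <= d.
  by rewrite -(ger0_norm (ltW d0)) -sqrtr_sqr ler_wsqrtr// ge_min lexx orbT.
pose G (p : R * rV) := \int[leb]_(s in `]0, T[)
  (if s <= p.1 - eta then heat_conv k (p.1 - s) (g s) p.2 else 0).
have tab : t / 2 < t < T by rewrite tT ltr_pdivrMr// ltr_pMr// ltr1n.
have slab := near_slab x tab ltr01.
exists G; last first.
  apply: filterS slab => -[r z] /= [/andP[r1 r2] _].
  have r0 : 0 < r by lra.
  have rT : 0 < r <= T by rewrite r0 ltW.
  have ik := integrable_duhamel z gk kB rT.
  have re0 : 0 < r - eta by lra.
  have -> : G (r, z) = \int[leb]_(s in `]0, r - eta]) heat_conv k (r - s) (g s) z.
    rewrite /G Rintegral_mkcond [RHS]Rintegral_mkcond; apply: eq_Rintegral => s _.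
    rewrite /patch !mem_setE !in_itv /=; case: (0 < s) => //=.
    case: (leP s (r - eta)) => h; last by case: ifP.
    by rewrite ifT// (le_lt_trans h)// (lt_trans _ r2)// ltrBlDr ltrDl.
  rewrite /duhamel Rintegral_itvB//; last 2 first.
  - by rewrite bnd_simp ltW.
  - by rewrite bnd_simp; lra.
  have ree : r - eta < r by lra.
  have [iR lR] := integral_right_singularity ree.
  have sub : `]r - eta, r[%classic `<=` `]0, r[%classic.
    by move=> s; rewrite /= !in_itv /= => /andP[s1 s2]; apply/andP; split; lra.
  have ik' : leb.-integrable `]r - eta, r[
      (EFin \o (fun s => heat_conv k (r - s) (g s) z)).
    by apply: integrableS ik => //; exact: sub.
  apply: le_trans (le_normr_Rintegral _ ik') _ => //.
  apply: (@le_trans _ _ (\int[leb]_(s in `]r - eta, r[) (B * c * (Num.sqrt (r - s))^-1))).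
    apply: le_Rintegral => //.
    - exact: integrable_norm ik'.
    - by apply: eq_integrable (integrableZl _ (B * c) iR).
    - move=> s; rewrite /= in_itv /= => /andP[s1 s2].
      apply: le_trans (kB _ _ z (_ : 0 < s < r) _) _; [lra|lra|].
      rewrite /weight mulrA ler_wpM2r ?invr_ge0 ?sqrtr_ge0// ler_wpM2l//.
      rewrite lef_pV2 ?posrE ?sqrtr_gt0 ?divr_gt0//; last lra.
      by rewrite ler_wsqrtr//; lra.
  rewrite RintegralZl//; apply: (@le_trans _ _ (B * c * (2 * d))).
    rewrite ler_wpM2l ?mulr_ge0 ?(ltW c0)//; apply: le_trans lR _.
    by rewrite ler_pM2l// (_ : r - (r - eta) = eta)//; ring.
  have -> : e = (B + 1) * c * (2 * d).
    by rewrite /d; field; rewrite !gt_eqF//= ltr_wpDl.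
  apply: ler_wpM2r; first by rewrite mulr_ge0 ?(ltW d0).
  by apply: ler_wpM2r; [exact: ltW|rewrite lerDl].
have c1 : 0 < (Num.sqrt eta)^-1 by rewrite invr_gt0 sqrtr_gt0.
have T0 : 0 < T := lt_trans t0 tT.
apply: (@continuous_param_integral R _ (measurableTypeR R) leb `]0, T[ (measurable_itv _)
  (R * rV)%type (fun p s => if s <= p.1 - eta then heat_conv k (p.1 - s) (g s) p.2 else 0)
  (fun s => B * (Num.sqrt eta)^-1 * (Num.sqrt (s - 0))^-1)).
- by apply: eq_integrable (integrableZl _ (B * (Num.sqrt eta)^-1)
    (integral_left_singularity T0).1).
- apply: filterS slab => -[r z] /= [/andP[r1 r2] _]; split.
    apply: measurable_funTS; apply: measurable_fun_ifT => //.
      exact: measurable_fun_ler.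
    exact: (measurable_heat_conv_slice r z gk).
  move=> s; rewrite in_itv /= => /andP[s0 sT]; case: ifPn => [sr|_].
    apply: le_trans (kB _ _ z (_ : 0 < s < r) _) _; [lra|lra|].
    rewrite /weight -mulrA ler_wpM2l// subr0 mulrC ler_wpM2r ?invr_ge0 ?sqrtr_ge0//.
    rewrite lef_pV2 ?posrE ?sqrtr_gt0//; last lra.
    by rewrite ler_wsqrtr//; lra.
  by rewrite normr0 !mulr_ge0 ?invr_ge0 ?sqrtr_ge0.
(* The truncated integrand is continuous at [(t, x)] except for [s = t - eta]. *)
- exists [set t - eta]; split => //; first exact: lebesgue_measure_set1.
  move=> s /= /not_implyP[_]; apply: contra_notP => /eqP st.
  case: (ltgtP s (t - eta)) st => // [st _|st _].
  + have st' : s + eta < t < T by rewrite tT andbT -ltrBrDr.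
    have ts : 0 < t - s by rewrite subr_gt0 (lt_trans st)// ltrBlDr ltrDl.
    apply: near_eq_continuous; last first.
      exact: (continuous_heat_conv_shift gk (measurable_slice s) (gM s) ts).
    apply: filterS (near_slab x st' ltr01) => p [/andP[p1 _] _].
    by rewrite ifT// lerBrDr ltW.
  + have st' : 0 < t < s + eta by rewrite t0 -ltrBlDr.
    apply: (@near_eq_continuous _ _ (cst 0)); last exact: cst_continuous.
    apply: filterS (near_slab x st' ltr01) => p [/andP[_ p1] _].
    by rewrite ifF//; apply/negbTE; rewrite -ltNge ltrBlDr.
Qed.

End duhamel.

(** * Time derivative of the Duhamel integral *)

Section time_integrals.
Context {R : realType}.
Local Notation leb := (@lebesgue_measure R).
Implicit Types (a b c r s t x : R).

(** Cutting off an interval of length [e] at an inverse square root singularity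
changes an integral by a multiple of [sqrt e]. *)
Lemma eq_of_sqrt_bound (a b C d : R) : 0 < d ->
  (forall e, 0 < e < d -> `|a - b| <= C * Num.sqrt e) -> a = b.
Proof.
move=> d0 H; apply/eqP; rewrite -subr_eq0 -normr_le0; apply/ler_addgt0Pl => z z0.
rewrite addr0.
have C0 : 0 < `|C| + 1 by rewrite ltr_wpDl.
pose q := z / (`|C| + 1).
have q0 : 0 < q by rewrite divr_gt0.
pose e := Num.min (d / 2) (q ^+ 2).
have e0 : 0 < e by rewrite lt_min exprn_gt0// divr_gt0.
have ed : e < d by apply: (@le_lt_trans _ _ (d / 2)); [rewrite ge_min lexx|lra].
have eq : Num.sqrt e <= q.
  by rewrite -(ger0_norm (ltW q0)) -sqrtr_sqr ler_wsqrtr// ge_min lexx orbT.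
apply: le_trans (H e _) _; first by rewrite e0.
apply: (@le_trans _ _ (`|C| * Num.sqrt e)).
  by rewrite ler_wpM2r ?sqrtr_ge0// ler_norm.
apply: (@le_trans _ _ ((`|C| + 1) * q)).
  by apply: ler_pM; rewrite ?sqrtr_ge0// lerDl.
by rewrite /q mulrC divfK// gt_eqF.
Qed.

Lemma integrable_sqrt_singularity (psi : R -> R) a b C : a < b ->
  measurable_fun setT psi ->
  (forall r, a < r <= b -> `|psi r| <= C * (Num.sqrt (r - a))^-1) ->
  leb.-integrable `]a, b[ (EFin \o psi) /\
  `|\int[leb]_(r in `]a, b[) psi r| <= C * (2 * Num.sqrt (b - a)).
Proof.
move=> ab mpsi psiC.
have [iw lw] := integral_left_singularity ab.
have iCw : leb.-integrable `]a, b[ (EFin \o (fun s => C * (Num.sqrt (s - a))^-1)).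
  by apply: eq_integrable (integrableZl _ C iw).
have C0 : 0 <= C.
  have h : 0 < (Num.sqrt (b - a))^-1 by rewrite invr_gt0 sqrtr_gt0 subr_gt0.
  rewrite -(pmulr_lge0 _ h); apply: le_trans (psiC b _); rewrite ?normr_ge0 ?mulrC//.
  by rewrite ab lexx.
have bnd s : `]a, b[%classic s -> `|psi s| <= C * (Num.sqrt (s - a))^-1.
  by rewrite /= in_itv /= => /andP[sa sb]; apply: psiC; rewrite sa ltW.
have ip : leb.-integrable `]a, b[ (EFin \o psi).
  apply: (@dominated_integrableR R _ (measurableTypeR R) leb _ (measurable_itv _) _ _ _ iCw).
    exact: measurable_funTS.
  exact: bnd.
split=> //; apply: le_trans (le_normr_Rintegral _ ip) _ => //.
apply: (@le_trans _ _ (\int[leb]_(s in `]a, b[) (C * (Num.sqrt (s - a))^-1))).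
  by apply: le_Rintegral => //; exact: integrable_norm ip.
by rewrite RintegralZl// ler_wpM2l.
Qed.

(** The fundamental theorem from [a + e] to [b]; what is left near [a] is of order
[sqrt e], both in the integral and in [F]. *)
Lemma ftc_sqrt_singularity (F psi : R -> R) a b C l : a < b ->
  measurable_fun setT psi ->
  (forall r, a < r -> is_derive r 1 F (psi r)) ->
  (forall r, a < r -> {for r, continuous psi}) ->
  (forall r, a < r <= b -> `|psi r| <= C * (Num.sqrt (r - a))^-1) ->
  (forall r, a < r <= b -> `|F r - l| <= C * Num.sqrt (r - a)) ->
  \int[leb]_(r in `]a, b[) psi r = F b - l.
Proof.
move=> ab mpsi dF cpsi psiC FC.
have [ipsi _] := integrable_sqrt_singularity ab mpsi psiC.
have ba : 0 < b - a by rewrite subr_gt0.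
apply: (eq_of_sqrt_bound (C := 3 * C) ba) => e /andP[e0 eba].
have aeb : a + e < b by lra.
have cF r : a < r -> {for r, continuous F}.
  move=> /dF d; apply: differentiable_continuous; apply/derivable1_diffP.
  exact: (@ex_derive _ _ _ _ _ _ _ d).
have E1 : \int[leb]_(r in `[a + e, b]) psi r = F b - F (a + e).
  rewrite /Rintegral (@continuous_FTC2 _ psi F) //.
  - apply: continuous_in_subspaceT => r; rewrite inE /= in_itv /= => ?.
    by apply: cpsi; lra.
  - split.
    + move=> r; rewrite in_itv/= => ?.
      by apply: (@ex_derive _ _ _ _ _ _ _ (dF r _)); lra.
    + by apply: cvg_at_right_filter; apply: cF; lra.
    + by apply: cvg_at_left_filter; apply: cF; lra.
  - move=> r; rewrite in_itv/= => ?; rewrite derive1E.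
    by apply: (@derive_val _ _ _ _ _ _ _ (dF r _)); lra.
have ilast : leb.-integrable `]a + e, b[ (EFin \o psi).
  apply: integrableS ipsi => // r; rewrite /= !in_itv /= => /andP[h ->].
  by rewrite andbT (lt_trans _ h)// ltrDl.
have E2 : \int[leb]_(r in `]a, b[) psi r - \int[leb]_(r in `]a, a + e]) psi r =
    F b - F (a + e).
  rewrite Rintegral_itvB//; last by rewrite bnd_simp lerDl ltW.
  rewrite -E1 Rintegral_itv_obnd_cbnd// Rintegral_itv_bndo_bndc//.
  apply/integrableP; split.
    by apply/measurable_EFinP; exact: measurable_funTS.
  have /integrableP[_] := ilast; rewrite integral_itv_obnd_cbnd//.
  by apply: measurableT_comp => //; apply/measurable_EFinP; exact: measurable_funTS.
have aae : a < a + e by rewrite ltrDl.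
have psiC' r : a < r <= a + e -> `|psi r| <= C * (Num.sqrt (r - a))^-1.
  by move=> rae; apply: psiC; lra.
have [ifirst] := integrable_sqrt_singularity aae mpsi psiC'.
rewrite Rintegral_itv_bndo_bndc// => E3.
have E4 : `|F (a + e) - l| <= C * Num.sqrt e.
  have := FC (a + e); rewrite (_ : a + e - a = e); last by ring.
  by apply; rewrite aae ltW.
move: E2 E3 E4; rewrite (_ : a + e - a = e); last by ring.
set I1 := Rintegral _ _ _; set I2 := Rintegral _ _ _ => E2.
rewrite !ler_norml; lra.
Qed.

Lemma Rintegral_fubini (F : measurableTypeR R * measurableTypeR R -> R) :
  measurable_fun setT F ->
  (leb \x leb)%E.-integrable setT (EFin \o F) ->
  (forall s, leb.-integrable setT (EFin \o (fun r => F (s, r)))) ->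
  (forall r, leb.-integrable setT (EFin \o (fun s => F (s, r)))) ->
  \int[leb]_s \int[leb]_r F (s, r) = \int[leb]_r \int[leb]_s F (s, r).
Proof.
move=> mF iF i1 i2; rewrite /Rintegral; congr fine.
transitivity (\int[leb]_s \int[leb]_r (F (s, r))%:E)%E.
  apply: eq_integral => s _; rewrite fineK//.
  exact: (integrable_fin_num measurableT (i1 s)).
transitivity (\int[leb]_r \int[leb]_s (F (s, r))%:E)%E.
  exact: (@Fubini _ _ _ _ _ leb leb (EFin \o F)).
apply: eq_integral => r _; rewrite fineK//.
exact: (integrable_fin_num measurableT (i2 r)).
Qed.

(** Fubini for the integrand extended by 0 outside the triangle; the weight is
integrable over it, which gives absolute integrability. *)
Lemma Rintegral_triangle (psi : R -> R -> R) t B : 0 < t -> 0 <= B ->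
  measurable_fun [set: measurableTypeR R * measurableTypeR R] (fun p => psi p.1 p.2) ->
  (forall s r, 0 < s < r -> r <= t -> `|psi s r| <= B * weight s r) ->
  \int[leb]_(s in `]0, t[) \int[leb]_(r in `]s, t[) psi s r =
  \int[leb]_(r in `]0, t[) \int[leb]_(s in `]0, r[) psi s r.
Proof.
move=> t0 B0 mpsi psiB.
pose F (p : measurableTypeR R * measurableTypeR R) :=
  if [&& 0 < p.1, p.1 < p.2 & p.2 < t] then psi p.1 p.2 else 0.
have mF : measurable_fun setT F.
  apply: measurable_fun_ifT => //; apply: measurable_and.
    by apply: measurable_fun_ltr => //; exact: measurable_fst.
  apply: measurable_and; apply: measurable_fun_ltr => //.
have EF1 s : (fun r => F (s, r)) =
    (if 0 < s then (fun r => psi s r) \_ `]s, t[ else cst 0).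
  apply/funext => r; rewrite /F /=; case: (0 < s) => //=.
  by rewrite /patch mem_setE in_itv.
have EF2 r : (fun s => F (s, r)) =
    (if r < t then (fun s => psi s r) \_ `]0, r[ else cst 0).
  apply/funext => s; rewrite /F /=; case: (r < t) => /=; last by rewrite !andbF.
  by rewrite andbT /patch mem_setE in_itv.
have m1 s : measurable_fun setT (psi s) := measurable_fun_pair2 s mpsi.
have m2 r : measurable_fun setT (psi ^~ r) := measurable_fun_pair1 r mpsi.
have psiB' s r : 0 < s < t -> s < r <= t ->
    `|psi s r| <= B * (Num.sqrt s)^-1 * (Num.sqrt (r - s))^-1.
  move=> /andP[s0 _] /andP[sr rt]; rewrite -mulrA; apply: psiB => //.
  by rewrite s0.
have i1' s : 0 < s < t -> leb.-integrable `]s, t[ (EFin \o psi s).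
  move=> /[dup] st /andP[_ st'].
  exact: (integrable_sqrt_singularity st' (m1 s) (fun r => psiB' s r st)).1.
have n1' s : 0 < s < t ->
   \int[leb]_(r in `]s, t[) `|psi s r| <= B * (2 * Num.sqrt t) * (Num.sqrt (s - 0))^-1.
  move=> /[dup] st /andP[s0 st'].
  have mn : measurable_fun setT (fun r => `|psi s r|) by exact: measurableT_comp.
  have bn r : s < r <= t -> `|(`|psi s r|)| <= B * (Num.sqrt s)^-1 * (Num.sqrt (r - s))^-1.
    by rewrite normr_id; exact: psiB'.
  have [_] := integrable_sqrt_singularity st' mn bn.
  rewrite ger0_norm; last by apply: Rintegral_ge0.
  move=> /le_trans; apply; rewrite subr0 -!mulrA ler_wpM2l//.
  rewrite [(Num.sqrt s)^-1 * _]mulrC -mulrA ler_wpM2l// ler_wpM2r ?invr_ge0 ?sqrtr_ge0//.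
  by rewrite ler_wsqrtr// lerBlDr lerDl ltW.
have i1 s : leb.-integrable setT (EFin \o (fun r => F (s, r))).
  rewrite EF1; case: ifP => s0; last exact: integrable0.
  rewrite -restrict_EFin; apply: ((@integrable_mkcond
    _ (measurableTypeR R) R leb _ _ (measurable_itv _)).1).
  have [st|ts] := ltP s t; first by apply: i1'; rewrite s0.
  by rewrite set_itv_ge ?bnd_simp -?leNgt//; exact: integrable_set0.
have i2 r : leb.-integrable setT (EFin \o (fun s => F (s, r))).
  rewrite EF2; case: ifP => rt; last exact: integrable0.
  rewrite -restrict_EFin; apply: ((@integrable_mkcond
    _ (measurableTypeR R) R leb _ _ (measurable_itv _)).1).
  have [r0|r0] := ltP 0 r; last first.
    by rewrite set_itv_ge ?bnd_simp -?leNgt//; exact: integrable_set0.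
  have iw : leb.-integrable `]0, r[ (EFin \o (fun s => B * weight s r)).
    by apply: eq_integrable (integrableZl _ B (integral_weight r0).1).
  apply: (@dominated_integrableR R _ (measurableTypeR R) leb _ (measurable_itv _) _ _ _ iw).
    exact: (measurable_funTS (m2 r)).
  by move=> s; rewrite /= in_itv /= => sr; apply: psiB => //; rewrite ltW.
have iF : (leb \x leb)%E.-integrable setT (EFin \o F).
  apply/integrable12ltyP; first exact/measurable_EFinP.
  have [il _] := integral_left_singularity t0.
  have ic : leb.-integrable `]0, t[ (EFin \o (fun s =>
      B * (2 * Num.sqrt t) * (Num.sqrt (s - 0))^-1)).
    by apply: eq_integrable (integrableZl _ (B * (2 * Num.sqrt t)) il).
  move/(@integrable_mkcond _ (measurableTypeR R) R leb _ _ (measurable_itv _)) : ic => ic.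
  have := integrable_lty measurableT ic; apply: le_lt_trans.
  apply: ge0_le_integral => //.
  - by move=> s _; exact: integral_ge0.
  - apply: (@measurable_fun_fubini_tonelli_F _ _ _ _ _ leb
      (fun p => `|(EFin \o F) p|%E)) => //.
    by apply: measurableT_comp => //; exact/measurable_EFinP.
  - exact: (measurable_int leb ic).
  - move=> s _ /=.
    have -> : (\int[leb]_r (`|(F (s, r))|%:E) = (\int[leb]_r `|F (s, r)|)%:E)%E.
      rewrite /Rintegral fineK//; apply: integrable_fin_num => //.
      exact: integrable_norm (i1 s).
    rewrite /patch mem_setE in_itv /=.
    have F0 : ~~ (0 < s < t) -> \int[leb]_r `|F (s, r)| = 0.
      move=> /negP st; rewrite -(@Rintegral_set0 _ _ _ leb (cst (0 : R))) /Rintegral.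
      rewrite integral_set0; congr fine; apply: integral0_eq => r _.
      rewrite /F /= ifF ?normr0//; apply/negP => /and3P[s0 sr rt]; apply: st.
      by rewrite s0 (lt_trans sr).
    case: ifP => [st|/negbT/F0 -> //].
    rewrite lee_fin; apply: le_trans (n1' s st).
    rewrite [leRHS]Rintegral_mkcond le_eqVlt; apply/orP; left; apply/eqP.
    apply: eq_Rintegral => r _; rewrite /F /patch mem_setE in_itv /=.
    by case/andP: (st) => -> _ /=; case: ifP; rewrite ?normr0.
have := Rintegral_fubini mF iF i1 i2.
have -> : \int[leb]_s \int[leb]_r F (s, r) =
    \int[leb]_(s in `]0, t[) \int[leb]_(r in `]s, t[) psi s r.
  rewrite [RHS]Rintegral_mkcond; apply: eq_Rintegral => s _.
  rewrite [RHS]patchE mem_setE in_itv /= EF1.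
  case: (0 < s) => /=; last by rewrite Rintegral_cst// mul0r.
  rewrite -Rintegral_mkcond; case: ifP => // /negbT; rewrite -leNgt => ts.
  by rewrite set_itv_ge ?bnd_simp -?leNgt// Rintegral_set0.
move=> ->; rewrite [RHS]Rintegral_mkcond; apply: eq_Rintegral => r _.
rewrite [RHS]patchE mem_setE in_itv /= EF2 andbC.
case: (r < t) => /=; last by rewrite Rintegral_cst// mul0r.
rewrite -Rintegral_mkcond; case: ifP => // /negbT; rewrite -leNgt => r0.
by rewrite set_itv_ge ?bnd_simp -?leNgt// Rintegral_set0.
Qed.

End time_integrals.

Section duhamel_time.
Context {R : realType} {n : nat}.
Local Notation K := (@heat_kernel R n).
Local Notation rV := 'rV[R]_n.
Local Notation leb := (@lebesgue_measure R).
Implicit Types (x y v w : rV) (r s t : R) (k : R -> rV -> R) (m : nat).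
Variables (g : R -> rV -> R) (M : R).
Hypothesis mg : measurable_fun [set: R * rV] (fun p => g p.1 p.2).
Hypothesis gM : forall s y, `|g s y| <= M.

Let mgs s : measurable_fun setT (g s) := measurable_slice mg s.

Lemma measurable_duhamel m k d (U : measurableType d) (tau : U -> R) (xi : U -> rV) :
  gauss_kernel m k -> measurable_fun setT tau -> measurable_fun setT xi ->
  measurable_fun setT (fun p => duhamel k g (tau p) (xi p)).
Proof.
move=> gk mtau mxi.
pose F (q : U * measurableTypeR R) := if (0 < q.2) && (q.2 < tau q.1)
  then heat_conv k (tau q.1 - q.2) (g q.2) (xi q.1) else 0.
have mtau1 : measurable_fun setT (fun q : U * measurableTypeR R => tau q.1).
  exact: (measurableT_comp mtau measurable_fst).
have msnd : measurable_fun setT (fun q : U * measurableTypeR R => (q.2 : R)).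
  exact: measurable_snd.
have mF : measurable_fun setT F.
  apply: measurable_fun_ifT => //.
    by apply: measurable_and; apply: measurable_fun_ltr.
  apply: (measurable_heat_conv (tau := fun q : U * measurableTypeR R => tau q.1 - q.2)
    (xi := fun q => xi q.1) (G := fun q => g q.2) gk).
  - exact: measurable_funB.
  - exact: (measurableT_comp mxi measurable_fst).
  - apply: (measurableT_comp mg (g := fun q : U * measurableTypeR R * rV =>
      ((q.1.2 : R), q.2))).
    apply: measurable_fun_pair; last exact: measurable_snd.
    exact: (measurableT_comp measurable_snd measurable_fst).
rewrite (_ : (fun p => _) = fun p => \int[leb]_s F (p, s)).
  exact: (measurable_param_Rintegral leb mF).
apply/funext => p; rewrite /duhamel Rintegral_mkcond; apply: eq_Rintegral => s _.
by rewrite patchE mem_setE in_itv.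
Qed.

Variables (T L : R).
Hypotheses (T0 : 0 < T) (L0 : 0 <= L).
Hypothesis gL : forall s y z, 0 < s <= T ->
  `|g s y - g s z| <= L * (Num.sqrt s)^-1 * `|z - y|.

(** The source is Lipschitz with constant [L / sqrt s] at time [s], which halves the
order of the non-integrable singularity [1 / (t - s)] of the kernel. *)
Lemma weight_bound_hk2 v w : exists2 B, 0 <= B & weight_bound (hk2 v w) g T B.
Proof.
have [C C0 HC] := heat_conv_hk2_lipschitz v w.
exists (C * L); first exact: mulr_ge0.
move=> s t x /andP[s0 st] tT; rewrite /weight mulrA -[C * L * _]mulrA.
apply: (HC (g s) M (L * (Num.sqrt s)^-1) (t - s) x (mgs s) (gM s)).
- by rewrite mulr_ge0 ?invr_ge0 ?sqrtr_ge0.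
- by move=> y; apply: gL; rewrite s0 (le_trans _ tT)// ltW.
- by rewrite subr_gt0.
Qed.

Lemma heat_conv_hkt t (h : rV -> R) (N : R) x : measurable_fun setT h -> (forall y, `|h y| <= N) ->
  0 < t -> heat_conv hkt t h x =
  \sum_(i < n) heat_conv (hk2 (delta_mx ord0 i) (delta_mx ord0 i)) t h x.
Proof.
move=> mh hN t0.
rewrite (_ : hkt = fun t x => \sum_(i < n) hk2 (delta_mx ord0 i) (delta_mx ord0 i) t x).
  exact: (heat_conv_sum _ _ (fun i => gauss_kernel_hk2 _ _) mh hN t0).
by apply/funext => s; apply/funext => y; exact: hkt_sum.
Qed.

Lemma weight_bound_hkt : exists2 B, 0 <= B & weight_bound hkt g T B.
Proof.
have H i := weight_bound_hk2 (delta_mx ord0 i) (delta_mx ord0 i).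
have [B HB] := choice (fun i : 'I_n => let: ex_intro2 B B0 kB := H i in
  ex_intro (fun B => 0 <= B /\ weight_bound _ g T B) B (conj B0 kB)).
exists (\sum_(i < n) B i); first by apply: sumr_ge0 => i _; have [] := HB i.
move=> s t x st tT; have ts : 0 < t - s by rewrite subr_gt0; case/andP: st.
rewrite (heat_conv_hkt x (mgs s) (gM s) ts) mulr_suml.
rewrite (le_trans (ler_norm_sum _ _ _))// ler_sum// => i _.
by have [_] := HB i; apply.
Qed.

Lemma duhamel_hkt t x : 0 < t <= T -> duhamel hkt g t x =
  \sum_(i < n) duhamel (hk2 (delta_mx ord0 i) (delta_mx ord0 i)) g t x.
Proof.
move=> tT; rewrite /duhamel.
have ik (i : 'I_n) : leb.-integrable `]0, t[ (EFin \o (fun s =>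
    heat_conv (hk2 (delta_mx ord0 i) (delta_mx ord0 i)) (t - s) (g s) x)).
  have [B B0 kB] := weight_bound_hk2 (delta_mx ord0 i) (delta_mx ord0 i).
  exact: (integrable_duhamel mg x (gauss_kernel_hk2 _ _) kB tT).
transitivity (\int[leb]_(s in `]0, t[) \sum_(i < n)
    heat_conv (hk2 (delta_mx ord0 i) (delta_mx ord0 i)) (t - s) (g s) x).
  apply: eq_Rintegral => s; rewrite inE /= in_itv /= => /andP[s0 st].
  by apply: (heat_conv_hkt x (mgs s) (gM s)); rewrite subr_gt0.
elim: (index_enum _) => [|i r IH].
  under eq_Rintegral do rewrite big_nil.
  by rewrite big_nil Rintegral_cst// mul0r.
rewrite big_cons -IH -RintegralD//.
  by apply: eq_Rintegral => s _; rewrite big_cons.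
rewrite (_ : EFin \o _ = fun s => (\sum_(i <- r)
  (heat_conv (hk2 (delta_mx ord0 i) (delta_mx ord0 i)) (t - s) (g s) x)%:E)%E).
  by apply: integrable_sum => // j _; exact: ik.
by apply/funext => s /=; rewrite sumEFin.
Qed.

Lemma integrable_slice t x : 0 < t ->
  leb.-integrable `]0, t[ (EFin \o (g ^~ x)).
Proof.
move=> t0; apply: measurable_bounded_integrable => //.
- by rewrite /= lebesgue_measure_itv /= lte_fin t0 -EFinB ltry.
- by apply: measurable_funTS; exact: (measurable_fun_pair1 x mg).
- by exists M; split; [exact: num_real|move=> N MN s _; exact: le_trans (gM s x) (ltW MN)].
Qed.

(** For fixed [s], [hkt] is the time derivative of the heat kernel and
[S(r - s) g(s)] tends to [g(s)] as [r] decreases to [s], so that integrating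
over [r] gives [S(t - s) g(s) - g(s)]. Integrating over [s] and exchanging the
integrals gives the claim. *)
Lemma duhamel_time_integral t x : 0 < t <= T ->
  duhamel K g t x - \int[leb]_(s in `]0, t[) g s x =
  \int[leb]_(r in `]0, t[) duhamel hkt g r x.
Proof.
move=> /[dup] tT /andP[t0 tT'].
have [B0 B00 kB0] := gauss_kernel_weight_bound mg gM gauss_kernel_heat isT T0.
have [B B_ge0 kB] := weight_bound_hkt.
have [C C0 HC] := @heat_conv_approx R n.
pose psi s r := heat_conv hkt (r - s) (g s) x.
rewrite -RintegralB//; last 2 first.
- exact: (integrable_duhamel mg x gauss_kernel_heat kB0 tT).
- exact: integrable_slice.
have mpsi : measurable_fun [set: measurableTypeR R * measurableTypeR R]
    (fun p => psi p.1 p.2).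
  have ms : measurable_fun [set: measurableTypeR R * measurableTypeR R]
    (fun p => (p.2 - p.1 : R)).
    by apply: measurable_funB; [exact: measurable_snd|exact: measurable_fst].
  apply: (measurable_heat_conv (tau := fun p : measurableTypeR R * measurableTypeR R =>
    (p.2 - p.1 : R)) (xi := cst x) (G := fun p => g p.1) gauss_kernel_hkt) => //.
  apply: (measurableT_comp mg (g := fun q : measurableTypeR R * measurableTypeR R * rV =>
      ((q.1.1 : R), q.2))).
  apply: measurable_fun_pair; last exact: measurable_snd.
  exact: (measurableT_comp measurable_fst measurable_fst).
have psiB s r : 0 < s < r -> r <= t -> `|psi s r| <= B * weight s r.
  by move=> sr rt; apply: kB => //; exact: le_trans tT'.
rewrite -[RHS](Rintegral_triangle t0 B_ge0 mpsi psiB).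
apply: eq_Rintegral => s; rewrite inE /= in_itv /= => /andP[s0 st].
have sT : 0 < s <= T by rewrite s0 (le_trans _ tT')// ltW.
pose l := L * (Num.sqrt s)^-1.
have l0 : 0 <= l by rewrite mulr_ge0 ?invr_ge0 ?sqrtr_ge0.
apply/esym.
apply: (@ftc_sqrt_singularity R (fun r => heat_conv K (r - s) (g s) x) (psi s) s t
  (B * (Num.sqrt s)^-1 + C * l)) => //.
- exact: (measurable_fun_pair2 s mpsi).
- move=> r sr; have rs : 0 < r - s by rewrite subr_gt0.
  have d1 : is_derive r 1 (fun r => r - s) 1.
    by apply: is_derive_eq; rewrite subr0.
  have d2 := is_derive_heat_conv_time x gauss_kernel_heat gauss_kernel_hkt
    (fun t x => is_derive_heat_kernel_time (t := t) x) (mgs s) (gM s) rs.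
  by have := is_derive_comp_real d1 d2; rewrite mulr1.
- move=> r sr; have rs : 0 < r - s by rewrite subr_gt0.
  have c1 : {for r, continuous (fun r : R => (r, x))}.
    by apply: (@cvg_pair _ _ _ (nbhs r) (nbhs r) (nbhs x)); [exact: cvg_id|exact: cvg_cst].
  exact: (continuous_comp c1 (continuous_heat_conv_shift (x := x) gauss_kernel_hkt (mgs s) (gM s) rs)).
- move=> r /andP[sr rt]; rewrite mulrDl; apply: ler_wpDr.
    by rewrite !mulr_ge0 ?invr_ge0 ?sqrtr_ge0.
  by rewrite -mulrA; apply: psiB; rewrite ?s0.
- move=> r /andP[sr rt]; rewrite mulrDl; apply: ler_wpDl.
    by rewrite !mulr_ge0 ?invr_ge0 ?sqrtr_ge0.
  apply: (HC (g s) M l (r - s) x (mgs s) (gM s) l0); last by rewrite subr_gt0.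
  by move=> y; exact: gL.
Qed.

(** By [duhamel_time_integral] the Duhamel term is the primitive of
[g s x + duhamel hkt g s x], which is continuous at [s = t]. *)
Lemma is_derive_duhamel_time t x : 0 < t < T -> {for t, continuous (g ^~ x)} ->
  is_derive t 1 (fun t => duhamel K g t x) (g t x + duhamel hkt g t x).
Proof.
move=> /andP[t0 tT] cg.
have [B B_ge0 kB] := weight_bound_hkt.
pose h s := g s x + duhamel hkt g s x.
(* Room to the right of [t] for the two-sided derivative. *)
pose u := (t + T) / 2.
have tu : t < u by rewrite /u; lra.
have uT : u < T by rewrite /u; lra.
have u0 : 0 < u := lt_trans t0 tu.
have md : measurable_fun setT (fun s : R => duhamel hkt g s x).
  exact: (measurable_duhamel (tau := id) (xi := cst x) gauss_kernel_hkt).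
have mgx : measurable_fun setT (g ^~ x) := measurable_fun_pair1 x mg.
have mh : measurable_fun setT h by exact: measurable_funD.
have ih_ r : 0 < r <= T -> leb.-integrable `]0, r] (EFin \o h).
  move=> /andP[r0 rT]; apply: measurable_bounded_integrable => //.
  - by rewrite /= lebesgue_measure_itv /= lte_fin r0 -EFinB ltry.
  - exact: measurable_funTS.
  - exists (M + B * 8); split; first exact: num_real.
    move=> N MN s; rewrite /= in_itv /= => /andP[s0 sr]; apply: le_trans (ltW MN).
    rewrite (le_trans (ler_normD _ _))// lerD ?gM//.
    by apply: (duhamel_le mg x gauss_kernel_hkt B_ge0 kB); rewrite s0 (le_trans sr).
have ch : {for t, continuous h}.
  apply: continuousD => //.
  have c1 : {for t, continuous (fun r : R => (r, x))}.
    by apply: (@cvg_pair _ _ _ (nbhs t) (nbhs t) (nbhs x)); [exact: cvg_id|exact: cvg_cst].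
  have tT2 : 0 < t < T by rewrite t0.
  exact: (continuous_comp c1 (continuous_duhamel mg gM (x := x) gauss_kernel_hkt B_ge0 kB tT2)).
have uT' : 0 < u <= T by rewrite u0 ltW.
have [d1 d2] := @continuous_FTC1 R h (BRight 0) t u tu (ih_ _ uT') t0 ch.
have E s : 0 < s < T -> \int[leb]_(r in `]0, s]) h r = duhamel K g s x.
  move=> /andP[s0 sT]; have sT' : 0 < s <= T by rewrite s0 ltW.
  have ih := ih_ _ sT'.
  have ih' : leb.-integrable `]0, s[ (EFin \o h).
    by apply: integrableS ih => // r; rewrite /= !in_itv /= => /andP[-> /ltW].
  rewrite -Rintegral_itv_bndo_bndc// RintegralD//.
  - by rewrite -duhamel_time_integral// addrC subrK.
  - exact: integrable_slice.
  - rewrite (_ : EFin \o _ = ((EFin \o h) \- (EFin \o (g ^~ x)))%E).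
      by apply: integrableB => //; exact: integrable_slice.
    by apply/funext => r /=; rewrite -EFinB /h addrAC subrr add0r.
apply: (near_eq_is_derive (f := fun s => \int[leb]_(r in `]0, s]) h r)).
  have tI : t \in `]0, T[ by rewrite in_itv /= t0.
  by apply: filterS (near_in_itvoo tI) => s; rewrite in_itv; exact: E.
by apply: DeriveDef; [exact: d1|rewrite -derive1E; exact: d2].
Qed.

End duhamel_time.

(** * Mild solutions between barriers *)

Section heat_semigroup_order.
Context {R : realType} {n : nat}.
Local Notation K := (@heat_kernel R n).
Local Notation rV := 'rV[R]_n.
Local Notation nu := (lebesgue_row R n).
Implicit Types (x y : rV) (s t M : R) (g h : rV -> R).

Lemma heat_convZ t g M x (c : R) : measurable_fun setT g ->
  (forall y, `|g y| <= M) -> 0 < t ->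
  heat_conv K t (fun y => c * g y) x = c * heat_conv K t g x.
Proof.
move=> mg gM t0; rewrite /heat_conv -RintegralZl//.
  by apply: eq_Rintegral => y _; rewrite mulrCA.
exact: (integrable_heat_conv mg gM x gauss_kernel_heat t0).
Qed.

Lemma heat_convN t g M x : measurable_fun setT g ->
  (forall y, `|g y| <= M) -> 0 < t ->
  heat_conv K t (fun y => - g y) x = - heat_conv K t g x.
Proof.
move=> mg gM t0; rewrite -mulN1r -(heat_convZ x (-1) mg gM t0).
by congr heat_conv; apply/funext => y; rewrite mulN1r.
Qed.

Lemma le_heat_conv t g h M N x : measurable_fun setT g -> (forall y, `|g y| <= M) ->
  measurable_fun setT h -> (forall y, `|h y| <= N) -> 0 < t ->
  (forall y, g y <= h y) -> heat_conv K t g x <= heat_conv K t h x.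
Proof.
move=> mg gM mh hN t0 gh; apply: le_Rintegral => //.
- exact: (integrable_heat_conv mg gM x gauss_kernel_heat t0).
- exact: (integrable_heat_conv mh hN x gauss_kernel_heat t0).
- by move=> y _; rewrite ler_wpM2l ?heat_kernel_ge0.
Qed.

Lemma heat_conv_ge0 t g x : (forall y, 0 <= g y) -> 0 <= heat_conv K t g x.
Proof. by move=> g0; apply: Rintegral_ge0 => y _; rewrite mulr_ge0 ?heat_kernel_ge0. Qed.

Lemma heat_conv_norm_le t g M x : measurable_fun setT g -> (forall y, `|g y| <= M) ->
  0 < t -> `|heat_conv K t g x| <= M.
Proof.
move=> mg gM t0.
have mc (c : R) : measurable_fun [set: rV] (cst c) by [].
have cM (c : R) (y : rV) : `|(cst c y : R)| <= `|c| by [].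
rewrite ler_norml -{1}(heat_conv_cst x (- M) t0) -{2}(heat_conv_cst x M t0).
apply/andP; split.
  apply: (le_heat_conv x (mc _) (cM (- M)) mg gM t0) => y /=.
  by have := gM y; rewrite ler_norml => /andP[].
apply: (le_heat_conv x mg gM (mc _) (cM M) t0) => y /=.
by have := gM y; rewrite ler_norml => /andP[].
Qed.

Lemma measurable_heat_conv_space t g : measurable_fun setT g ->
  measurable_fun setT (heat_conv K t g).
Proof.
move=> mg; apply: (measurable_heat_conv (tau := cst t) (xi := id)
  (G := fun=> g) gauss_kernel_heat) => //.
exact: (measurableT_comp mg measurable_snd).
Qed.

Lemma EFin_heat_conv t g M x : measurable_fun setT g -> (forall y, `|g y| <= M) ->
  0 < t -> ((heat_conv K t g x)%:E = \int[nu]_y (K t (x - y) * g y)%:E)%E.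
Proof.
move=> mg gM t0; rewrite /heat_conv /Rintegral fineK//.
apply: (integrable_fin_num measurableT).
exact: (integrable_heat_conv mg gM x gauss_kernel_heat t0).
Qed.

(** Tonelli's theorem and the semigroup law of the kernel; as [g] is nonnegative,
no integrability on the product is at stake. *)
Lemma heat_conv_semigroup s t g M x : measurable_fun setT g ->
  (forall y, 0 <= g y) -> (forall y, `|g y| <= M) -> 0 < s -> 0 < t ->
  heat_conv K t (heat_conv K s g) x = heat_conv K (t + s) g x.
Proof.
move=> mg g0 gM s0 t0.
have mS := measurable_heat_conv_space s mg.
have SM y := heat_conv_norm_le y mg gM s0.
apply: EFin_inj; rewrite (EFin_heat_conv x mS SM t0).
rewrite (EFin_heat_conv x mg gM (addr_gt0 t0 s0)).
have mk r z : measurable_fun [set: rV] (fun y => K r (z - y)).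
  exact: measurable_kernel_translate gauss_kernel_heat.
have mk2 r : measurable_fun [set: rV * rV] (fun p => K r (p.1 - p.2)).
  have [mK _ _] := @gauss_kernel_heat R n.
  apply: (measurableT_comp mK (g := fun p : rV * rV => (r, p.1 - p.2))).
  apply: measurable_fun_pair => //.
  by apply: measurable_rowB; [exact: measurable_fst|exact: measurable_snd].
pose F (p : rV * rV) : R := K t (x - p.1) * (K s (p.1 - p.2) * g p.2).
have mF : measurable_fun setT F.
  apply: measurable_funM; first exact: (measurableT_comp (mk t x) measurable_fst).
  by apply: measurable_funM => //; exact: (measurableT_comp mg measurable_snd).
transitivity (\int[nu]_y \int[nu]_z (F (y, z))%:E)%E.
  apply: eq_integral => y _; rewrite EFinM (EFin_heat_conv y mg gM s0).
  rewrite -ge0_integralZl//.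
  - apply/measurable_EFinP; apply: measurable_funM => //; exact: mk.
  - by move=> z _; rewrite lee_fin mulr_ge0 ?heat_kernel_ge0.
  - by rewrite lee_fin heat_kernel_ge0.
rewrite (@fubini_tonelli _ _ _ _ _ nu nu (EFin \o F)); first last.
- by move=> p; rewrite lee_fin !mulr_ge0 ?powR_ge0 ?expR_ge0.
- exact/measurable_EFinP.
apply: eq_integral => z _.
transitivity (\int[nu]_y ((g z)%:E * (K t (x - y) * K s (y - z))%:E))%E.
  by apply: eq_integral => y _; rewrite /F /= -EFinM; congr (_%:E); ring.
rewrite ge0_integralZl//.
- by rewrite heat_kernel_semigroup// -EFinM mulrC.
- apply/measurable_EFinP; apply: measurable_funM; first exact: mk.
  exact: (measurable_fun_pair1 z (mk2 s)).
- by move=> y _; rewrite lee_fin mulr_ge0 ?heat_kernel_ge0.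
- by rewrite lee_fin.
Qed.

End heat_semigroup_order.

Section mild_solution.
Context {R : realType} {n : nat}.
Local Notation K := (@heat_kernel R n).
Local Notation rV := 'rV[R]_n.
Local Notation leb := (@lebesgue_measure R).
Implicit Types (x y : rV) (s t N : R) (G : R -> rV -> R).

Lemma duhamelN G N t x : measurable_fun [set: R * rV] (fun p => G p.1 p.2) ->
  (forall s y, `|G s y| <= N) -> 0 < t ->
  duhamel K (fun s y => - G s y) t x = - duhamel K G t x.
Proof.
move=> mG GN t0.
have [B B0 kB] := gauss_kernel_weight_bound mG GN gauss_kernel_heat isT t0.
have tt : 0 < t <= t by rewrite t0 lexx.
have ik := integrable_duhamel mG x gauss_kernel_heat kB tt.
rewrite /duhamel -mulN1r -RintegralZl//; apply: eq_Rintegral => s.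
rewrite inE /= in_itv /= => /andP[s0 st].
by rewrite mulN1r (heat_convN x (measurable_slice mG s) (GN s))// subr_gt0.
Qed.

Lemma le_duhamel G G' N N' t x :
  measurable_fun [set: R * rV] (fun p => G p.1 p.2) -> (forall s y, `|G s y| <= N) ->
  measurable_fun [set: R * rV] (fun p => G' p.1 p.2) -> (forall s y, `|G' s y| <= N') ->
  0 < t -> (forall s y, G s y <= G' s y) -> duhamel K G t x <= duhamel K G' t x.
Proof.
move=> mG GN mG' GN' t0 GG'.
have [B B0 kB] := gauss_kernel_weight_bound mG GN gauss_kernel_heat isT t0.
have [B' B'0 kB'] := gauss_kernel_weight_bound mG' GN' gauss_kernel_heat isT t0.
have tt : 0 < t <= t by rewrite t0 lexx.
apply: le_Rintegral => //.
- exact: (integrable_duhamel mG x gauss_kernel_heat kB tt).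
- exact: (integrable_duhamel mG' x gauss_kernel_heat kB' tt).
- move=> s; rewrite /= in_itv /= => /andP[s0 st].
  apply: (le_heat_conv x (measurable_slice mG s) (GN s) (measurable_slice mG' s) (GN' s)) => //.
  by rewrite subr_gt0.
Qed.

Lemma duhamel_norm_le G N t x :
  measurable_fun [set: R * rV] (fun p => G p.1 p.2) -> (forall s y, `|G s y| <= N) ->
  0 < t -> `|duhamel K G t x| <= N * t.
Proof.
move=> mG GN t0.
have [B B0 kB] := gauss_kernel_weight_bound mG GN gauss_kernel_heat isT t0.
have tt : 0 < t <= t by rewrite t0 lexx.
have ik := integrable_duhamel mG x gauss_kernel_heat kB tt.
have mu_t : leb `]0, t[%classic = t%:E.
  by rewrite /= lebesgue_measure_itv /= lte_fin t0 -EFinB subr0.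
apply: le_trans (le_normr_Rintegral _ ik) _ => //.
apply: (@le_trans _ _ (\int[leb]_(s in `]0, t[) N)); last first.
  by rewrite Rintegral_cst// [X in fine X]mu_t.
apply: le_Rintegral => //.
- exact: integrable_norm ik.
- apply: measurable_bounded_integrable => //; first by rewrite [X in (X < _)%E]mu_t ltry.
  exact: bounded_cst.
- move=> s; rewrite /= in_itv /= => /andP[s0 st].
  by apply: (heat_conv_norm_le x (measurable_slice mG s) (GN s)); rewrite subr_gt0.
Qed.

(** As [S(t - s) S(s) p = S(t) p] does not depend on [s], it can be taken out of the
time integral. *)
Lemma duhamel_le_semigroup G N (Lambda : R -> R) (c : R) (p : rV -> R) (D : R) t x :
  measurable_fun [set: R * rV] (fun q => G q.1 q.2) -> (forall s y, `|G s y| <= N) ->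
  measurable_fun setT p -> (forall y, 0 <= p y) -> (forall y, `|p y| <= D) -> 0 < t ->
  leb.-integrable `]0, t[ (EFin \o Lambda) ->
  (forall s y, 0 < s -> G s y <= Lambda s * (c * heat_conv K s p y)) ->
  duhamel K G t x <= (\int[leb]_(s in `]0, t[) Lambda s) * (c * heat_conv K t p x).
Proof.
move=> mG GN mp p0 pD t0 iL GL.
have [B B0 kB] := gauss_kernel_weight_bound mG GN gauss_kernel_heat isT t0.
have tt : 0 < t <= t by rewrite t0 lexx.
have ik := integrable_duhamel mG x gauss_kernel_heat kB tt.
rewrite -RintegralZr//; apply: le_Rintegral => //.
  by apply: eq_integrable (integrableZr _ (c * heat_conv K t p x) iL).
move=> s; rewrite /= in_itv /= => /andP[s0 st].
have ts : 0 < t - s by rewrite subr_gt0.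
have mS := measurable_heat_conv_space s mp.
have SD y := heat_conv_norm_le y mp pD s0.
rewrite (_ : Lambda s * _ = heat_conv K (t - s)
    (fun y => Lambda s * c * heat_conv K s p y) x); last first.
  by rewrite (heat_convZ x _ mS SD ts) (heat_conv_semigroup x mp p0 pD s0 ts) subrK mulrA.
apply: (le_heat_conv x (measurable_slice mG s) (GN s) _
    (N := `|Lambda s * c| * D) _ ts).
- exact: measurable_funM.
- by move=> y; rewrite normrM ler_wpM2l.
- by move=> y; rewrite -mulrA; exact: GL.
Qed.

Variables (f : R -> R) (phi : rV -> R) (A D : R) (Lambda : R -> R).
Hypotheses (f_mono : {homo f : a b / a <= b}) (f_cont : continuous f).
Hypotheses (A1 : 1 < A) (mphi : measurable_fun setT phi) (phiD : forall y, `|phi y| <= D).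
Hypothesis iL : forall t, 0 < t -> leb.-integrable `]0, t[ (EFin \o Lambda).
Hypothesis L_le : forall t, 0 < t -> \int[leb]_(s in `]0, t[) Lambda s <= 1 - A^-1.

Let A0 : 0 < A. Proof. exact: lt_trans A1. Qed.

Definition pos_part y : R := Num.max (phi y) 0.
Definition neg_part y : R := Num.min (phi y) 0.

(** With the value 0 at nonpositive times, the barriers are measurable on the whole
of space-time, and functions between them are bounded there. *)
Definition upper_barrier t x := if 0 < t then A * heat_conv K t pos_part x else 0.
Definition lower_barrier t x := if 0 < t then A * heat_conv K t neg_part x else 0.

Hypothesis f_upper : forall s y, 0 < s ->
  f (upper_barrier s y) <= Lambda s * upper_barrier s y.
Hypothesis f_lower : forall s y, 0 < s ->
  Lambda s * lower_barrier s y <= f (lower_barrier s y).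

Let mp : measurable_fun setT pos_part.
Proof. exact: measurable_maxr. Qed.

Let mq : measurable_fun setT neg_part.
Proof. exact: measurable_minr. Qed.

Let pD y : `|pos_part y| <= D.
Proof.
have := phiD y; rewrite !ler_norml /pos_part => /andP[h1 h2].
by case: (leP (phi y) 0) => ?; apply/andP; split; lra.
Qed.

Let qD y : `|neg_part y| <= D.
Proof.
have := phiD y; rewrite !ler_norml /neg_part => /andP[h1 h2].
by case: (leP (phi y) 0) => ?; apply/andP; split; lra.
Qed.

Let p0 y : 0 <= pos_part y. Proof. by rewrite le_max lexx orbT. Qed.

Let q0 y : 0 <= - neg_part y. Proof. by rewrite oppr_ge0 ge_min lexx orbT. Qed.

Let D0 : 0 <= D. Proof. exact: le_trans (normr_ge0 _) (phiD 0). Qed.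

Lemma upper_barrier_le t x : `|upper_barrier t x| <= A * D.
Proof.
rewrite /upper_barrier; case: ifP => t0; last by rewrite normr0 mulr_ge0 ?(ltW A0) ?D0.
rewrite normrM (ger0_norm (ltW A0)) ler_pM2l//.
exact: (heat_conv_norm_le x mp pD t0).
Qed.

Lemma lower_barrier_le t x : `|lower_barrier t x| <= A * D.
Proof.
rewrite /lower_barrier; case: ifP => t0; last by rewrite normr0 mulr_ge0 ?(ltW A0) ?D0.
rewrite normrM (ger0_norm (ltW A0)) ler_pM2l//.
exact: (heat_conv_norm_le x mq qD t0).
Qed.

Let f_bound := `|f (A * D)| + `|f (- (A * D))|.

Let f_bounded z : `|z| <= A * D -> `|f z| <= f_bound.
Proof.
rewrite ler_norml => /andP[/f_mono h1 /f_mono h2].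
have h3 := ler_norm (f (A * D)).
have h4 : - f (- (A * D)) <= `|f (- (A * D))| by rewrite -normrN ler_norm.
have h5 := normr_ge0 (f (A * D)).
have h6 := normr_ge0 (f (- (A * D))).
by rewrite ler_norml /f_bound; apply/andP; split; lra.
Qed.

Definition mild_map (u : R -> rV -> R) t x : R :=
  if 0 < t then heat_conv K t phi x + duhamel K (fun s y => f (u s y)) t x else 0.

Definition between_barriers (u : R -> rV -> R) :=
  measurable_fun [set: R * rV] (fun p => u p.1 p.2) /\
  forall t x, lower_barrier t x <= u t x <= upper_barrier t x.

Let u_bounded u t x : between_barriers u -> `|u t x| <= A * D.
Proof.
move=> [_ /(_ t x) /andP[h1 h2]].
have := upper_barrier_le t x; have := lower_barrier_le t x.
by rewrite !ler_norml; lra.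
Qed.

Let mf : measurable_fun [set: R] f.
Proof. exact: continuous_measurable_fun. Qed.

Let mfu u : between_barriers u ->
  measurable_fun [set: R * rV] (fun p => f (u p.1 p.2)).
Proof. by move=> [mu _]; exact: (measurableT_comp mf mu). Qed.

Let fu_bounded u s y : between_barriers u -> `|f (u s y)| <= f_bound.
Proof. by move=> bu; apply: f_bounded; exact: u_bounded. Qed.

Let measurable_barrier (g : rV -> R) : measurable_fun setT g ->
  measurable_fun [set: R * rV]
    (fun p => if 0 < p.1 then A * heat_conv K p.1 g p.2 else 0).
Proof.
move=> mg; apply: measurable_fun_ifT => //.
  by apply: measurable_fun_ltr => //; exact: measurable_fst.
apply: measurable_funM => //.
apply: (measurable_heat_conv (tau := fun p : R * rV => p.1) (xi := snd)
  (G := fun=> g) gauss_kernel_heat).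
- exact: measurable_fst.
- exact: measurable_snd.
- exact: (measurableT_comp mg measurable_snd).
Qed.

(** The monotonicity of [f] replaces [u] by a barrier in the source, and
[duhamel_le_semigroup] gives [S(t) phi^+ + (int Lambda) A S(t) phi^+], where
[A int Lambda <= A - 1]. *)
Lemma mild_map_between u : between_barriers u -> between_barriers (mild_map u).
Proof.
move=> bu; have [mu wu] := bu; split.
  apply: measurable_fun_ifT => //.
    by apply: measurable_fun_ltr => //; exact: measurable_fst.
  apply: measurable_funD.
    apply: (measurable_heat_conv (tau := fun p : R * rV => p.1) (xi := snd)
      (G := fun=> phi) gauss_kernel_heat).
    - exact: measurable_fst.
    - exact: measurable_snd.
    - exact: (measurableT_comp mphi measurable_snd).
  apply: (measurable_duhamel (mfu bu) gauss_kernel_heat).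
    exact: measurable_fst.
  exact: measurable_snd.
move=> t x; rewrite /mild_map /lower_barrier /upper_barrier; case: ifP => t0.
  2: by rewrite lexx.
have AL : (\int[leb]_(s in `]0, t[) Lambda s) * A <= A - 1.
  have := ler_wpM2r (ltW A0) (L_le t0).
  by rewrite mulrBl mul1r mulVf// gt_eqF.
have Spp := heat_conv_ge0 t x p0.
have Sqq := heat_conv_ge0 t x q0.
have SN := heat_convN x mq qD t0.
apply/andP; split.
- have h1 : heat_conv K t neg_part x <= heat_conv K t phi x.
    by apply: (le_heat_conv x mq qD mphi phiD t0) => y; rewrite ge_min lexx.
  have h2 : duhamel K (fun s y => - f (u s y)) t x <=
      (\int[leb]_(s in `]0, t[) Lambda s) * (A * heat_conv K t (fun y => - neg_part y) x).
    apply: (@duhamel_le_semigroup _ f_bound _ _ _ D) => //.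
    - exact: measurable_funN (mfu bu).
    - by move=> s y; rewrite normrN; exact: fu_bounded.
    - exact: measurable_funN.
    - by move=> y; rewrite normrN.
    - exact: iL.
    - move=> s y s0; rewrite (heat_convN y mq qD s0) !mulrN lerN2.
      have := f_lower y s0; rewrite /lower_barrier s0 => /le_trans; apply.
      by apply: f_mono; have /andP[] := wu s y; rewrite /lower_barrier s0.
  rewrite (duhamelN x (mfu bu) (fun s y => fu_bounded s y bu) t0) in h2.
  rewrite mulrA in h2.
  have h3 := le_trans h2 (ler_wpM2r Sqq AL).
  rewrite SN in h3; lra.
- have h1 : heat_conv K t phi x <= heat_conv K t pos_part x.
    by apply: (le_heat_conv x mphi phiD mp pD t0) => y; rewrite le_max lexx.
  have h2 : duhamel K (fun s y => f (u s y)) t x <=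
      (\int[leb]_(s in `]0, t[) Lambda s) * (A * heat_conv K t pos_part x).
    apply: (@duhamel_le_semigroup _ f_bound _ _ _ D) => //.
    - exact: mfu bu.
    - by move=> s y; exact: fu_bounded.
    - exact: iL.
    - move=> s y s0.
      have := f_upper y s0; rewrite /upper_barrier s0; apply: le_trans.
      by apply: f_mono; have /andP[] := wu s y; rewrite /upper_barrier s0.
  rewrite mulrA in h2.
  have h3 := le_trans h2 (ler_wpM2r Spp AL).
  lra.
Qed.

(** [f] is nondecreasing and the heat kernel is nonnegative. *)
Lemma mild_map_mono u v : between_barriers u -> between_barriers v ->
  (forall t x, u t x <= v t x) -> forall t x, mild_map u t x <= mild_map v t x.
Proof.
move=> bu bv uv t x; rewrite /mild_map; case t0 : (0 < t); last exact: lexx.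
apply: lerD; first exact: lexx.
apply: (le_duhamel x (mfu bu) (fun s y => fu_bounded s y bu)
  (mfu bv) (fun s y => fu_bounded s y bv) t0) => s y.
exact: f_mono.
Qed.

Fixpoint mild_iter (j : nat) : R -> rV -> R :=
  if j is j'.+1 then mild_map (mild_iter j') else upper_barrier.

Lemma lower_le_upper_barrier t x : lower_barrier t x <= upper_barrier t x.
Proof.
rewrite /lower_barrier /upper_barrier; case: ifP => [t0|_]; last exact: lexx.
rewrite ler_pM2l//; apply: (le_heat_conv x mq qD mp pD t0) => y.
by rewrite (@le_trans _ _ (phi y))// ?ge_min ?le_max lexx.
Qed.

Lemma mild_iter_between j : between_barriers (mild_iter j).
Proof.
elim: j => [|j IH]; last exact: mild_map_between.
split; first exact: measurable_barrier.
by move=> t x /=; rewrite lower_le_upper_barrier lexx.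
Qed.

(** The first step decreases because the map stays below the upper barrier; the
others follow by monotonicity. *)
Lemma mild_iter_decr j t x : mild_iter j.+1 t x <= mild_iter j t x.
Proof.
elim: j t x => [|j IH] t x.
  by have [_ /(_ t x) /andP[]] := mild_iter_between 1.
exact: (mild_map_mono (mild_iter_between j.+1) (mild_iter_between j) IH).
Qed.

Definition mild_limit t x : R := limn (fun j => mild_iter j t x).

Lemma cvg_mild_iter t x : (fun j => mild_iter j t x) @ \oo --> mild_limit t x.
Proof.
apply: nonincreasing_is_cvgn.
  by apply/nonincreasing_seqP => j; exact: mild_iter_decr.
exists (lower_barrier t x) => _ [j _ <-].
by have [_ /(_ t x) /andP[]] := mild_iter_between j.
Qed.

Lemma mild_limit_between : between_barriers mild_limit.
Proof.
split.
  apply: (measurable_fun_cvg (h := fun j (p : R * rV) => mild_iter j p.1 p.2)).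
    by move=> j; have [] := mild_iter_between j.
  by move=> p _; exact: cvg_mild_iter.
move=> t x; apply/andP; split.
  apply: (cvgr_to_ge (cvg_mild_iter (t := t) (x := x))); apply: nearW => j.
  by have [_ /(_ t x) /andP[]] := mild_iter_between j.
apply: (cvgr_to_le (cvg_mild_iter (t := t) (x := x))); apply: nearW => j.
by have [_ /(_ t x) /andP[]] := mild_iter_between j.
Qed.

(** Dominated convergence, first in space and then in time; the iterates share the
bound [A D]. *)
Lemma cvg_mild_map t x :
  (fun j => mild_map (mild_iter j) t x) @ \oo --> mild_map mild_limit t x.
Proof.
rewrite /mild_map; case t0 : (0 < t); last exact: cvg_cst.
apply: cvgD; first exact: cvg_cst.
have bl := mild_limit_between.
have bi j := mild_iter_between j.
have mu_t : leb `]0, t[%classic = t%:E.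
  by rewrite /= lebesgue_measure_itv /= lte_fin t0 -EFinB subr0.
apply: (@dominated_cvgR R _ (measurableTypeR R) leb `]0, t[ (measurable_itv _)
  (fun j s => heat_conv K (t - s) (fun y => f (mild_iter j s y)) x)
  (fun s => heat_conv K (t - s) (fun y => f (mild_limit s y)) x)
  (cst f_bound) _ _ _ _ _).2.
- move=> j; apply: measurable_funTS.
  exact: (@measurable_heat_conv_slice R n (fun s y => f (mild_iter j s y))
    (mfu (bi j)) _ _ t x gauss_kernel_heat).
- apply: measurable_funTS.
  exact: (@measurable_heat_conv_slice R n (fun s y => f (mild_limit s y))
    (mfu bl) _ _ t x gauss_kernel_heat).
- apply: aeW => s; rewrite /= in_itv /= => /andP[s0 st].
  have ts : 0 < t - s by rewrite subr_gt0.
  have ms u : between_barriers u -> measurable_fun setT (fun y => f (u s y)).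
    by move=> bu; exact: (@measurable_slice R n (fun s y => f (u s y)) (mfu bu) s).
  apply: (@dominated_cvgR R _ rV (lebesgue_row R n) setT measurableT
    (fun j y => K (t - s) (x - y) * f (mild_iter j s y))
    (fun y => K (t - s) (x - y) * f (mild_limit s y))
    (fun y => f_bound * K (t - s) (x - y)) _ _ _ _ _).2.
  + move=> j; apply: measurable_funM; last exact: ms.
    exact: measurable_kernel_translate gauss_kernel_heat.
  + apply: measurable_funM; last exact: ms.
    exact: measurable_kernel_translate gauss_kernel_heat.
  + apply: aeW => y _; apply: cvgM; first exact: cvg_cst.
    apply: continuous_cvg; [exact: f_cont|exact: cvg_mild_iter].
  + by apply: eq_integrable (integrableZl measurableT f_bound (integrable_heat_kernel x ts)).
  + move=> j y _; rewrite normrM (ger0_norm (heat_kernel_ge0 _ _)) mulrC.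
    by apply: ler_wpM2r; [exact: heat_kernel_ge0|exact: fu_bounded].
- apply: measurable_bounded_integrable => //; first by rewrite [X in (X < _)%E]mu_t ltry.
  exact: bounded_cst.
- move=> j s; rewrite /= in_itv /= => /andP[s0 st].
  apply: (heat_conv_norm_le x (@measurable_slice R n (fun s y => f (mild_iter j s y)) (mfu (bi j)) s)
    (fun y => fu_bounded s y (bi j))).
  by rewrite subr_gt0.
Qed.

Theorem exists_mild_solution : exists u, [/\
  measurable_fun [set: R * rV] (fun p => u p.1 p.2),
  forall t x, lower_barrier t x <= u t x <= upper_barrier t x &
  forall t x, 0 < t ->
    u t x = heat_conv K t phi x + duhamel K (fun s y => f (u s y)) t x].
Proof.
exists mild_limit; have [ml bl] := mild_limit_between; split=> // t x t0.
have E : mild_map mild_limit t x = mild_limit t x.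
  apply: (cvg_unique _ (cvg_mild_map (t := t) (x := x))) => //.
  have := cvg_mild_iter (t := t) (x := x).
  by rewrite -(cvg_shiftS (fun j => mild_iter j t x)).
by rewrite -E /mild_map t0.
Qed.

End mild_solution.

(** * Regularity of bounded mild solutions *)

Section gradient_bound.
Context {R : realType} {n : nat}.
Local Notation K := (@heat_kernel R n).
Local Notation rV := 'rV[R]_n.
Implicit Types (x y v : rV) (s t M : R) (g : rV -> R).

Lemma hk1_bounded : exists2 C, 0 <= C & forall v t x, 0 < t ->
  `|hk1 v t x| <= C * `|v| * (Num.sqrt t)^-1 * K (2 * t) x.
Proof.
have [C C0 HC] := @gauss_bounded_moment R n; exists (n%:R / 2 * C).
  by rewrite !mulr_ge0 ?invr_ge0 ?ler0n.
move=> v t x t0; have := HC t x t0.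
have h0 : 0 <= t^-1 * `|x| * K t x.
  by apply: mulr_ge0; [rewrite mulr_ge0 ?invr_ge0 ?(ltW t0)|exact: heat_kernel_ge0].
rewrite (ger0_norm h0) expr1 => H.
rewrite /hk1 normrM normrN (ger0_norm (heat_kernel_ge0 _ _)).
apply: (@le_trans _ _ (n%:R / 2 * `|v| * (t^-1 * `|x| * K t x))).
  rewrite normrM [`|_^-1|]ger0_norm ?invr_ge0 ?mulr_ge0 ?(ltW t0)//.
  rewrite (_ : n%:R / 2 * `|v| * (t^-1 * `|x| * K t x) =
    n%:R * `|v| * `|x| * (2 * t)^-1 * K t x); last by rewrite invfM; ring.
  apply: ler_wpM2r; first exact: heat_kernel_ge0.
  by apply: ler_wpM2r (dot_le v x); rewrite invr_ge0 mulr_ge0 ?(ltW t0).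
have nv : 0 <= n%:R / 2 * `|v| by rewrite !mulr_ge0 ?invr_ge0 ?ler0n.
have := ler_wpM2l nv H; move=> /le_trans; apply.
by rewrite !mulrA (mulrAC _ (`|v|)).
Qed.

Lemma heat_conv_hk1_le : exists2 C, 0 <= C & forall v t g M x,
  measurable_fun setT g -> (forall y, `|g y| <= M) -> 0 < t ->
  `|heat_conv (hk1 v) t g x| <= C * `|v| * M * (Num.sqrt t)^-1.
Proof.
have [C C0 HC] := hk1_bounded; exists C => // v t g M x mg gM t0.
have M0 : 0 <= M by exact: le_trans (normr_ge0 _) (gM 0).
apply: heat_conv_le => //.
- by rewrite !mulr_ge0 ?invr_ge0 ?sqrtr_ge0.
- exact: (integrable_heat_conv mg gM x (gauss_kernel_hk1 v) t0).
- move=> y; rewrite normrM.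
  have := ler_pM (normr_ge0 _) (normr_ge0 _) (HC v t (x - y) t0) (gM y).
  by move=> /le_trans; apply; rewrite mulrAC [_ * M]mulrAC.
Qed.

End gradient_bound.

Section regularity.
Context {R : realType} {n : nat}.
Local Notation K := (@heat_kernel R n).
Local Notation rV := 'rV[R]_n.
Implicit Types (x y z v : rV) (s t T : R).
Variables (f : R -> R) (phi : rV -> R) (D : R) (G : R -> rV -> R) (M Lf : R).
Variable w : R -> rV -> R.
Hypotheses (mphi : measurable_fun setT phi) (phiD : forall y, `|phi y| <= D).
Hypotheses (mG : measurable_fun [set: R * rV] (fun p => G p.1 p.2))
  (GM : forall s y, `|G s y| <= M).
Hypothesis f_cont : continuous f.
Hypothesis wE : forall t x, 0 < t -> w t x = heat_conv K t phi x + duhamel K G t x.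
Hypothesis GE : forall t x, 0 < t -> G t x = f (w t x).
Hypothesis Lf0 : 0 <= Lf.
Hypothesis G_lip : forall s y z, 0 < s -> `|G s y - G s z| <= Lf * `|w s y - w s z|.

Let M0 : 0 <= M. Proof. exact: le_trans (normr_ge0 _) (GM 0 0). Qed.
Let D0 : 0 <= D. Proof. exact: le_trans (normr_ge0 _) (phiD 0). Qed.

(** For a derivative [k] of the heat kernel this is the candidate for the
corresponding derivative of the mild solution. *)
Definition evolve k t x := heat_conv k t phi x + duhamel k G t x.

Lemma is_derive_evolve_line m m' k k' v t x (h : R) :
  gauss_kernel m k -> gauss_kernel m' k' -> line_derivative k k' v ->
  (exists2 B, 0 <= B & weight_bound k G t B) ->
  (exists2 B, 0 <= B & weight_bound k' G t B) -> 0 < t ->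
  is_derive h 1 (fun h : R => evolve k t (x + h *: v)) (evolve k' t (x + h *: v)).
Proof.
move=> gk gk' kk' [B B0 kB] [B' B'0 kB'] t0.
have tt : 0 < t <= t by rewrite t0 lexx.
apply: is_deriveD.
  exact: (is_derive_heat_conv_line x h gk gk' kk' mphi phiD t0).
exact: (is_derive_duhamel_line mG GM x h gk gk' kk' kB kB' tt).
Qed.

Lemma continuous_evolve m k t x : gauss_kernel m k ->
  (exists2 B, 0 <= B & weight_bound k G (t + 1) B) -> 0 < t ->
  {for (t, x), continuous (fun p : R * rV => evolve k p.1 p.2)}.
Proof.
move=> gk [B B0 kB] t0; apply: continuousD.
  exact: (continuous_heat_conv gk mphi phiD t0).
have tt : 0 < t < t + 1 by rewrite t0 ltrDl ltr01.
exact: (continuous_duhamel mG GM gk B0 kB tt).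
Qed.

Let wb0 T : 0 < T -> exists2 B, 0 <= B & weight_bound K G T B.
Proof. exact: (gauss_kernel_weight_bound mG GM gauss_kernel_heat). Qed.

Let wb1 v T : 0 < T -> exists2 B, 0 <= B & weight_bound (hk1 v) G T B.
Proof. exact: (gauss_kernel_weight_bound mG GM (gauss_kernel_hk1 v)). Qed.

(** The mean value theorem along the segment from [y] to [z]: the gradient of the
free part is of order [1 / sqrt s], that of the Duhamel part of order
[sqrt s]. *)
Lemma evolve_lipschitz T : 0 < T -> exists2 L, 0 <= L &
  forall s y z, 0 < s <= T -> `|w s y - w s z| <= L * (Num.sqrt s)^-1 * `|z - y|.
Proof.
move=> T0; have [C C0 HC] := @heat_conv_hk1_le R n.
pose q := Num.sqrt T; have q0 : 0 < q by rewrite sqrtr_gt0.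
exists (C * D + C * M * q * 8 * q).
  by rewrite addr_ge0 ?mulr_ge0 ?(ltW q0).
move=> s y z /andP[s0 sT]; pose v := z - y.
have qs : 1 <= q * (Num.sqrt s)^-1.
  by rewrite ler_pdivlMr ?sqrtr_gt0// mul1r ler_wsqrtr.
have bnd x : `|evolve (hk1 v) s x| <= (C * D + C * M * q * 8 * q) * (Num.sqrt s)^-1 * `|v|.
  rewrite /evolve (le_trans (ler_normD _ _))// !mulrDl lerD//.
    by apply: le_trans (HC v s phi D x mphi phiD s0) _; rewrite -!mulrA ler_wpM2l//
      mulrCA ler_wpM2l// mulrC.
  have wb : weight_bound (hk1 v) G s (C * `|v| * M * q).
    move=> r t x' /andP[r0 rt] ts.
    have tr : 0 < t - r by rewrite subr_gt0.
    apply: le_trans (HC v (t - r) (G r) M x' (measurable_slice mG r) (GM r) tr) _.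
    rewrite /weight (_ : _ * q * _ =
      C * `|v| * M * (q * (Num.sqrt r)^-1 * (Num.sqrt (t - r))^-1)); last by ring.
    apply: ler_wpM2l; first by rewrite !mulr_ge0.
    rewrite ler_peMl ?invr_ge0 ?sqrtr_ge0//.
    rewrite ler_pdivlMr ?sqrtr_gt0// mul1r ler_wsqrtr//; lra.
  have ss : 0 < s <= s by rewrite s0 lexx.
  have wb_ge0 : 0 <= C * `|v| * M * q by rewrite !mulr_ge0// ltW.
  apply: le_trans (duhamel_le mG x (gauss_kernel_hk1 v) wb_ge0 wb ss) _.
  rewrite (_ : C * M * q * 8 * q * (Num.sqrt s)^-1 * `|v| =
    C * `|v| * M * q * 8 * (q * (Num.sqrt s)^-1)); last by ring.
  by rewrite ler_peMr// mulr_ge0.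
have d (h : R) : is_derive h 1 (fun h : R => w s (y + h *: v)) (evolve (hk1 v) s (y + h *: v)).
  under eq_fun do rewrite wE//.
  exact: (is_derive_evolve_line y h gauss_kernel_heat (gauss_kernel_hk1 v)
    (is_derive_heat_kernel_line v) (wb0 s0) (wb1 v s0) s0).
have [c _] := @MVT R (fun h => w s (y + h *: v)) (fun h => evolve (hk1 v) s (y + h *: v))
  0 1 ltr01 (fun h _ => d h) (derivable_within_continuous
    (fun h _ => @ex_derive _ _ _ _ _ _ _ (d h))).
have yv : y + v = z by rewrite /v addrC subrK.
rewrite scale1r scale0r addr0 subr0 mulr1 yv => E.
by rewrite distrC E; exact: bnd.
Qed.

Lemma G_lipschitz T : 0 < T -> exists2 L, 0 <= L &
  forall s y z, 0 < s <= T -> `|G s y - G s z| <= L * (Num.sqrt s)^-1 * `|z - y|.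
Proof.
move=> T0; have [L L0 HL] := evolve_lipschitz T0.
exists (Lf * L); first exact: mulr_ge0.
move=> s y z sT; apply: le_trans (G_lip _ _ _) _; first by case/andP: sT.
by rewrite -!mulrA ler_wpM2l// mulrA; exact: HL.
Qed.

Let wb2 v v' T : 0 < T -> exists2 B, 0 <= B & weight_bound (hk2 v v') G T B.
Proof.
move=> T0; have [L L0 HL] := G_lipschitz T0.
exact: (weight_bound_hk2 mG GM L0 HL).
Qed.

Let wbt T : 0 < T -> exists2 B, 0 <= B & weight_bound hkt G T B.
Proof.
move=> T0; have [L L0 HL] := G_lipschitz T0.
exact: (weight_bound_hkt mG GM L0 HL).
Qed.

Let T1 t : 0 < t -> 0 < t + 1. Proof. by move=> t0; rewrite addr_gt0. Qed.

Lemma is_derive_mild v t x : 0 < t -> is_derive x v (w t) (evolve (hk1 v) t x).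
Proof.
move=> t0; apply: is_derive_line.
rewrite [X in is_derive _ _ X _](_ : _ = (fun h : R => evolve K t (x + h *: v))); last first.
  by apply/funext => h; rewrite wE.
have := is_derive_evolve_line x 0 gauss_kernel_heat (gauss_kernel_hk1 v)
    (is_derive_heat_kernel_line v) (wb0 t0) (wb1 v t0) t0.
by rewrite scale0r addr0.
Qed.

Lemma is_derive_evolve_hk1 v v' t x : 0 < t ->
  is_derive x v' (evolve (hk1 v) t) (evolve (hk2 v v') t x).
Proof.
move=> t0; apply: is_derive_line.
have := is_derive_evolve_line x 0 (gauss_kernel_hk1 v) (gauss_kernel_hk2 v v')
    (is_derive_hk1_line v v') (wb1 v t0) (wb2 v v' t0) t0.
by rewrite scale0r addr0.
Qed.

Lemma partial_mild i t : 0 < t -> partial i (w t) = evolve (hk1 (delta_mx ord0 i)) t.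
Proof.
move=> t0; apply/funext => x; rewrite /partial.
exact: (@derive_val _ _ _ _ _ _ _ (is_derive_mild _ x t0)).
Qed.

Lemma partial2_mild i j t : 0 < t -> partial j (partial i (w t)) =
  evolve (hk2 (delta_mx ord0 i) (delta_mx ord0 j)) t.
Proof.
move=> t0; rewrite partial_mild//; apply/funext => x; rewrite /partial.
exact: (@derive_val _ _ _ _ _ _ _ (is_derive_evolve_hk1 _ _ x t0)).
Qed.

Let near_pos (F H : R * rV -> R) t x : 0 < t ->
  (forall p, 0 < p.1 -> F p = H p) -> {for (t, x), continuous F} ->
  {for (t, x), continuous H}.
Proof.
move=> t0 FH; apply: near_eq_continuous.
have tt : 0 < t < t + 1 by rewrite t0 ltrDl ltr01.
by apply: filterS (near_slab x tt ltr01) => p [/andP[p0 _] _]; exact: FH.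
Qed.

Lemma continuous_mild t x : 0 < t -> jointly_continuous_at w t x.
Proof.
move=> t0; apply: (near_pos (F := fun p => evolve K p.1 p.2) t0).
  by move=> p p0; rewrite wE.
exact: (continuous_evolve gauss_kernel_heat (wb0 (T1 t0)) t0).
Qed.

Let continuous_G t x : 0 < t -> {for (t, x), continuous (fun p : R * rV => G p.1 p.2)}.
Proof.
move=> t0; apply: (near_pos (F := fun p => f (w p.1 p.2)) t0).
  by move=> p p0; rewrite GE.
apply: (@continuous_comp _ _ _ (fun p : R * rV => w p.1 p.2) f).
  exact: continuous_mild.
exact: f_cont.
Qed.

Lemma is_derive_mild_time t x : 0 < t ->
  is_derive t 1 (w ^~ x) (evolve hkt t x + G t x).
Proof.
move=> t0; have [L L0 HL] := G_lipschitz (T1 t0).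
have tt : 0 < t < t + 1 by rewrite t0 ltrDl ltr01.
have c1 : {for t, continuous (G ^~ x)}.
  have c : {for t, continuous (fun r : R => (r, x))}.
    by apply: (@cvg_pair _ _ _ (nbhs t) (nbhs t) (nbhs x)); [exact: cvg_id|exact: cvg_cst].
  exact: (continuous_comp c (@continuous_G t x t0)).
have d1 := is_derive_heat_conv_time x gauss_kernel_heat gauss_kernel_hkt
  (fun t x => is_derive_heat_kernel_time (t := t) x) mphi phiD t0.
have d2 := is_derive_duhamel_time mG GM (T1 t0) L0 HL tt c1.
apply: (near_eq_is_derive (f := fun t => heat_conv K t phi x + duhamel K G t x)).
  have tI : t \in `]0, t + 1[ by rewrite in_itv /= t0 ltrDl ltr01.
  by apply: filterS (near_in_itvoo tI) => s; rewrite in_itv /= => /andP[s0 _]; rewrite wE.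
have -> : evolve hkt t x + G t x =
  heat_conv hkt t phi x + (G t x + duhamel hkt G t x) by rewrite /evolve; ring.
exact: is_deriveD.
Qed.

Lemma partial_t_mild t x : 0 < t -> partial_t w t x = evolve hkt t x + G t x.
Proof. by move=> t0; exact: (@derive_val _ _ _ _ _ _ _ (is_derive_mild_time x t0)). Qed.

(** Each derivative is an [evolve] of a derivative of the kernel, with [G] added in
the case of time; it is continuous by the weight bounds, which for second
derivatives rest on [G_lipschitz]. *)
Lemma mild_C21 (T : \bar R) : C21 T w.
Proof.
move=> t x t0 _; split.
- exact: continuous_mild.
- split; first exact: (@ex_derive _ _ _ _ _ _ _ (is_derive_mild_time x t0)).
  apply: (near_pos (F := fun p => evolve hkt p.1 p.2 + G p.1 p.2) t0).
    by move=> p p0; rewrite partial_t_mild.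
  apply: continuousD; last exact: continuous_G.
  exact: (continuous_evolve gauss_kernel_hkt (wbt (T1 t0)) t0).
- move=> i; split; first exact: (@ex_derive _ _ _ _ _ _ _ (is_derive_mild _ x t0)).
  apply: (near_pos (F := fun p => evolve (hk1 (delta_mx ord0 i)) p.1 p.2) t0).
    by move=> p p0; rewrite partial_mild.
  exact: (continuous_evolve (gauss_kernel_hk1 _) (wb1 _ (T1 t0)) t0).
- move=> i j; split.
    rewrite partial_mild//.
    exact: (@ex_derive _ _ _ _ _ _ _ (is_derive_evolve_hk1 _ _ x t0)).
  apply: (near_pos (F := fun p =>
    evolve (hk2 (delta_mx ord0 i) (delta_mx ord0 j)) p.1 p.2) t0).
    by move=> p p0; rewrite partial2_mild.
  exact: (continuous_evolve (gauss_kernel_hk2 _ _) (wb2 _ _ (T1 t0)) t0).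
Qed.

(** [evolve hkt] is the sum of the pure second derivatives, by [hkt_sum]. *)
Lemma mild_heat_equation t x : 0 < t ->
  partial_t w t x = laplacian (w t) x + f (w t x).
Proof.
move=> t0; rewrite partial_t_mild// GE//; congr (_ + _).
have tt : 0 < t <= t by rewrite t0 lexx.
have [L L0 HL] := G_lipschitz t0.
rewrite /evolve (heat_conv_hkt x mphi phiD t0) (duhamel_hkt mG GM L0 HL x tt).
by rewrite -big_split /=; apply: eq_bigr => i _; rewrite partial2_mild.
Qed.

End regularity.

(** * Lipschitz nonlinearities and the function ell *)

Section locally_lipschitz_theory.
Context {R : realType}.
Variable f : R -> R.
Hypothesis f_lip : locally_lipschitz f.

Lemma locally_lipschitzP x : exists2 r, 0 < r & exists2 L, 0 <= L &
  forall a b, `|a - x| < r -> `|b - x| < r -> `|f a - f b| <= L * `|a - b|.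
Proof.
have [r r0 fr] := f_lip x; exists r => //.
near (pinfty_nbhs R) => L.
exists L; first by near: L; exact: nbhs_pinfty_ge.
have HL : L.-lipschitz_(ball x r) f by near: L.
move=> a b ar br; apply: (HL (a, b)).
by split; rewrite /= -ball_normE /= distrC.
Unshelve. all: end_near. Qed.

Lemma locally_lipschitz_continuous : continuous f.
Proof.
move=> x; have [r r0 [L L0 HL]] := locally_lipschitzP x.
apply/cvgrPdist_lt => e e0.
have L1 : 0 < L + 1 by rewrite ltr_wpDl.
near=> y.
have yx : `|x - y| < e / (L + 1) by near: y; apply: cvgr_dist_lt; rewrite ?divr_gt0.
have yr : `|y - x| < r by rewrite distrC; near: y; exact: cvgr_dist_lt.
apply: (@le_lt_trans _ _ (L * `|x - y|)); first by apply: HL; rewrite ?subrr ?normr0.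
apply: (@le_lt_trans _ _ ((L + 1) * `|x - y|)); first by rewrite ler_wpM2r// lerDl.
by rewrite -ltr_pdivlMl// mulrC.
Unshelve. all: end_near. Qed.

(** Connectedness: the supremum of the [c] up to which one Lipschitz constant works
is [M], for a local constant at the supremum could otherwise be added. *)
Lemma lipschitz_on_segment (M : R) : exists2 L, 0 <= L &
  forall a b, `|a| <= M -> `|b| <= M -> `|f a - f b| <= L * `|a - b|.
Proof.
have [M0|M0] := ltP M 0.
  by exists 0 => // a b aM; have := le_lt_trans (le_trans (normr_ge0 a) aM) M0; rewrite ltxx.
pose S := [set c : R | - M <= c <= M /\ exists2 L, 0 <= L &
  forall a b, - M <= a -> a <= b -> b <= c -> `|f a - f b| <= L * `|a - b|].
have SM : S (- M).
  split; first by lra.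
  exists 0 => // a b a1 ab b1; have -> : a = b by lra.
  by rewrite !subrr normr0 mul0r.
have hS : has_sup S.
  by split; [exists (- M)|exists M => c [/andP[]]].
have [r r0 [L1 L10 HL1]] := locally_lipschitzP (sup S).
have r2 : 0 < r / 2 by rewrite divr_gt0.
have [c [/andP[c1 c2] [L0 L00 HL0]] cS] := sup_adherent r2 hS.
have cS' : c <= sup S.
  by apply: sup_ubound hS.2 _ _; split; [rewrite c1|exists L0].
pose d := Num.min M (sup S + r / 2).
have [d1 d2] : d <= M /\ d <= sup S + r / 2 by rewrite /d !ge_min !lexx orbT.
have cd : c <= d by rewrite le_min c2 (le_trans cS')// lerDl ltW.
have dL : forall a b, - M <= a -> a <= b -> b <= d ->
    `|f a - f b| <= (L0 + L1) * `|a - b|.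
  move=> a b aM ab bd.
  have [bc|cb] := leP b c.
    by apply: le_trans (HL0 a b aM ab bc) _; rewrite ler_wpM2r// lerDl.
  have near_sup z : c <= z -> z <= d -> `|z - sup S| < r.
    by move=> z1 z2; rewrite ltr_norml; apply/andP; split; lra.
  have [ac|ca] := leP a c; last first.
    apply: le_trans (HL1 a b _ _) _; [by apply: near_sup; lra|by apply: near_sup; lra|].
    by rewrite ler_wpM2r// lerDr.
  rewrite (_ : f a - f b = (f a - f c) + (f c - f b)); last by ring.
  apply: le_trans (ler_normD _ _) _.
  have h1 := HL0 a c aM ac (lexx _).
  have h2 := HL1 c b (near_sup c (lexx _) cd) (near_sup b (ltW cb) bd).
  apply: le_trans (lerD h1 h2) _.
  have dist (p q : R) : p <= q -> `|p - q| = q - p by move=> pq; rewrite distrC ger0_norm ?subr_ge0.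
  rewrite (dist _ _ ac) (dist _ _ (ltW cb)) (dist _ _ ab) mulrDl.
  by apply: lerD; apply: ler_wpM2l => //; rewrite lerB// ltW.
have Sd : S d.
  split; first by rewrite d1 andbT (le_trans c1).
  by exists (L0 + L1); [exact: addr_ge0|exact: dL].
have dS : d <= sup S by exact: sup_ubound hS.2 _ Sd.
have dM : d = M.
  rewrite /d; apply/min_idPl; rewrite leNgt; apply/negP => dM.
  by move: dS; rewrite /d (min_idPr (ltW dM)) gerDl leNgt r2.
exists (L0 + L1); first exact: addr_ge0.
move=> a b aM bM.
have /andP[a1 a2] : - M <= a <= M by rewrite -ler_norml.
have /andP[b1 b2] : - M <= b <= M by rewrite -ler_norml.
have [ab|ba] := leP a b; first by apply: dL => //; rewrite dM.
by rewrite (distrC (f a)) (distrC a b); apply: dL => //; rewrite ?dM// ltW.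
Qed.

End locally_lipschitz_theory.

Section ell_theory.
Context {R : realType}.
Variable f : R -> R.
Hypotheses (f_lip : locally_lipschitz f) (f_mono : {homo f : x y / x <= y}) (f0 : f 0 = 0).
Implicit Types s t z : R.

Let quotients s := [set f t / t | t in [set t : R | 0 < `|t| <= s]].

Let quotients_sup s : 0 < s -> has_sup (quotients s).
Proof.
move=> s0; split; first by exists (f s / s), s => //=; rewrite gtr0_norm ?s0 ?lexx.
have [L L0 HL] := lipschitz_on_segment f_lip s.
exists L => _ [t /= /andP[t0 ts] <-].
apply: le_trans (ler_norm _) _; rewrite normrM normfV ler_pdivrMr//.
by have := HL t 0 ts; rewrite normr0 f0 !subr0; apply; exact: ltW.
Qed.

Lemma quotient_le_ell s z : 0 < `|z| <= s -> f z / z <= ell f s.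
Proof.
move=> zs; have s0 : 0 < s by case/andP: zs => ? ?; exact: (@lt_le_trans _ _ `|z|).
rewrite /ell s0; apply: sup_ubound; first exact: (quotients_sup s0).2.
by exists z.
Qed.

Lemma ell_ge0 s : 0 <= ell f s.
Proof.
have [s0|s0] := ltP 0 s; last by rewrite /ell ltNge s0.
have ss : 0 < `|s| <= s by rewrite gtr0_norm// s0 lexx.
apply: le_trans (quotient_le_ell ss).
by apply: divr_ge0 (ltW s0); rewrite -f0; apply: f_mono; exact: ltW.
Qed.

(** The supremum is over a larger set. *)
Lemma ell_mono : {homo ell f : s t / s <= t}.
Proof.
move=> s t st; have [s0|s0] := ltP 0 s; last by rewrite {1}/ell ltNge s0 /= ell_ge0.
have t0 : 0 < t := lt_le_trans s0 st.
rewrite {1}/ell s0; apply: ge_sup; first exact: (quotients_sup s0).1.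
move=> _ [z /= /andP[z0 zs] <-]; apply: quotient_le_ell.
by rewrite z0 (le_trans zs).
Qed.

Lemma f_le_ell s z : 0 <= z <= s -> f z <= ell f s * z.
Proof.
move=> /andP[]; rewrite le_eqVlt => /orP[/eqP <- _|z0 zs].
  by rewrite f0 mulr0.
by rewrite -ler_pdivrMr//; apply: quotient_le_ell; rewrite gtr0_norm ?z0.
Qed.

Lemma ell_le_f s z : - s <= z <= 0 -> ell f s * z <= f z.
Proof.
move=> /andP[sz]; rewrite le_eqVlt => /orP[/eqP ->|z0].
  by rewrite f0 mulr0.
by rewrite -ler_ndivrMr//; apply: quotient_le_ell; rewrite ltr0_norm ?oppr_gt0 ?z0//=; lra.
Qed.

End ell_theory.

(** * The time integral of ell along a decaying power *)

Section dyadic_change_of_variable.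
Context {R : realType}.
Local Notation leb := (@lebesgue_measure R).
Variables (p : R) (h : R -> R).
Hypotheses (p0 : 0 < p) (h_mono : {homo h : s t / s <= t}) (h_ge0 : forall s, 0 <= h s).
Hypothesis h_int :
  (\int[leb]_(s in `]0%R, 1%R[) (s `^ (- (1 + p)) * h s)%:E < +oo)%E.
Implicit Types s t : R.

Let c : R := 2 `^ p.
Let a (k : nat) : R := 2^-1 ^+ k.
Let phi s := s `^ (- (1 + p)) * h s.
(** [h] along the decay [b min(1, s^(-1/p))]; for [p = 2/n] the exponent is the decay
rate [n/2] of the heat semigroup from [L^1] to [L^oo]. *)
Definition stretched b s := h (b * Num.min 1 (s `^ (- p^-1))).

Let c1 : 1 < c.
Proof.
have lt12 : 1 < 2 :> R by rewrite ltr1n.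
by rewrite /c /powR pnatr_eq0 /= expR_gt1 mulr_gt0// ln_gt0.
Qed.

Let c_ge1 k : 1 <= c ^+ k.
Proof. by rewrite exprn_ege1// ltW. Qed.

Let c_gt0 k : 0 < c ^+ k.
Proof. exact: lt_le_trans ltr01 (c_ge1 k). Qed.

Let a_gt0 k : 0 < a k.
Proof. by rewrite exprn_gt0// invr_gt0. Qed.

Let aS k : a k.+1 = a k / 2.
Proof. by rewrite /a exprSr. Qed.

Let a_le k j : (j <= k)%N -> a k <= a j.
Proof. by move=> jk; apply: ler_wiXn2l jk; rewrite ?invr_ge0 ?invf_le1// ler1n. Qed.

Let powR_a k : a k `^ p = (c ^+ k)^-1.
Proof.
elim: k => [|k IHk]; first by rewrite /a !expr0 powR1 invr1.
rewrite aS powRM ?invr_ge0// ?(ltW (a_gt0 k))// IHk.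
rewrite -[2^-1]powR_inv1// -powRrM mulN1r powRN exprS invfM mulrC.
by congr (_ * _).
Qed.

Let measurable_h : measurable_fun [set: R] h.
Proof. exact: nondecreasing_measurable. Qed.

Let phi_ge0 s : 0 <= phi s.
Proof. by rewrite mulr_ge0 ?powR_ge0. Qed.

Let measurable_phi : measurable_fun [set: R] phi.
Proof. by apply: measurable_funM => //; exact: measurable_powR. Qed.

Let integrable_phi : leb.-integrable `]0, 1[ (EFin \o phi).
Proof.
apply/integrableP; split.
  by apply/measurable_EFinP; exact: measurable_funTS.
under eq_integral do rewrite /= ger0_norm//.
exact: h_int.
Qed.

Let integrable_phi_itvoc s : s < 1 -> leb.-integrable `]0, s] (EFin \o phi).
Proof.
move=> s1; apply: integrableS integrable_phi => // x /=; rewrite !in_itv /=.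
by move=> /andP[-> xs]; exact: le_lt_trans s1.
Qed.

Let measurable_stretched b : measurable_fun [set: R] (stretched b).
Proof.
apply: (measurableT_comp measurable_h); apply: measurable_funM => //.
by apply: measurable_minr => //; exact: measurable_powR.
Qed.

Let integrable_cst (x y k : R) : leb.-integrable `]x, y] (EFin \o cst k).
Proof.
apply: measurable_bounded_integrable => //.
- rewrite /= lebesgue_measure_itv /=; case: ifP => _; exact: ltry.
- by exists `|k|; split; [exact: num_real|move=> M kM s _; exact: ltW].
Qed.

Let stretched_le b s : 0 <= b -> stretched b s <= h b.
Proof.
by move=> b0; apply: h_mono; rewrite -[leRHS]mulr1 ler_wpM2l// ge_min lexx.
Qed.

Let stretched_itv b x y : 0 <= b -> leb.-integrable `]x, y] (EFin \o stretched b).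
Proof.
move=> b0; apply: (@dominated_integrableR R _ (measurableTypeR R) leb _ (measurable_itv _)
  _ _ _ (integrable_cst x y (h b))).
  by apply: measurable_funTS; exact: measurable_stretched.
by move=> s _; rewrite ger0_norm ?stretched_le//; exact: h_ge0.
Qed.

Let Rintegral_cst_itv x y k : x <= y -> \int[leb]_(s in `]x, y]) k = k * (y - x).
Proof.
move=> xy; rewrite Rintegral_cst//= lebesgue_measure_itv /= lte_fin.
move: xy; rewrite le_eqVlt => /orP[/eqP ->|->]; last by [].
by rewrite ltxx subrr.
Qed.

(** Between [a (k+1)] and [a k], at distance [a k / 2], the integrand is at least
[a k ^ (- (1 + p)) h(a (k+1))]. *)
Let dyadic_piece k : (0 < k)%N ->
  c ^+ k * h (a k.+1) / 2 <=
  \int[leb]_(s in `]0, a k]) phi s - \int[leb]_(s in `]0, a k.+1]) phi s.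
Proof.
move=> k0; have ak1 : a k < 1.
  by rewrite exprn_ilt1 ?invr_ge0 ?invf_lt1 ?ltr1n// -lt0n.
have aS' := a_le (leqnSn k).
rewrite Rintegral_itvB ?bnd_simp ?(ltW (a_gt0 _))//; last exact: integrable_phi_itvoc.
have -> : c ^+ k * h (a k.+1) / 2 = \int[leb]_(s in `]a k.+1, a k]) (h (a k.+1) * (c ^+ k / a k)).
  rewrite Rintegral_cst_itv// aS; field; exact: lt0r_neq0.
apply: le_Rintegral => //; first exact: integrable_cst.
  apply: integrableS (integrable_phi_itvoc ak1) => // s /=; rewrite !in_itv /=.
  by case/andP => /(lt_trans (a_gt0 _)) -> ->.
move=> s /=; rewrite in_itv /= => /andP[s1 s2]; rewrite /phi mulrC.
have s0 : 0 < s := lt_trans (a_gt0 _) s1.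
rewrite ler_pM ?divr_ge0 ?(ltW (c_gt0 _)) ?(ltW (a_gt0 _)) ?h_mono ?(ltW s1)//.
rewrite powRN powRD; last by rewrite (gt_eqF s0) implybT.
rewrite powRr1 ?(ltW s0)// -[c ^+ k]invrK -powR_a -invfM lef_pV2 ?posrE ?mulr_gt0 ?powR_gt0//.
rewrite mulrC ler_pM ?(ltW s0) ?powR_ge0//.
by apply: ge0_ler_powR; rewrite ?nnegrE ?(ltW s0) ?(ltW p0) ?(ltW (a_gt0 k)).
Qed.

Let G k := \int[leb]_(s in `]0, a k]) phi s.

(** The times between [c^N] and [c^(N+1)] are those where [s^(-1/p)] lies between [a (N+1)]
and [a N]; their part of the integral is at most [c^(N+1) h(a (j+N+1))], which is
[2 c / c^j] times the lower bound of [dyadic_piece] at [k = j + N]. *)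
Let stretched_integral_dyadic j N : (0 < j)%N ->
  \int[leb]_(s in `]0, c ^+ N]) stretched (a j.+1) s <=
  h (a j.+1) + 2 * c / c ^+ j * (G j - G (j + N)).
Proof.
move=> j0; elim: N => [|N IHN].
  rewrite addn0 subrr mulr0 addr0 expr0.
  have -> : h (a j.+1) = \int[leb]_(s in `]0, 1]) h (a j.+1).
    by rewrite Rintegral_cst_itv// subr0 mulr1.
  apply: le_Rintegral => //; [exact: stretched_itv (ltW (a_gt0 _))|exact: integrable_cst|].
  by move=> s _; exact: stretched_le (ltW (a_gt0 _)).
have cN : c ^+ N <= c ^+ N.+1 by rewrite ler_eXn2l.
rewrite -[leLHS](subrK (\int[leb]_(s in `]0, c ^+ N]) stretched (a j.+1) s)).
rewrite Rintegral_itvB ?bnd_simp ?(ltW (c_gt0 _))//; last exact: stretched_itv (ltW (a_gt0 _)).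
have key : \int[leb]_(s in `]c ^+ N, c ^+ N.+1]) stretched (a j.+1) s <=
    2 * c / c ^+ j * (G (j + N)%N - G (j + N.+1)%N).
  have -> : (j + N.+1 = (j + N).+1)%N by rewrite addnS.
  apply: (@le_trans _ _ (h (a (j + N).+1) * (c ^+ N.+1 - c ^+ N))).
    rewrite -Rintegral_cst_itv//.
    apply: le_Rintegral => //; [exact: stretched_itv (ltW (a_gt0 _))|exact: integrable_cst|].
    move=> s /=; rewrite in_itv /= => /andP[s1 _]; apply: h_mono.
    rewrite -addSn /a exprD ler_pM2l// ge_min; apply/orP; right.
    have s0 : 0 < s := lt_trans (c_gt0 _) s1.
    have -> : 2^-1 ^+ N = (c ^+ N) `^ (- p^-1).
      have -> : c ^+ N = a N `^ (- p) by rewrite powRN powR_a invrK.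
      by rewrite -powRrM mulrNN mulfV ?gt_eqF// powRr1// ltW// a_gt0.
    rewrite !powRN lef_pV2 ?posrE ?powR_gt0//.
    by apply: ge0_ler_powR; rewrite ?nnegrE ?invr_ge0 ?(ltW s0) ?(ltW p0) ?(ltW (c_gt0 _)) ?(ltW s1).
  apply: (@le_trans _ _ (2 * c / c ^+ j * (c ^+ (j + N) * h (a (j + N).+1) / 2))).
    have -> : 2 * c / c ^+ j * (c ^+ (j + N) * h (a (j + N).+1) / 2) = h (a (j + N).+1) * c ^+ N.+1.
      rewrite exprD exprS; field; exact: lt0r_neq0.
    by rewrite ler_wpM2l// gerBl ltW.
  rewrite ler_wpM2l ?divr_ge0 ?mulr_ge0 ?(ltW c1) ?(ltW (c_gt0 _)) ?(le_trans ler01 (ltW c1))//.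
  by apply: dyadic_piece; rewrite addn_gt0 j0.
apply: le_trans (lerD key IHN) _.
rewrite addrCA -mulrDr le_eqVlt; apply/orP; left; apply/eqP.
by congr (_ + _ * _); ring.
Qed.

Let c_unbounded (M : R) : exists2 k, (0 < k)%N & M <= c ^+ k.
Proof.
have c0 : 0 < c := lt_trans ltr01 c1.
have cV : `|c^-1| < 1 by rewrite ger0_norm ?invr_ge0 ?(ltW c0)// invf_lt1.
have M0 : 0 < (`|M| + 1)^-1 by rewrite invr_gt0 ltr_wpDl.
near \oo => k.
have ck : `|c^-1 ^+ k| < (`|M| + 1)^-1.
  near: k; have /cvgrPdist_lt/(_ _ M0) := cvg_expr cV.
  by apply: filterS => k; rewrite sub0r normrN.
exists k; first by near: k; exact: nbhs_infty_gt.
have M1 : `|M| <= `|M| + 1 by rewrite lerDl.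
apply: le_trans (ler_norm M) (le_trans M1 (ltW _)).
move: ck; rewrite ger0_norm ?exprn_ge0 ?invr_ge0 ?(ltW c0)// exprVn.
by rewrite ltf_pV2 ?posrE ?exprn_gt0 ?ltr_wpDl.
Unshelve. all: end_near. Qed.

(** In [stretched_integral_dyadic] the total is at most [4 c / c^j] times the given
integral, whatever the time; hence [b] is a small power of [1/2]. *)
Lemma stretched_integral_small (kappa : R) : 0 < kappa -> exists2 b, 0 < b &
  forall t, 0 < t -> leb.-integrable `]0, t[ (EFin \o stretched b) /\
    \int[leb]_(s in `]0, t[) stretched b s <= kappa.
Proof.
move=> k0.
have G_ge0 k : 0 <= G k by apply: Rintegral_ge0 => s _; exact: phi_ge0.
have G_le k : (0 < k)%N -> G k <= G 1.
  move=> k1; rewrite -subr_ge0 Rintegral_itvB ?bnd_simp ?(ltW (a_gt0 _))//.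
  - by apply: Rintegral_ge0 => s _; exact: phi_ge0.
  - by apply: integrable_phi_itvoc; rewrite /a expr1 invf_lt1// ltr1n.
  - exact: a_le.
have [j j0 cj] := c_unbounded (4 * c * (G 1 + 1) / kappa).
exists (a j.+1) => // t t0.
have it : leb.-integrable `]0, t] (EFin \o stretched (a j.+1)).
  exact: stretched_itv (ltW (a_gt0 _)).
split; first by apply: integrableS it => // s /=; rewrite !in_itv /= => /andP[-> /ltW].
rewrite Rintegral_itv_bndo_bndc; last first.
  by apply: integrableS it => // s /=; rewrite !in_itv /= => /andP[-> /ltW].
have [N _ tN] := c_unbounded t.
apply: (@le_trans _ _ (\int[leb]_(s in `]0, c ^+ N]) stretched (a j.+1) s)).
  rewrite -subr_ge0 Rintegral_itvB ?bnd_simp ?(ltW t0)//.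
    by apply: Rintegral_ge0 => s _; exact: h_ge0.
  exact: stretched_itv (ltW (a_gt0 _)).
apply: le_trans (stretched_integral_dyadic N j0) _.
have h1 := dyadic_piece j0.
have h2 : h (a j.+1) <= 2 * c / c ^+ j * G 1.
  apply: (@le_trans _ _ (2 / c ^+ j * G 1)); last first.
    by rewrite -!mulrA ler_wpM2l// mulrA ler_wpM2r// ler_peMl ?invr_ge0 ?(ltW (c_gt0 _)) ?(ltW c1).
  have h1' : c ^+ j * h (a j.+1) / 2 <= G 1.
    by apply: le_trans h1 _; have := G_ge0 j.+1; have := G_le j j0; rewrite /G; lra.
  by rewrite mulrAC ler_pdivlMr//; lra.
have h3 : 2 * c / c ^+ j * (G j - G (j + N)%N) <= 2 * c / c ^+ j * G 1.
  rewrite ler_wpM2l ?divr_ge0 ?mulr_ge0 ?(le_trans ler01 (ltW c1)) ?(ltW (c_gt0 _))//.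
  by have := G_ge0 (j + N)%N; have := G_le j j0; lra.
apply: le_trans (lerD h2 h3) _.
have G1 := G_ge0 1%N.
rewrite (_ : _ + _ = 4 * c * G 1 / c ^+ j); last by rewrite -mulrDl; ring.
move: cj; rewrite ler_pdivrMr// [_ * kappa]mulrC => cj; rewrite ler_pdivrMr//.
apply: le_trans cj; rewrite ler_wpM2l ?lerDl//.
by rewrite mulr_ge0// (le_trans ler01 (ltW c1)).
Qed.

End dyadic_change_of_variable.

(** * Maxima of functions of one variable *)

Section one_variable_maximum.
Context {R : realType}.
Implicit Types (g : R -> R) (t l e r h : R).

Lemma is_derive_quotient g t l e : is_derive t 1 g l -> 0 < e ->
  exists2 d, 0 < d &
  forall k, 0 < `|k| < d -> `|k^-1 * (g (t + k) - g t) - l| < e.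
Proof.
move=> dg e0.
have : (fun k : R => k^-1 *: (g (k *: 1 + t) - g t)) @ 0^' --> l.
  by rewrite -(@derive_val _ _ _ _ _ _ _ dg); exact: (@ex_derive _ _ _ _ _ _ _ dg).
move=> /cvgrPdist_lt/(_ e e0) /nbhs_ballP[d /= d0 Hd].
exists d => // k /andP[k0 kd].
have := Hd k; rewrite /ball /= sub0r normrN distrC => /(_ kd).
rewrite -normr_gt0 => /(_ k0).
by rewrite [k *: 1]mulr1 [k + t]addrC.
Qed.

(** Difference quotients from the left are nonnegative. *)
Lemma derive_left_maximum g t r l : 0 < r -> is_derive t 1 g l ->
  (forall s, t - r <= s <= t -> g s <= g t) -> 0 <= l.
Proof.
move=> r0 dg gmax; rewrite leNgt; apply/negP => l0.
have l0' : 0 < - l by rewrite oppr_gt0.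
have [d d0 Hd] := is_derive_quotient dg l0'.
pose k := Num.min d r / 2.
have [k0 kd kr] : [/\ 0 < k, k < d & k < r].
  by rewrite /k; have [dr|rd] := leP d r; split; lra.
have := Hd (- k); rewrite normrN gtr0_norm// k0 kd => /(_ isT).
rewrite ltr_norml => /andP[_]; rewrite ltrBlDr addNr invrN mulNr oppr_lt0.
rewrite pmulr_rgt0 ?invr_gt0// subr_gt0 ltNge gmax//.
by apply/andP; split; lra.
Qed.

(** Otherwise [g'] would be positive just to the right of 0, where it vanishes, and
[g] would exceed its maximum by the mean value theorem. *)
Lemma second_derivative_maximum (g g' : R -> R) r l : 0 < r ->
  (forall h, `|h| < r -> is_derive h (1 : R) g (g' h)) -> is_derive (0 : R) (1 : R) g' l ->
  (forall h, `|h| < r -> g h <= g 0) -> l <= 0.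
Proof.
move=> r0 dg dg' gmax.
have r00 : `|0 : R| < r by rewrite normr0.
have g'0 : g' 0 = 0.
  have mem h : h \in `]- r, r[ -> `|h| < r by rewrite in_itv /= -ltr_norml.
  have d0 : is_derive (0 : R) (1 : R) g 0.
    apply: (@derive1_at_max R g (- r) r 0).
    - by rewrite ge0_cp// ltW.
    - by move=> h /mem hr; exact: (@ex_derive _ _ _ _ _ _ _ (dg h hr)).
    - by rewrite in_itv /= -ltr_norml.
    - by move=> h /mem; exact: gmax.
  by rewrite -(@derive_val _ _ _ _ _ _ _ (dg 0 r00)) (@derive_val _ _ _ _ _ _ _ d0).
rewrite leNgt; apply/negP => l0.
have [d d0 Hd] := is_derive_quotient dg' l0.
pose k := Num.min d r / 2.
have [k0 kd kr] : [/\ 0 < k, k < d & k < r].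
  by rewrite /k; have [dr|rd] := leP d r; split; lra.
have [c ck E] : exists2 c, c \in `]0, k[ & g k - g 0 = g' c * (k - 0).
  apply: (@MVT _ g g') => // [x|].
    rewrite in_itv /= => /andP[x0 xk]; apply: dg; rewrite gtr0_norm//.
    exact: lt_trans kr.
  apply: derivable_within_continuous => x; rewrite in_itv /= => /andP[x0 xk].
  apply: (@ex_derive _ _ _ _ _ _ _ (dg x _)); rewrite ger0_norm//.
  exact: le_lt_trans kr.
move: ck; rewrite in_itv /= => /andP[c0 ck].
have g'c : 0 < g' c.
  have := Hd c; rewrite gtr0_norm// c0 (lt_trans ck kd) => /(_ isT).
  rewrite add0r g'0 subr0 ltr_norml => /andP[+ _].
  by rewrite ltrBrDl subrr pmulr_rgt0 ?invr_gt0.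
have := gmax k; rewrite gtr0_norm// => /(_ kr).
by rewrite -subr_le0 E subr0 leNgt mulr_gt0.
Qed.

End one_variable_maximum.

(** The converse of [is_derive_line], at every point of the line. *)
Lemma is_derive_along_line (R : realType) (V W : normedModType R) (F : V -> W) x v (h : R) :
  derivable F (x + h *: v) v ->
  is_derive h (1 : R) (fun h : R => F (x + h *: v)) ('D_v F (x + h *: v)).
Proof.
move=> dF.
pose g1 (k : R) := k^-1 *: (F (x + (k *: 1 + h) *: v) - F (x + h *: v)).
pose g2 (k : R) := k^-1 *: (F (k *: v + (x + h *: v)) - F (x + h *: v)).
have g12 : g1 = g2.
  by apply/funext => k; rewrite /g1 /g2 [k *: 1]mulr1 scalerDl addrCA.
apply: DeriveDef.
  by rewrite /derivable -/g1 g12.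
by rewrite /derive -/g1 g12.
Qed.

(** * The comparison principle *)

Section penalty_derivatives.
Context {R : realType}.
Implicit Types (a b : R -> R) (t h k : R).

Lemma is_derive_penalty_space a b h (a' b' k eta p q r : R) :
  is_derive h (1 : R) a a' -> is_derive h (1 : R) b b' ->
  is_derive h (1 : R)
    (fun h : R => k * (a h - b h) - eta * (p + h * q + h ^+ 2 * r))
    (k * (a' - b') - eta * (q + h * (2 * r))).
Proof.
move=> da db.
have dq : is_derive h (1 : R) (fun h : R => p + h * q + h ^+ 2 * r) (q + h * (2 * r)).
  by apply: is_derive_eq; rewrite /GRing.scale /=; ring.
have dab := is_deriveB da db.
exact: is_deriveB (is_deriveZ k dab) (is_deriveZ eta dq).
Qed.

Lemma is_derive_penalty_time a b t (t0 a' b' eta p q lambda : R) :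
  is_derive t (1 : R) a a' -> is_derive t (1 : R) b b' ->
  is_derive t (1 : R) (fun t : R =>
     expR (- (lambda * (t - t0))) * (a t - b t) - eta * (p + q * (t - t0)))
    (expR (- (lambda * (t - t0))) * (a' - b' - lambda * (a t - b t)) - eta * q).
Proof.
move=> da db.
have dl : is_derive t (1 : R) (fun t : R => - (lambda * (t - t0))) (- lambda).
  by apply: is_derive_eq; rewrite /GRing.scale /=; ring.
have dE := is_derive_comp_real dl (is_derive_expR _).
have dab := is_deriveB da db.
have dq : is_derive t (1 : R) (fun t : R => p + q * (t - t0)) q.
  by apply: is_derive_eq; rewrite /GRing.scale /=; ring.
apply: is_derive_eq (is_deriveB (is_deriveM dE dab) (is_deriveZ eta dq)) _.
by rewrite /GRing.scale /= [(a - b) t](_ : _ = a t - b t)//; ring.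
Qed.

End penalty_derivatives.

Section comparison.
Context {R : realType} {n : nat}.
Variables (f : R -> R) (T : \bar R) (u v : R -> 'rV[R]_n -> R).
Hypotheses (uC : C21 T u) (vC : C21 T v).
Hypothesis u_eq : forall t x, 0 < t -> (t%:E < T)%E ->
  partial_t u t x = laplacian (u t) x + f (u t x).
Hypothesis v_eq : forall t x, 0 < t -> (t%:E < T)%E ->
  partial_t v t x = laplacian (v t) x + f (v t x).
Variables (t0 t1 M L eps : R).
Hypotheses (t00 : 0 < t0) (t1T : (t1%:E < T)%E) (L0 : 0 <= L) (eps0 : 0 <= eps).
Hypothesis f_lip : forall a b, `|a| <= M -> `|b| <= M -> `|f a - f b| <= L * `|a - b|.
Hypothesis uM : forall t x, t0 <= t <= t1 -> `|u t x| <= M.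
Hypothesis vM : forall t x, t0 <= t <= t1 -> `|v t x| <= M.
Hypothesis uv0 : forall x, u t0 x - v t0 x <= eps.
Implicit Types (t : R) (x : 'rV[R]_n).

Let lambda := L + 1.
Let K t := expR (- (lambda * (t - t0))).
Let penalized (eta t : R) x : R :=
  K t * (u t x - v t x) - eta * (sqr_euclidean x + 2 * n%:R * (t - t0)).

Let in_time t : t0 <= t <= t1 -> 0 < t /\ (t%:E < T)%E.
Proof.
move=> /andP[t0t tt1]; split; first exact: lt_le_trans t0t.
by apply: le_lt_trans t1T; rewrite lee_fin.
Qed.

Let K_gt0 t : 0 < K t.
Proof. exact: expR_gt0. Qed.

Let K_le1 t : t0 <= t -> K t <= 1.
Proof. by move=> t0t; rewrite -expR0 ler_expR oppr_le0 mulr_ge0 ?subr_ge0// addr_ge0. Qed.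

Let diff_le t x : t0 <= t <= t1 -> u t x - v t x <= 2 * M.
Proof.
move=> tt; have := uM x tt; have := vM x tt.
rewrite !ler_norml => /andP[? _] /andP[_ ?]; lra.
Qed.

Let continuous_penalized eta t x : t0 <= t <= t1 ->
  {for (t, x), continuous (fun p : R * 'rV[R]_n => penalized eta p.1 p.2)}.
Proof.
move=> /in_time[t_gt0 tT].
have [cu _ _ _] := uC x t_gt0 tT; have [cv _ _ _] := vC x t_gt0 tT.
have cfst : {for (t, x), continuous (fun p : R * 'rV[R]_n => p.1 - t0)}.
  by apply: continuousB; [exact: cvg_fst|exact: cst_continuous].
have csnd : {for (t, x), continuous (fun p : R * 'rV[R]_n => sqr_euclidean p.2)}.
  by apply: continuous_comp; [exact: cvg_snd|exact: continuous_sqr_euclidean].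
apply: continuousB.
  apply: continuousM; last exact: continuousB cu cv.
  apply: (@continuous_comp _ _ _ (fun p : R * 'rV[R]_n => - (lambda * (p.1 - t0))) (@expR R)).
    by apply: continuousN; apply: continuousM => //; exact: cst_continuous.
  exact: continuous_expR.
apply: continuousM; first exact: cst_continuous.
apply: continuousD => //; apply: continuousM => //; exact: cst_continuous.
Qed.

(** At a maximum in time up to [t] and in space near [x], the time derivative of the
penalized difference is nonnegative and its Laplacian nonpositive. The
penalties cancel as [2 n] is the Laplacian of [|x|^2], and the equations leave
[(L + 1) (u - v) <= f(u) - f(v)], impossible if [u - v] is positive. *)
Let penalized_max_le eta r t x : t0 < t <= t1 -> 0 < r ->
  (forall s, t0 <= s <= t -> penalized eta s x <= penalized eta t x) ->
  (forall y, `|y - x| < r -> penalized eta t y <= penalized eta t x) ->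
  u t x - v t x <= 0.
Proof.
move=> /andP[t0t tt1] r0 tmax xmax.
have [t_gt0 tT] := in_time (introT andP (conj (ltW t0t) tt1)).
have [_ [du _] du1 du2] := uC x t_gt0 tT; have [_ [dv _] dv1 dv2] := vC x t_gt0 tT.
have time_ge0 : 0 <= K t * (partial_t u t x - partial_t v t x - lambda * (u t x - v t x)) -
    eta * (2 * n%:R).
  have du' : is_derive t (1 : R) (u ^~ x) (partial_t u t x) := derivableP du.
  have dv' : is_derive t (1 : R) (v ^~ x) (partial_t v t x) := derivableP dv.
  have t0t' : 0 < t - t0 by rewrite subr_gt0.
  have dW := is_derive_penalty_time t0 eta (sqr_euclidean x) (2 * n%:R) lambda du' dv'.
  apply: (derive_left_maximum t0t' dW) => s; rewrite opprB addrCA subrr addr0.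
  exact: tmax.
have space_le0 i : K t * (partial i (partial i (u t)) x - partial i (partial i (v t)) x) -
    eta * 2 <= 0.
  pose e : 'rV[R]_n := delta_mx ord0 i.
  pose p := sqr_euclidean x + 2 * n%:R * (t - t0).
  have line_derive (w : R -> 'rV[R]_n -> R) : C21 T w -> forall h : R,
      is_derive h (1 : R) (fun h : R => w t (x + h *: e)) (partial i (w t) (x + h *: e)).
    move=> wC h; apply: is_derive_along_line.
    by have [_ _ /(_ i)[]] := wC t (x + h *: e) t_gt0 tT.
  have line_derive2 (w : R -> 'rV[R]_n -> R) : C21 T w ->
      is_derive (0 : R) (1 : R) (fun h : R => partial i (w t) (x + h *: e))
        (partial i (partial i (w t)) x).
    move=> wC; rewrite -[in partial i (partial i _) x](addr0 x) -(scale0r e).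
    apply: is_derive_along_line; rewrite scale0r addr0.
    by have [_ _ _ /(_ i i)[]] := wC t x t_gt0 tT.
  have e1 : sqr_euclidean e = 1 by rewrite -dotxx dot_delta mxE !eqxx.
  pose g h := K t * (u t (x + h *: e) - v t (x + h *: e)) -
    eta * (p + h * (2 * dot e x) + h ^+ 2 * 1).
  have gE h : g h = penalized eta t (x + h *: e).
    by rewrite /g /penalized sqr_euclidean_line e1 /p; ring.
  pose g' h := K t * (partial i (u t) (x + h *: e) - partial i (v t) (x + h *: e)) -
    eta * (2 * dot e x + h * (2 * 1)).
  have g_d h : `|h| < r -> is_derive h (1 : R) g (g' h).
    move=> _; exact: (is_derive_penalty_space (K t) eta p (2 * dot e x) 1
      (line_derive u uC h) (line_derive v vC h)).
  have g'_d : is_derive (0 : R) (1 : R) g' (K t * (partial i (partial i (u t)) x -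
      partial i (partial i (v t)) x) - eta * 2).
    have := is_derive_penalty_space (K t) eta (2 * dot e x) 2 0
      (line_derive2 u uC) (line_derive2 v vC).
    rewrite 2!mulr0 addr0; congr (is_derive _ _ _ _).
    by apply/funext => h; rewrite /g' mulr1 mulr0 addr0.
  have g_max h : `|h| < r -> g h <= g 0.
    move=> hr; rewrite !gE scale0r addr0; apply: xmax.
    rewrite addrAC subrr add0r normrZ; apply: le_lt_trans hr.
    by apply: ler_piMr; [exact: normr_ge0|exact: norm_delta].
  exact: (second_derivative_maximum r0 g_d g'_d g_max).
have lap_le0 : K t * (laplacian (u t) x - laplacian (v t) x) - eta * (2 * n%:R) <= 0.
  rewrite /laplacian -sumrB mulr_sumr (_ : eta * (2 * n%:R) = \sum_(i < n) eta * 2); last first.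
    by rewrite sumr_const card_ord mulrA [LHS]mulr_natr.
  by rewrite -sumrB; apply: sumr_le0 => i _; exact: space_le0.
have H : 0 <= K t * (f (u t x) - f (v t x) - lambda * (u t x - v t x)).
  move: time_ge0 lap_le0; rewrite (u_eq x t_gt0 tT) (v_eq x t_gt0 tT).
  move: (K t) (laplacian (u t) x) (laplacian (v t) x) (f (u t x)) (f (v t x)) (u t x - v t x).
  by move=> k a b c d w; lra.
move: H; rewrite pmulr_rge0// subr_ge0 => H.
rewrite leNgt; apply/negP => w0.
have tt : t0 <= t <= t1 by rewrite (ltW t0t).
have := f_lip (uM x tt) (vM x tt); rewrite (gtr0_norm w0) => /(le_trans (ler_norm _)).
by move=> /(le_trans H); rewrite /lambda mulrDl mul1r gerDl leNgt w0.
Qed.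

(** A value above [eps] would give a maximum above [eps] on a large box; it lies
after [t0] by the hypothesis on initial values, and off the lateral boundary
because the penalty exceeds [2 M] there. *)
Let penalized_le eta t x : 0 < eta -> t0 <= t <= t1 -> penalized eta t x <= eps.
Proof.
move=> eta0 tt; rewrite leNgt; apply/negP => We.
have M0 : 0 <= M by apply: le_trans (uM x tt).
(* Since [1 <= rho], [2 M < eta rho <= eta rho ^ 2]. *)
pose rho := `|x| + 2 * M / eta + 1.
have rho1 : 1 <= rho by rewrite lerDr addr_ge0// divr_ge0 ?mulr_ge0// ltW.
have rhoM : 2 * M < eta * rho ^+ 2.
  rewrite [ltRHS]mulrC -ltr_pdivrMr//; apply: (@lt_le_trans _ _ rho).
    by rewrite /rho -addrA addrCA ltrDl ltr_wpDl.
  by rewrite expr2 ler_peMl// (le_trans ler01).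
pose B := `[t0, t1]%classic `*` [set y : 'rV[R]_n | forall i, `[- rho, rho]%classic (y ord0 i)].
have B_of s y : t0 <= s <= t1 -> `|y| <= rho -> B (s, y).
  move=> ss yr; split=> /=; first by rewrite in_itv.
  by move=> i; rewrite in_itv /= -ler_norml (le_trans (norm_coor i y)).
have xB : B (t, x).
  by apply: B_of => //; rewrite /rho -addrA lerDl addr_ge0// divr_ge0 ?mulr_ge0// ltW.
have [[s y] + ymax] : exists2 q, q \in B & forall q', q' \in B ->
    penalized eta q'.1 q'.2 <= penalized eta q.1 q.2.
  apply: (@compact_EVT_max _ R (fun q => penalized eta q.1 q.2) B); first by exists (t, x).
    apply: compact_setX; first exact: segment_compact.
    by apply: (@rV_compact R n (fun=> `[- rho, rho]%classic)) => i; exact: segment_compact.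
  apply: continuous_in_subspaceT => -[s y] /set_mem[/= + _]; rewrite in_itv /= => ss.
  exact: continuous_penalized.
move=> /set_mem[/= + _]; rewrite in_itv /= => ss.
have Wsy : eps < penalized eta s y.
  by apply: lt_le_trans We _; apply: (ymax (t, x)); exact/mem_set.
have pen0 : 0 <= eta * (sqr_euclidean y + 2 * n%:R * (s - t0)).
  rewrite mulr_ge0 ?(ltW eta0)// addr_ge0 ?sqr_euclidean_ge0// mulr_ge0 ?mulr_ge0// subr_ge0.
  by case/andP: ss.
have w0 : 0 < u s y - v s y.
  rewrite -(pmulr_rgt0 _ (K_gt0 s)); apply: le_lt_trans eps0 (lt_le_trans Wsy _).
  by rewrite /penalized gerBl.
have Kw : K s * (u s y - v s y) <= u s y - v s y.
  by rewrite ler_piMl ?(ltW w0)// K_le1//; case/andP: ss.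
have yrho : `|y| < rho.
  have : eta * `|y| ^+ 2 < eta * rho ^+ 2.
    apply: le_lt_trans rhoM; apply: (@le_trans _ _ (eta * (sqr_euclidean y + 2 * n%:R * (s - t0)))).
      rewrite ler_wpM2l ?(ltW eta0)// (le_trans (sqr_norm_le y))// lerDl mulr_ge0 ?mulr_ge0// subr_ge0.
      by case/andP: ss.
    apply: le_trans (diff_le y ss); apply: le_trans Kw; rewrite -subr_ge0.
    exact: ltW (le_lt_trans eps0 Wsy).
  rewrite ltr_pM2l// ltr_pXn2r// ?nnegrE//; exact: le_trans ler01 rho1.
have st0 : t0 < s.
  rewrite lt_neqAle; case/andP: (ss) => -> _; rewrite andbT; apply/eqP => t0s.
  move: Wsy; rewrite ltNge => /negP; apply.
  apply: le_trans (uv0 y); rewrite [in leRHS]t0s (le_trans _ Kw)//.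
  by rewrite /penalized gerBl.
suff : u s y - v s y <= 0 by rewrite leNgt w0.
apply: (@penalized_max_le eta (rho - `|y|)).
- by rewrite st0; case/andP: ss.
- by rewrite subr_gt0.
- move=> s' /andP[s'0 s's]; apply: (ymax (s', y)); apply/mem_set; apply: B_of (ltW yrho).
  by rewrite s'0 (le_trans s's)//; case/andP: ss.
- move=> z zy; apply: (ymax (s, z)); apply/mem_set; apply: B_of => //.
  by rewrite -(subrK y z) (le_trans (ler_normD _ _))// -lerBrDr ltW.
Qed.

(** Let [eta] tend to 0 in [penalized_le]. *)
Lemma heat_comparison t x : t0 <= t <= t1 ->
  u t x - v t x <= eps * expR ((L + 1) * (t - t0)).
Proof.
move=> tt; set w := u t x - v t x.
have -> : expR ((L + 1) * (t - t0)) = (K t)^-1 by rewrite /K expRN invrK.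
rewrite ler_pdivlMr// mulrC; apply/ler_addgt0Pr => e e0.
set c := sqr_euclidean x + 2 * n%:R * (t - t0).
have c0 : 0 <= c.
  rewrite addr_ge0 ?sqr_euclidean_ge0// !mulr_ge0// subr_ge0.
  by case/andP: tt.
have c1 : 0 < c + 1 by rewrite ltr_wpDl.
have := penalized_le x (divr_gt0 e0 c1) tt; rewrite /penalized -/w -/c lerBlDr.
move=> /le_trans; apply; rewrite lerD2l mulrAC ler_pdivrMr// ler_wpM2l ?(ltW e0)//.
by rewrite lerDl.
Qed.

End comparison.

(** * Uniqueness of classical solutions *)

Section almost_everywhere_row.
Context {R : realType} {n : nat}.
Local Notation rV := 'rV[R]_n.
Local Notation mu := (lebesgue_row R n).
Implicit Types (g : rV -> R) (x y : rV).

Let cube x (r : R) : set rV :=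
  [set v | forall i, (`]x ord0 i - r, x ord0 i + r[%classic : set (measurableTypeR R)) (coor i v)].

Let measurable_cube x r : measurable (cube x r).
Proof.
rewrite (_ : cube x r = \bigcap_(i in [set: 'I_n])
    (coor i @^-1` `]x ord0 i - r, x ord0 i + r[%classic)); last first.
  by apply/seteqP; split => v /= h i; [move=> _|]; exact: h.
apply: fin_bigcap_measurable => // i _.
by rewrite -[X in measurable X]setTI; apply: measurable_coor.
Qed.

Let lebesgue_cube_gt0 x (r : R) : 0 < r -> (0 < mu (cube x r))%E.
Proof.
move=> r0.
have -> : mu (cube x r) = (\prod_(i < n)
    @lebesgue_measure R (`](x ord0 i - r)%R, (x ord0 i + r)%R[%classic))%E.
  by apply: lebesgue_row_box => i; exact: measurable_itv.
rewrite (eq_bigr (fun=> (2 * r)%:E)) => [|i _]; last first.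
  rewrite /= lebesgue_measure_itv /= lte_fin ifT; last by lra.
  by rewrite -EFinB; congr EFin; ring.
by elim/big_ind : _ => // [a b|i _]; [exact: mule_gt0|rewrite lte_fin mulr_gt0].
Qed.

Lemma lebesgue_row_gt0 : (0 < mu setT)%E.
Proof.
apply: lt_le_trans (lebesgue_cube_gt0 0 ltr01) _.
by apply: le_measure; rewrite ?inE//; exact: measurable_cube.
Qed.

(** A point with [c < g y] has a cube around it where this holds, and cubes have
positive measure. *)
Lemma ae_le_continuous g (c : R) : continuous g ->
  (\forall y \ae mu, g y <= c) -> forall y, g y <= c.
Proof.
move=> cg [N [mN N0 gN]] y; rewrite leNgt; apply/negP => cgy.
have /nbhs_ballP[r /= r0 yr] : nbhs y [set z | c < g z].
  exact: (cvgr_gt (g y) (cg y) c cgy).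
have : (mu (cube y r) <= mu N)%E.
  apply: le_measure; rewrite ?inE//.
  move=> z yz; apply: gN => /= gz.
  suff : c < g z by rewrite ltNge gz.
  apply: yr; split=> // i j; rewrite ord1 /ball /= distrC ltr_distl.
  by have := yz j; rewrite /= in_itv.
by rewrite [X in (_ <= X)%E]N0 leNgt lebesgue_cube_gt0.
Qed.

(** The norm is an essential supremum since the space has positive measure. *)
Lemma Lq_norm_pinftyP g (c : \bar R) :
  (Lq_norm +oo g <= c)%E <-> (\forall y \ae mu, (`|g y|%:E <= c)%E).
Proof.
rewrite /Lq_norm unlock lebesgue_row_gt0.
by split => [/ess_supP|h]; [|apply/ess_supP].
Qed.

End almost_everywhere_row.

Section uniqueness.
Context {R : realType} {n : nat}.
Variable f : R -> R.
Hypothesis f_lip : locally_lipschitz f.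
Implicit Types (phi : 'rV[R]_n -> R) (u v : R -> 'rV[R]_n -> R) (T : \bar R).

Lemma classical_solutionW phi T T' u : (0 < T')%E -> (T' <= T)%E ->
  classical_solution f phi T u -> classical_solution f phi T' u.
Proof.
move=> T'0 T'T [[_ u0] uC u_eq u_bd u_cvg]; split => //.
- by move=> t x t0 tT; apply: uC => //; exact: lt_le_trans T'T.
- by move=> t x t0 tT; apply: u_eq => //; exact: lt_le_trans T'T.
- by move=> s sT; apply: u_bd; exact: lt_le_trans T'T.
Qed.

Let C21_continuous T u t : C21 T u -> 0 < t -> (t%:E < T)%E -> continuous (u t).
Proof.
move=> uC t0 tT x; have [cu _ _ _] := uC t x t0 tT.
apply: (@continuous_comp _ _ _ (fun y => (t, y)) (fun p : R * 'rV[R]_n => u p.1 p.2)) => //.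
by apply: (@cvg_pair _ _ _ (nbhs x) (nbhs t) (nbhs x)); [exact: cvg_cst|exact: cvg_id].
Qed.

Let norm_le_everywhere T u t (M : R) : C21 T u -> 0 < t -> (t%:E < T)%E ->
  (Lq_norm +oo (u t) <= M%:E)%E -> forall x, `|u t x| <= M.
Proof.
move=> uC t0 tT /Lq_norm_pinftyP uM.
apply: ae_le_continuous => [x|].
  apply: (@continuous_comp _ _ _ (u t) (@Num.norm _ R)); first exact: C21_continuous tT x.
  exact: norm_continuous.
by apply: filterS uM => y; rewrite lee_fin.
Qed.

Let near_datum phi T u (e : R) : classical_solution f phi T u -> 0 < e ->
  \forall s \near 0^'+, (Lq_norm +oo (fun x => u s x - heat_semigroup s phi x)%R <= e%:E)%E.
Proof.
move=> [_ _ _ _ u_cvg] e0.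
near=> s; apply/ltW; near: s.
exact: (u_cvg _ (@nbhs_open_ereal_lt R 0 (fun=> e) e0)).
Unshelve. all: end_near. Qed.

(** Both solutions are close to [S(s) phi] in [L^oo] for small [s], hence to each
other, and by continuity everywhere; [heat_comparison] from time [s] on keeps
them close up to a factor that does not depend on [s]. *)
Lemma classical_solution_unique phi T u v :
  classical_solution f phi T u -> classical_solution f phi T v ->
  forall t, 0 <= t -> (t%:E < T)%E -> v t = u t.
Proof.
move=> su sv t; rewrite le_eqVlt => /orP[/eqP <- _|t0 tT].
  by case: su sv => [[_ ->] _ _ _ _] [[_ ->]].
have [_ uC u_eq u_bd _] := su; have [_ vC v_eq v_bd _] := sv.
have [M1 uM] := u_bd _ tT; have [M2 vM] := v_bd _ tT.
pose M := Num.max M1 M2.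
have in_time s : 0 < s <= t -> 0 < s /\ (s%:E < T)%E.
  by move=> /andP[s0 st]; split=> //; apply: le_lt_trans tT; rewrite lee_fin.
have uM' s x : 0 < s <= t -> `|u s x| <= M.
  move=> st; have [s0 sT] := in_time s st.
  apply: (norm_le_everywhere uC s0 sT); apply: le_trans (uM s _) _.
    by case/andP: st => _ ->; rewrite ltW.
  by rewrite lee_fin le_max lexx.
have vM' s x : 0 < s <= t -> `|v s x| <= M.
  move=> st; have [s0 sT] := in_time s st.
  apply: (norm_le_everywhere vC s0 sT); apply: le_trans (vM s _) _.
    by case/andP: st => _ ->; rewrite ltW.
  by rewrite lee_fin le_max lexx orbT.
have [L L0 HL] := lipschitz_on_segment f_lip M.
apply/funext => x; apply/eqP; rewrite eq_sym -subr_eq0 -normr_le0.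
apply/ler_addgt0Pr => e e0; rewrite add0r.
(* The factor lost in the comparison between the times [s] and [t]. *)
pose C := expR ((L + 1) * t).
have C0 : 0 < C by exact: expR_gt0.
have d0 : 0 < e / C / 2 by rewrite !divr_gt0.
near (0 : R)^'+ => s.
have s0 : 0 < s by near: s; exact: nbhs_right_gt.
have st : s < t by near: s; exact: nbhs_right_lt.
have [_ sT] := in_time s (introT andP (conj s0 (ltW st))).
have uvs y : `|u s y - v s y| <= e / C.
  move: y; apply: ae_le_continuous.
    move=> y; apply: (@continuous_comp _ _ _ (fun y => u s y - v s y) (@Num.norm _ R)); last first.
      exact: norm_continuous.
    by apply: continuousB; [exact: C21_continuous uC s0 sT y|exact: C21_continuous vC s0 sT y].
  have /Lq_norm_pinftyP h1 :
      (Lq_norm +oo (fun x => u s x - heat_semigroup s phi x)%R <= (e / C / 2)%:E)%E.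
    by near: s; exact: near_datum su d0.
  have /Lq_norm_pinftyP h2 :
      (Lq_norm +oo (fun x => v s x - heat_semigroup s phi x)%R <= (e / C / 2)%:E)%E.
    by near: s; exact: near_datum sv d0.
  apply: filterS2 h1 h2 => y; rewrite !lee_fin => h1 h2.
  rewrite (_ : u s y - v s y = (u s y - heat_semigroup s phi y) -
    (v s y - heat_semigroup s phi y)); last by ring.
  by rewrite (le_trans (ler_normB _ _))// (le_trans (lerD h1 h2))// -splitr.
have bound (a b : R -> 'rV[R]_n -> R) : C21 T a -> C21 T b ->
    (forall t x, 0 < t -> (t%:E < T)%E -> partial_t a t x = laplacian (a t) x + f (a t x)) ->
    (forall t x, 0 < t -> (t%:E < T)%E -> partial_t b t x = laplacian (b t) x + f (b t x)) ->
    (forall s x, 0 < s <= t -> `|a s x| <= M) -> (forall s x, 0 < s <= t -> `|b s x| <= M) ->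
    (forall x, a s x - b s x <= e / C) -> a t x - b t x <= e.
  move=> aC bC a_eq b_eq aM bM ab0.
  have between r : s <= r <= t -> 0 < r <= t.
    by move=> /andP[sr ->]; rewrite (lt_le_trans s0 sr).
  have eC : 0 <= e / C by rewrite ltW// divr_gt0.
  have := @heat_comparison R n f T a b aC bC a_eq b_eq s t M L (e / C) s0 tT L0 eC HL
    (fun r y rt => aM r y (between r rt)) (fun r y rt => bM r y (between r rt)) ab0 t x.
  rewrite (ltW st) lexx => /(_ isT) /le_trans; apply.
  rewrite -ler_pdivlMl ?divr_gt0// invfM invrK mulrAC mulVf ?gt_eqF// mul1r ler_expR.
  by rewrite ler_wpM2l ?addr_ge0// gerBl ltW.
rewrite ler_norml; apply/andP; split.
  rewrite lerNl opprB; apply: bound => // y; apply: le_trans (uvs y).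
  by rewrite distrC ler_norm.
by apply: bound => // y; apply: le_trans (uvs y); exact: ler_norm.
Unshelve. all: end_near. Qed.

End uniqueness.

(** * Global solutions for small data *)

Section smoothing.
Context {R : realType} {n : nat}.
Local Notation rV := 'rV[R]_n.
Local Notation K := (@heat_kernel R n).
Local Notation mu := (lebesgue_row R n).
Implicit Types (g : rV -> R) (x : rV) (t : R).

Lemma heat_kernel_le t x : 0 < t -> K t x <= t `^ (- (n%:R / 2)).
Proof.
move=> t0; have pi4 : 1 <= 4 * pi :> R by have := @pi_ge2 R; lra.
have t4 : t <= 4 * pi * t by rewrite ler_peMl// ltW.
have t40 : 0 < 4 * pi * t := lt_le_trans t0 t4.
rewrite -[leRHS]mulr1 /heat_kernel ler_pM ?powR_ge0 ?expR_ge0//; last first.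
  by rewrite -expR0 ler_expR oppr_le0 divr_ge0 ?sqr_euclidean_ge0// mulr_ge0// ltW.
rewrite !powRN lef_pV2 ?posrE ?powR_gt0//.
by apply: ge0_ler_powR; rewrite ?nnegrE ?divr_ge0 ?(ltW t0) ?(ltW t40).
Qed.

(** The smoothing of the heat semigroup from [L^1] to [L^oo]. *)
Lemma heat_conv_norm_L1 t g M x : measurable_fun setT g -> (forall y, `|g y| <= M) ->
  0 < t -> (`|heat_conv K t g x|%:E <=
    (t `^ (- (n%:R / 2)))%:E * \int[mu]_y `|g y|%:E)%E.
Proof.
move=> mg gM t0.
have mg' : measurable_fun setT (fun y => `|g y|) by exact: measurableT_comp.
have gM' y : `| `|g y| | <= M by rewrite normr_id.
have mK := measurable_kernel_translate t x (gauss_kernel_heat (R := R) (n := n)).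
apply: (@le_trans _ _ (heat_conv K t (fun y => `|g y|) x)%:E).
  rewrite lee_fin ler_norml; apply/andP; split.
    rewrite lerNl -(heat_convN x mg gM t0).
    apply: (le_heat_conv x _ _ mg' gM' t0).
    - exact: measurable_funN.
    - by move=> y; rewrite normrN.
    - by move=> y; rewrite -normrN ler_norm.
  by apply: (le_heat_conv x mg gM mg' gM' t0) => y; exact: ler_norm.
rewrite (EFin_heat_conv x mg' gM' t0) -ge0_integralZl_EFin ?powR_ge0//; last first.
  exact/measurable_EFinP.
apply: ge0_le_integral => //.
- by move=> y _; rewrite lee_fin mulr_ge0 ?heat_kernel_ge0.
- by apply/measurable_EFinP; exact: measurable_funM.
- by apply/measurable_EFinP; apply: measurable_funM.
- by move=> y _; rewrite -EFinM lee_fin ler_wpM2r// heat_kernel_le.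
Qed.

Lemma heat_semigroup_ae t g g' x : measurable_fun setT g -> measurable_fun setT g' ->
  (\forall y \ae mu, g y = g' y) -> 0 < t ->
  heat_semigroup t g x = heat_conv K t g' x.
Proof.
move=> mg mg' gg' t0; rewrite heat_semigroupE// /heat_conv /Rintegral; congr fine.
have mK := measurable_kernel_translate t x (gauss_kernel_heat (R := R) (n := n)).
apply: ae_eq_integral => //.
- by apply/measurable_EFinP; exact: measurable_funM.
- by apply/measurable_EFinP; exact: measurable_funM.
- by apply: filterS gg' => y -> _.
Qed.

End smoothing.

Section mild_to_classical.
Context {R : realType} {n : nat}.
Local Notation rV := 'rV[R]_n.
Local Notation K := (@heat_kernel R n).
Variables (f : R -> R) (phi psi : rV -> R) (D N : R) (u : R -> rV -> R).
Hypotheses (f_lip : locally_lipschitz f).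
Hypotheses (mpsi : measurable_fun setT psi) (psiD : forall y, `|psi y| <= D).
Hypothesis phi_psi : forall t x, 0 < t -> heat_semigroup t phi x = heat_conv K t psi x.
Hypothesis phi_bounded : (Lq_norm +oo phi <= N%:E)%E.
Hypotheses (u0 : u 0 = phi) (uN : forall t x, 0 < t -> `|u t x| <= N).
Hypothesis mu_pos : measurable_fun [set: R * rV] (fun p => if 0 < p.1 then u p.1 p.2 else 0).
Hypothesis u_mild : forall t x, 0 < t ->
  u t x = heat_conv K t psi x + duhamel K (fun s y => f (u s y)) t x.

(** Cut off at nonpositive times, where [u] is arbitrary, the source is bounded and
measurable on all of space-time. *)
Let F s y := f (if 0 < s then u s y else 0).

Let F_bounded : exists M, forall s y, `|F s y| <= M.
Proof.
have N0 : 0 <= N by apply: le_trans (uN 0 ltr01).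
have [L L0 fL] := lipschitz_on_segment f_lip N.
exists (`|f 0| + L * N) => s y.
have uN' : `|if 0 < s then u s y else 0| <= N.
  by case: ifP => [s0|_]; [exact: uN|rewrite normr0].
rewrite -lerBlDl (le_trans (lerB_dist _ _))// (le_trans (fL _ _ uN' _))//.
  by rewrite normr0.
by rewrite subr0 ler_wpM2l.
Qed.

Let mF : measurable_fun [set: R * rV] (fun p => F p.1 p.2).
Proof.
have fm : measurable_fun setT f.
  by apply: continuous_measurable_fun; exact: locally_lipschitz_continuous.
exact: (measurableT_comp fm mu_pos).
Qed.

Let u_mildF t x : 0 < t -> u t x = heat_conv K t psi x + duhamel K F t x.
Proof.
move=> t0; rewrite (u_mild x t0); congr (_ + _); apply: eq_Rintegral => s.
rewrite inE /= in_itv /= => /andP[s0 _]; congr (heat_conv _ _ _ _).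
by apply/funext => y; rewrite /F s0.
Qed.

(** The convergence to [S(t) phi] is immediate from the mild formula: the Duhamel
term is at most [M t]. *)
Lemma mild_is_classical : classical_solution f phi +oo%E u.
Proof.
have N0 : 0 <= N by apply: le_trans (uN 0 ltr01).
have [M FM] := F_bounded.
have fc := locally_lipschitz_continuous f_lip.
have [L L0 fL] := lipschitz_on_segment f_lip N.
have FE t x : 0 < t -> F t x = f (u t x) by move=> t0; rewrite /F t0.
have F_lip s y z : 0 < s -> `|F s y - F s z| <= L * `|u s y - u s z|.
  by move=> s0; rewrite !FE//; apply: fL; exact: uN.
have M0 : 0 <= M by apply: le_trans (FM 0 0).
split=> //.
- exact: (mild_C21 mpsi psiD mF FM fc u_mildF FE L0 F_lip).
- by move=> t x t0 _; exact: (mild_heat_equation mpsi psiD mF FM fc u_mildF FE L0 F_lip x t0).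
- move=> T' _; exists N => t /andP[]; rewrite le_eqVlt => /orP[/eqP <- _|t0 _].
    by rewrite u0.
  by apply/Lq_norm_pinftyP; apply: aeW => y; rewrite lee_fin uN.
apply: (@squeeze_cvge _ _ _ _ (cst 0%E) _ (fun t => (M * t)%:E)).
- near=> t; have t0 : 0 < t by near: t; exact: nbhs_right_gt.
  rewrite /cst /Lq_norm Lnorm_ge0 /=; apply/Lq_norm_pinftyP; apply: aeW => y.
  rewrite lee_fin phi_psi// u_mildF// addrAC subrr add0r.
  exact: (duhamel_norm_le y mF FM t0).
- exact: cvg_cst.
- apply/cvg_EFin; first by near=> t.
  rewrite -[X in _ --> X](mulr0 M) /=.
  apply: cvg_at_right_filter; apply: cvgM; [exact: cvg_cst|exact: cvg_id].
Unshelve. all: end_near. Qed.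

(** No existence interval exceeds [+oo], and uniqueness identifies any other
solution. *)
Lemma mild_is_maximal : maximal_solution f phi +oo%E u.
Proof.
split; first exact: mild_is_classical.
move=> T' v sv; split; first exact: leey.
have [[T'0 _] _ _ _ _] := sv.
apply: classical_solution_unique sv => //.
exact: classical_solutionW T'0 (leey _) mild_is_classical.
Qed.

End mild_to_classical.

Section barrier_solution.
Context {R : realType} {n : nat}.
Local Notation rV := 'rV[R]_n.
Local Notation K := (@heat_kernel R n).
Local Notation leb := (@lebesgue_measure R).
Local Notation mu := (lebesgue_row R n).
Variables (f : R -> R) (A b : R).
Hypotheses (f_lip : locally_lipschitz f)
  (f_mono : {homo f : x y / x <= y}) (f0 : f 0 = 0) (A1 : 1 < A) (b0 : 0 < b).
Let Lambda := stretched (2 / n%:R) (ell f) b.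
Hypothesis Lambda_int : forall t, 0 < t ->
  leb.-integrable `]0, t[ (EFin \o Lambda) /\
  \int[leb]_(s in `]0, t[) Lambda s <= 1 - A^-1.
Variable phi : rV -> R.
Hypotheses (mphi : measurable_fun setT phi)
  (phi_small : (Lq_norm 1 phi + Lq_norm +oo phi <= (b / A)%:E)%E).

Let A0 : 0 < A. Proof. exact: lt_trans ltr01 A1. Qed.
Let delta := b / A.
Let delta0 : 0 < delta. Proof. exact: divr_gt0. Qed.

(** A datum that is small in [L^oo] equals its truncation almost everywhere; the
truncation is bounded at every point, as the mild theory asks, and gives the
same [S(t)] at positive times. *)
Definition clipped y := Num.max (- delta) (Num.min delta (phi y)).

Let phi1_ge0 : (0 <= Lq_norm 1 phi)%E. Proof. exact: Lnorm_ge0. Qed.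
Let phiy_ge0 : (0 <= Lq_norm +oo phi)%E. Proof. exact: Lnorm_ge0. Qed.

Let phi1_small : (Lq_norm 1 phi <= delta%:E)%E.
Proof. by apply: le_trans phi_small; rewrite leeDl. Qed.

Let phiy_small : (Lq_norm +oo phi <= delta%:E)%E.
Proof. by apply: le_trans phi_small; rewrite leeDr. Qed.

Let clipped_le y : `|clipped y| <= delta.
Proof.
rewrite /clipped ler_norml ge_max !le_max lexx ge_min lexx /= andbT.
by rewrite (le_trans _ (ltW delta0))// oppr_le0 ltW.
Qed.

Let clippedE y : `|phi y| <= delta -> clipped y = phi y.
Proof. by rewrite ler_norml => /andP[h1 h2]; rewrite /clipped (min_idPr h2) (max_idPr h1). Qed.

Let ae_clipped : \forall y \ae mu, phi y = clipped y.
Proof.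
have /Lq_norm_pinftyP := phiy_small.
by apply: filterS => y; rewrite lee_fin => /clippedE ->.
Qed.

Let measurable_clipped : measurable_fun setT clipped.
Proof.
apply: measurable_maxr; first exact: measurable_cst.
by apply: measurable_minr; first exact: measurable_cst.
Qed.

Let L1_clipped : (\int[mu]_y `|clipped y|%:E = Lq_norm 1 phi)%E.
Proof.
rewrite /Lq_norm Lnorm1; apply: ae_eq_integral => //.
- by apply/measurable_EFinP; exact: measurableT_comp.
- by apply/measurable_EFinP; exact: measurableT_comp.
- by apply: filterS ae_clipped => y /= -> _.
Qed.

Let heat_clipped t x : 0 < t -> heat_semigroup t phi x = heat_conv K t clipped x.
Proof. by move=> t0; exact: heat_semigroup_ae. Qed.

Let heat_pos t x : 0 < t ->
  heat_semigroup t (fun y => Num.max (phi y) 0) x = heat_conv K t (pos_part clipped) x.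
Proof.
move=> t0; apply: heat_semigroup_ae => //.
- by apply: measurable_maxr.
- by apply: measurable_maxr.
- by apply: filterS ae_clipped => y; rewrite /pos_part => ->.
Qed.

Let heat_neg t x : 0 < t ->
  heat_semigroup t (fun y => Num.min (phi y) 0) x = heat_conv K t (neg_part clipped) x.
Proof.
move=> t0; apply: heat_semigroup_ae => //.
- by apply: measurable_minr.
- by apply: measurable_minr.
- by apply: filterS ae_clipped => y; rewrite /neg_part => ->.
Qed.

Let heat_abs_L1 (g : rV -> R) t x : measurable_fun setT g ->
  (forall y, `|g y| <= `|clipped y|) -> 0 < t ->
  (`|heat_conv K t g x|%:E <= (t `^ (- (n%:R / 2)))%:E * Lq_norm 1 phi)%E.
Proof.
move=> mg gphi t0; have gd y := le_trans (gphi y) (clipped_le y).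
apply: le_trans (heat_conv_norm_L1 x mg gd t0) _; rewrite -L1_clipped.
rewrite lee_pmul2l ?lte_fin ?powR_gt0//; apply: ge0_le_integral => //.
- by apply/measurable_EFinP; exact: measurableT_comp.
- by apply/measurable_EFinP; exact: measurableT_comp.
- by move=> y _; rewrite lee_fin.
Qed.

(** The sup norm bound [delta] for short times and the [L^1] bound for long times
combine to the argument of [ell] in [Lambda]. *)
Let heat_abs_le (g : rV -> R) t x : measurable_fun setT g ->
  (forall y, `|g y| <= `|clipped y|) -> 0 < t ->
  A * `|heat_conv K t g x| <= b * Num.min 1 (t `^ (- (2 / n%:R)^-1)).
Proof.
move=> mg gphi t0; have gd y := le_trans (gphi y) (clipped_le y).
have -> : b = A * delta by rewrite /delta mulrCA divff ?mulr1// gt_eqF.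
rewrite -mulrA ler_pM2l// minr_pMr ?(ltW delta0)// mulr1 le_min.
rewrite (heat_conv_norm_le x mg gd t0) /= -lee_fin invf_div.
apply: le_trans (heat_abs_L1 x mg gphi t0) _.
by rewrite muleC EFinM; apply: lee_wpmul2r; rewrite // lee_fin powR_ge0.
Qed.

Let mpos : measurable_fun setT (pos_part clipped).
Proof. exact: measurable_maxr. Qed.

Let mneg : measurable_fun setT (neg_part clipped).
Proof. exact: measurable_minr. Qed.

Let pos_le y : `|pos_part clipped y| <= `|clipped y|.
Proof. by rewrite /pos_part; case: (leP (clipped y) 0) => _; rewrite ?normr0. Qed.

Let neg_le y : `|neg_part clipped y| <= `|clipped y|.
Proof. by rewrite /neg_part; case: (leP (clipped y) 0) => _; rewrite ?normr0. Qed.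

Let pos_ge0 t x : 0 < t -> 0 <= heat_conv K t (pos_part clipped) x.
Proof. by move=> t0; apply: heat_conv_ge0 => y; rewrite le_max lexx orbT. Qed.

Let neg_le0 t x : 0 < t -> heat_conv K t (neg_part clipped) x <= 0.
Proof.
move=> t0; have nd y := le_trans (neg_le y) (clipped_le y).
rewrite -oppr_ge0 -(heat_convN x mneg nd t0); apply: heat_conv_ge0 => y.
by rewrite oppr_ge0 ge_min lexx orbT.
Qed.

Let f_upper s y : 0 < s -> f (upper_barrier clipped A s y) <=
  Lambda s * upper_barrier clipped A s y.
Proof.
move=> s0; rewrite /upper_barrier s0; apply: f_le_ell => //.
rewrite mulr_ge0 ?(ltW A0) ?pos_ge0//=.
by apply: le_trans (heat_abs_le y mpos pos_le s0); rewrite ler_pM2l// ler_norm.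
Qed.

Let f_lower s y : 0 < s -> Lambda s * lower_barrier clipped A s y <=
  f (lower_barrier clipped A s y).
Proof.
move=> s0; rewrite /lower_barrier s0; apply: ell_le_f => //.
rewrite mulr_ge0_le0 ?(ltW A0) ?neg_le0// andbT lerNl -mulrN.
by apply: le_trans (heat_abs_le y mneg neg_le s0); rewrite ler_pM2l// -normrN ler_norm.
Qed.

(** At time 0 the solution takes the prescribed representative of the datum, and
afterwards the values of the mild solution for the truncated datum; the
[L^oo] bound follows from the barriers by [heat_conv_norm_L1]. *)
Lemma global_solution_between_barriers : exists u : R -> rV -> R,
  [/\ maximal_solution f phi +oo%E u,
      forall t x, 0 <= t ->
        A * heat_semigroup t (fun y => Num.min (phi y) 0) x <= u t x
        <= A * heat_semigroup t (fun y => Num.max (phi y) 0) x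
    & forall t, 0 < t ->
        (Lq_norm +oo (u t) <= (A * t `^ (- (n%:R / 2)))%:E * Lq_norm 1 phi)%E].
Proof.
have [v [mv v_between v_mild]] := exists_mild_solution f_mono
  (locally_lipschitz_continuous f_lip) A1 measurable_clipped clipped_le
  (fun t t0 => (Lambda_int t0).1) (fun t t0 => (Lambda_int t0).2) f_upper f_lower.
pose u t := if 0 < t then v t else phi.
have uE t : 0 < t -> u t = v t by rewrite /u => ->.
have u0 : u 0 = phi by rewrite /u ltxx.
have barrier t x : 0 < t -> A * heat_conv K t (neg_part clipped) x <= u t x
    <= A * heat_conv K t (pos_part clipped) x.
  by move=> t0; have := v_between t x; rewrite /lower_barrier /upper_barrier uE// t0.
have u_norm t x (B : \bar R) : 0 < t ->
    ((A * `|heat_conv K t (pos_part clipped) x|)%:E <= B)%E ->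
    ((A * `|heat_conv K t (neg_part clipped) x|)%:E <= B)%E -> (`|u t x|%:E <= B)%E.
  move=> t0 pB nB; have [ux|ux] := leP 0 (u t x).
    apply: le_trans pB; rewrite lee_fin ger0_norm//.
    have /andP[_ /le_trans] := barrier t x t0; apply.
    by rewrite ler_pM2l// ler_norm.
  apply: le_trans nB; rewrite lee_fin ltr0_norm// lerNl.
  have /andP[/(le_trans _) h _] := barrier t x t0; apply: h.
  by rewrite -mulrN ler_pM2l// lerNl -normrN ler_norm.
exists u; split.
- apply: (@mild_is_maximal _ _ f phi clipped delta (A * delta) u) => //.
  + by apply: le_trans phiy_small _; rewrite lee_fin ler_peMl ?(ltW delta0)// ltW.
  + move=> t x t0; rewrite -lee_fin; apply: u_norm => //; rewrite lee_fin ler_pM2l//.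
      exact: (heat_conv_norm_le x mpos (fun y => le_trans (pos_le y) (clipped_le y)) t0).
    exact: (heat_conv_norm_le x mneg (fun y => le_trans (neg_le y) (clipped_le y)) t0).
  + rewrite (_ : (fun p => _) = (fun p : R * rV => if 0 < p.1 then v p.1 p.2 else 0)); last first.
      by apply/funext => p; case p0 : (0 < p.1) => //; rewrite uE.
    apply: measurable_fun_ifT => //.
    by apply: measurable_fun_ltr => //; exact: measurable_fst.
  + move=> t x t0; rewrite (uE t t0) (v_mild t x t0); congr (_ + _); apply: eq_Rintegral => s.
    by rewrite inE /= in_itv /= => /andP[s0 _]; rewrite uE.
- move=> t x; rewrite le_eqVlt => /orP[/eqP <-|t0]; last first.
    by rewrite heat_pos// heat_neg//; exact: barrier.
  rewrite u0 /heat_semigroup ltxx; apply/andP; split.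
    have [p0|p0] := leP (phi x) 0; last by rewrite mulr0 ltW.
    by rewrite -[leRHS]mul1r ler_wnM2r// ltW.
  have [p0|p0] := leP (phi x) 0; first by rewrite mulr0.
  by rewrite ler_peMl// ltW.
- move=> t t0; apply/Lq_norm_pinftyP; apply: aeW => x.
  rewrite EFinM -muleA; apply: u_norm => //; rewrite EFinM lee_pmul2l ?lte_fin//.
    exact: heat_abs_L1.
  exact: heat_abs_L1.
Qed.

End barrier_solution.

Theorem theorem2p7 (R : realType) (n : nat) (f : R -> R) :
  (0 < n)%N ->
  locally_lipschitz f -> {homo f : x y / x <= y} -> f 0 = 0 ->
  (\int[lebesgue_measure]_(s in `]0%R, 1%R[)
     (s `^ (- (1 + 2 / n%:R)) * ell f s)%:E < +oo)%E ->
  forall A : R, 1 < A ->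
  exists2 delta : R, 0 < delta &
    forall phi : 'rV[R]_n -> R,
      phi \in Lfun (lebesgue_row R n) 1%E ->
      phi \in Lfun (lebesgue_row R n) +oo%E ->
      (Lq_norm 1 phi + Lq_norm +oo phi <= delta%:E)%E ->
      exists u : R -> 'rV[R]_n -> R,
        [/\ maximal_solution f phi +oo%E u,
            forall t x, 0 <= t ->
              A * heat_semigroup t (fun y => Num.min (phi y) 0) x <= u t x
              <= A * heat_semigroup t (fun y => Num.max (phi y) 0) x
          & forall t, 0 < t ->
              (Lq_norm +oo (u t) <=
               (A * t `^ (- (n%:R / 2)))%:E * Lq_norm 1 phi)%E].
Proof.
move=> n0 f_lip f_mono f0 ell_int A A1.
have A0 : 0 < A := lt_trans ltr01 A1.
have n2 : 0 < 2 / n%:R :> R by rewrite divr_gt0// ltr0n.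
have kappa0 : 0 < 1 - A^-1 by rewrite subr_gt0 invf_lt1.
have [b b0 Lambda_int] := stretched_integral_small n2
  (fun s t => ell_mono f_lip f_mono f0 (x := s) (y := t)) (ell_ge0 f_lip f_mono f0) ell_int kappa0.
exists (b / A); first exact: divr_gt0.
move=> phi /sub_Lfun_mfun/set_mem mphi _ phi_small.
exact: (global_solution_between_barriers f_lip f_mono f0 A1 b0 Lambda_int mphi phi_small).
Qed.
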